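(* Let $d\geq 2$. Let $\Omega\subset\mathbb{R}^{d}$ be a bounded $C^{1}$ domain and suppose that $\Omega=\Omega^{+}\cup\Gamma\cup\Omega^{-}$, where $\Omega^{+},\Omega^{-}$ are disjoint open sets and $\Gamma=\Omega\cap\partial\Omega^{+}=\Omega\cap\partial\Omega^{-}$ is a $(d-1)$-surface of class $C^{1}$. Further, assume that $y^{+}\in C^{1}(\overline{\Omega^{+}},\mathbb{R}^{d})$ and $y^{-}\in C^{1}(\overline{\Omega^{-}},\mathbb{R}^{d})$, and let $n\in C(\Gamma,\mathbb{R}^{d})$ be the outward unit normal to $\Gamma$ with respect to $\Omega^{+}$. Consider the following two conditions. (A) There exists a map $z\in W^{1,\infty}(\Omega,\mathbb{R}^{d})$ such that $$Dz(x)=\begin{cases}Dy^{+}(x), & x\in\Omega^{+},\\ Dy^{-}(x), & x\in\Omega^{-}.\end{cases}$$ (B) There exists $a\in C(\Gamma,\mathbb{R}^{d})$ such that for all $x\in\Gamma$, $$Dy^{+}(x)=Dy^{-}(x)+a(x)\otimes n(x).$$ Then (A) implies (B). Conversely, if $\Gamma$ is connected or $\Omega$ is simply connected, then (B) implies (A).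
   Context: A domain is an open and connected subset of $\mathbb{R}^d$. $D$ denotes the (weak) gradient, and for vectors $a,n$ the matrix $a\otimes n$ has entries $(a\otimes n)_{ij}=a_in_j$. For an open set $O\subset\mathbb{R}^d$, a function $y:O\to\mathbb{R}$ belongs to $C^{1}(\overline{O})$ if $y\in C^{1}(O)$ and $y$ can be extended to a continuously differentiable function on an open set containing $\overline{O}$; $C^{1}(\overline{O},\mathbb{R}^{d})$ consists of the maps all of whose components lie in $C^{1}(\overline{O})$. On $\Gamma$, $Dy^{\pm}$ means the gradient of such an extension (equivalently the continuous extension of $Dy^\pm$ from $\Omega^\pm$). A domain $\Omega$ is of class $C^{k}$ (a $C^k$ domain) if for each $\xi\in\partial\Omega$ there exist $r>0$, a Cartesian coordinate system in $B(\xi,r)$ with coordinates $(\bar{x},x_d)$, $\bar{x}=(x_1,\ldots,x_{d-1})$, and a $C^{k}$ function $g:\mathbb{R}^{d-1}\to\mathbb{R}$ such that $\Omega\cap B(\xi,r)=\{x\in B(\xi,r):x_d>g(\bar{x})\}$ and $\partial\Omega\cap B(\xi,r)=\{x\in B(\xi,r):x_d=g(\bar{x})\}$. A $(d-1)$-surface $\Gamma$ is a relatively compact manifold of dimension $d-1$ embedded in $\mathbb{R}^{d}$ such that $\Gamma=\mathrm{int}\,\Gamma$, in the sense that every point of $\Gamma$ has an open neighbourhood in $\Gamma$ homeomorphic to a ball in $\mathbb{R}^{d-1}$. It is of class $C^{k}$ if for each $\xi\in\Gamma$ there exist $r>0$, a Cartesian coordinate system in $B(\xi,r)$ with coordinates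 $(\bar{x},x_d)$, and a $C^{k}$ function $g:\mathbb{R}^{d-1}\to\mathbb{R}$ such that $\Gamma\cap B(\xi,r)=\{x\in B(\xi,r):x_d=g(\bar{x})\}$. *)

(* Defs.v *)
From HB Require Import structures.
From mathcomp Require Import all_boot all_order all_algebra.
From mathcomp Require Import all_classical all_reals all_analysis.

Set Implicit Arguments.
Unset Strict Implicit.
Unset Printing Implicit Defensive.
Import Order.TTheory GRing.Theory Num.Theory.
Import numFieldNormedType.Exports.

Local Open Scope classical_set_scope.
Local Open Scope ring_scope.

(* 'rV[R]_n carries the product sigma-algebra of its coordinates, which is its
   Borel sigma-algebra. *)
Section measurable_rV.
Variables (R : realType) (n : nat).

Let coord (i : 'I_n) (v : 'rV[R]_n) : R := v ord0 i.

Let rV_set0 : g_sigma_preimage coord set0.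
Proof. exact: sigma_algebra0. Qed.

Let rV_setC A : g_sigma_preimage coord A -> g_sigma_preimage coord (~` A).
Proof. exact: sigma_algebraC. Qed.

Let rV_bigcup (F : (set 'rV[R]_n)^nat) :
  (forall i, g_sigma_preimage coord (F i)) ->
  g_sigma_preimage coord (\bigcup_i (F i)).
Proof. exact: sigma_algebra_bigcup. Qed.

HB.instance Definition _ := @isMeasurable.Build default_measure_display
  'rV[R]_n (g_sigma_preimage coord) rV_set0 rV_setC rV_bigcup.

Lemma measurable_coord (i : 'I_n) :
  measurable_fun [set: 'rV[R]_n] (fun v : 'rV[R]_n => v ord0 i).
Proof.
move=> _ Y mY; rewrite setTI; apply: sub_sigma_algebra => /=.
rewrite -bigcup_seq/=; exists i => /=; first by rewrite mem_index_enum.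
by exists Y => //; rewrite setTI.
Qed.

Lemma measurable_fun_rVP d (T : measurableType d) (f : T -> 'rV[R]_n) :
  (forall i, measurable_fun [set: T] (fun x => f x ord0 i)) ->
  measurable_fun [set: T] f.
Proof.
move=> mf _ A mA; rewrite setTI.
have sub : g_sigma_preimage (fun i => coord i \o f) `<=` measurable.
  apply: smallest_sub; first exact: sigma_algebra_measurable.
  move=> B; rewrite -bigcup_seq/= => -[i _ [C mC <-]].
  exact: mf.
by apply: sub; rewrite g_sigma_preimage_comp; exists A => //; rewrite setTI.
Qed.

End measurable_rV.

(* Lebesgue measure on 'rV[R]_n as an iterated product measure, transported
   along 'rV_n.+1 = R * 'rV_n; lebesgue_rV_box computes it on boxes. *)
Section lebesgue_measure_rV.
Variable R : realType.

Definition rV_cons n (p : measurableTypeR R * 'rV[R]_n) : 'rV[R]_n.+1 :=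
  \row_i oapp (fun j => p.2 ord0 j) p.1 (unlift ord0 i).

Definition rV_uncons n (v : 'rV[R]_n.+1) : measurableTypeR R * 'rV[R]_n :=
  (v ord0 ord0, \row_j v ord0 (lift ord0 j)).

Lemma rV_cons0 n p : @rV_cons n p ord0 ord0 = p.1.
Proof. by rewrite mxE unlift_none. Qed.

Lemma rV_consS n p j : @rV_cons n p ord0 (lift ord0 j) = p.2 ord0 j.
Proof. by rewrite mxE liftK. Qed.

Lemma rV_consK n : cancel (@rV_cons n) (@rV_uncons n).
Proof.
move=> [a v]; rewrite /rV_uncons rV_cons0; congr pair.
by apply/rowP => j; rewrite mxE rV_consS.
Qed.

Lemma measurable_rV_cons n : measurable_fun setT (@rV_cons n).
Proof.
apply: measurable_fun_rVP => i; case: (unliftP ord0 i) => [j|] ->.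
- rewrite (_ : (fun _ => _) = (fun v : 'rV[R]_n => v ord0 j) \o snd).
    exact: measurableT_comp (measurable_coord j) measurable_snd.
  by apply/funext => p /=; rewrite rV_consS.
- rewrite (_ : (fun _ => _) = fst); first exact: measurable_fst.
  by apply/funext => p /=; rewrite rV_cons0.
Qed.

Lemma measurable_rV_uncons n : measurable_fun setT (@rV_uncons n).
Proof.
apply: measurable_fun_pair; first exact: measurable_coord.
apply: measurable_fun_rVP => i.
rewrite (_ : (fun _ => _) = fun v : 'rV[R]_n.+1 => v ord0 (lift ord0 i)).
  exact: measurable_coord.
by apply/funext => v; rewrite mxE.
Qed.

Section step.
Variables (n : nat) (mu : {sigma_finite_measure set 'rV[R]_n -> \bar R}).
Local Open Scope ereal_scope.

Definition lebesgue_rV_step : set 'rV[R]_n.+1 -> \bar R :=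
  pushforward (@lebesgue_measure R \x mu) (@rV_cons n).

Let step0 : lebesgue_rV_step set0 = 0.
Proof. by rewrite /lebesgue_rV_step /pushforward preimage_set0 measure0. Qed.

Let step_ge0 A : 0 <= lebesgue_rV_step A.
Proof. by rewrite /lebesgue_rV_step /pushforward; apply: measure_ge0. Qed.

Let mcons A : measurable A -> measurable (@rV_cons n @^-1` A).
Proof. by move=> mA; rewrite -[X in measurable X]setTI; exact: measurable_rV_cons. Qed.

Let step_sigma_additive : semi_sigma_additive lebesgue_rV_step.
Proof.
move=> F mF tF mUF; rewrite /lebesgue_rV_step /pushforward preimage_bigcup.
apply: measure_semi_sigma_additive.
- by move=> k; exact: mcons.
- apply/trivIsetP => /= i j _ _ ij; rewrite -preimage_setI.
  by move/trivIsetP : tF => /(_ _ _ _ _ ij) ->//; rewrite preimage_set0.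
- by rewrite -preimage_bigcup; exact: mcons.
Qed.

HB.instance Definition _ := isMeasure.Build _ _ _
  lebesgue_rV_step step0 step_ge0 step_sigma_additive.

Let step_sigma_finite : sigma_finite setT lebesgue_rV_step.
Proof.
have /sigma_finiteP[F [FT ndF Foo]] := sigma_finiteT (@lebesgue_measure R).
have /sigma_finiteP[G [GT ndG Goo]] := sigma_finiteT mu.
exists (fun k => @rV_uncons n @^-1` (F k `*` G k)).
  apply/seteqP; split => // v _.
  have [i _ Fi] : (\bigcup_i F i) (rV_uncons v).1 by rewrite -FT.
  have [j _ Gj] : (\bigcup_i G i) (rV_uncons v).2 by rewrite -GT.
  exists (maxn i j) => //; split.
    by move: Fi; exact/subsetPset/ndF/leq_maxl.
  by move: Gj; exact/subsetPset/ndG/leq_maxr.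
move=> k; have [mF Fk] := Foo k; have [mG Gk] := Goo k; split.
  rewrite -[X in measurable X]setTI; apply: measurable_rV_uncons => //.
  exact: measurableX.
rewrite /lebesgue_rV_step /pushforward -comp_preimage.
rewrite (_ : _ \o _ = id); last by apply/funext => p /=; rewrite rV_consK.
by rewrite preimage_id product_measure1E// lte_mul_pinfty// ge0_fin_numE.
Qed.

HB.instance Definition _ := Measure_isSigmaFinite.Build _ _ _
  lebesgue_rV_step step_sigma_finite.

End step.

Fixpoint lebesgue_rV n : {sigma_finite_measure set 'rV[R]_n -> \bar R} :=
  match n with
  | 0 => \d_(0 : 'rV[R]_0)
  | n.+1 => lebesgue_rV_step (lebesgue_rV n)
  end.

Lemma lebesgue_rV_box n (a b : 'rV[R]_n) :
  (forall i, a ord0 i <= b ord0 i) ->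
  lebesgue_rV n [set x : 'rV[R]_n | forall i, a ord0 i <= x ord0 i <= b ord0 i] =
  (\prod_(i < n) (b ord0 i - a ord0 i))%:E.
Proof.
elim: n a b => [|n IH] a b ab.
  rewrite big_ord0 /= diracE mem_set //.
  by case.
pose a' := (rV_uncons a).2; pose b' := (rV_uncons b).2.
transitivity ((@lebesgue_measure R \x lebesgue_rV n)%E
    (`[a ord0 ord0, b ord0 ord0]%classic `*`
     [set x : 'rV[R]_n | forall i, a' ord0 i <= x ord0 i <= b' ord0 i])).
  apply: (congr1 (@lebesgue_measure R \x lebesgue_rV n)%E).
  apply/seteqP; split => [[t x] /= H|[t x] /= [t01 H] i].
    split; first by have := H ord0; rewrite rV_cons0 in_itv.
    by move=> i; have := H (lift ord0 i); rewrite rV_consS !mxE.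
  case: (unliftP ord0 i) => [j|] ->; last by rewrite rV_cons0; move: t01; rewrite in_itv.
  by have := H j; rewrite rV_consS !mxE.
have mbox : measurable [set x : 'rV[R]_n | forall i, a' ord0 i <= x ord0 i <= b' ord0 i].
  rewrite (_ : mkset _ = \bigcap_(i in [set: 'I_n])
    ((fun x : 'rV[R]_n => x ord0 i) @^-1` `[a' ord0 i, b' ord0 i])).
    apply: fin_bigcap_measurable => // i _.
    by rewrite -[X in measurable X]setTI; exact: measurable_coord.
  apply/seteqP; split => [x /= H i _|x /= H i]; rewrite /= ?in_itv//=.
  by have := H i I; rewrite /= in_itv.
rewrite product_measure1E// IH; last by move=> i; rewrite !mxE.
rewrite big_ord_recl EFinM; congr (_ * _)%E; last first.
  by congr EFin; apply: eq_bigr => i _; rewrite !mxE.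
have /= -> := @lebesgue_measure_itv R `[a ord0 ord0, b ord0 ord0].
rewrite lte_fin; case: ltP => [//|ba]; have -> : a ord0 ord0 = b ord0 ord0.
  by apply/eqP; rewrite eq_le ba ab.
by rewrite subrr.
Qed.

End lebesgue_measure_rV.

Section euclidean.
Context {R : realType} {n : nat}.
Implicit Types u v x : 'rV[R]_n.

Definition dotp u v : R := \sum_i u ord0 i * v ord0 i.

(* the library norm on matrices is the sup norm *)
Definition enorm u : R := Num.sqrt (dotp u u).

Definition eball x (r : R) : set 'rV[R]_n := [set y | enorm (y - x) < r].

Definition tensor u v : 'M[R]_n := \matrix_(i, j) (u ord0 i * v ord0 j).

Definition basis (j : 'I_n) : 'rV[R]_n := delta_mx ord0 j.

End euclidean.

Section topological_notions.

Definition boundary (T : topologicalType) (A : set T) : set T :=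
  closure A `\` interior A.

Definition homeomorphic (T U : topologicalType) (A : set T) (B : set U) :=
  exists f : T -> U, exists g : U -> T,
    [/\ {within A, continuous f} /\ {within B, continuous g},
        (forall x, A x -> B (f x)), (forall y, B y -> A (g y)),
        (forall x, A x -> g (f x) = x) & (forall y, B y -> f (g y) = y)].

Definition path_connected (R : realType) (T : topologicalType) (A : set T) :=
  forall x y, A x -> A y -> exists c : R -> T,
    [/\ {within `[0, 1]%classic, continuous c}, c 0 = x, c 1 = y
      & forall t, 0 <= t <= 1 -> A (c t)].

(* every loop in A is homotopic in A, relative to its base point, to a
   constant loop; H (s, t) is the position at time t of the s-th loop *)
Definition simply_connected (R : realType) (T : topologicalType) (A : set T) :=
  path_connected R A /\
  forall c : R -> T, {within `[0, 1]%classic, continuous c} ->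
    (forall t, 0 <= t <= 1 -> A (c t)) -> c 0 = c 1 ->
    exists H : R * R -> T,
      [/\ {within `[0, 1]%classic `*` `[0, 1]%classic, continuous H},
          (forall s t, 0 <= s <= 1 -> 0 <= t <= 1 -> A (H (s, t))),
          (forall t, 0 <= t <= 1 -> H (0, t) = c t /\ H (1, t) = c 0)
        & (forall s, 0 <= s <= 1 -> H (s, 0) = c 0 /\ H (s, 1) = c 0)].

End topological_notions.

Section smoothness.
Context {R : realType} {n : nat}.
Implicit Types (O U : set 'rV[R]_n) (f : 'rV[R]_n -> R).

(* C^k on an open set U; only the values of f on U matter *)
Fixpoint Ck (k : nat) U f : Prop :=
  match k with
  | 0 => forall x, U x -> {for x, continuous f}
  | k.+1 => (forall x, U x -> differentiable f x) /\
            forall j, Ck k U (fun x => 'D_(basis j) f x)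
  end.

Definition C1_extension O f : set ('rV[R]_n -> R) :=
  [set F | exists U, [/\ open U, closure O `<=` U, Ck 1 U F
                       & forall x, O x -> F x = f x]].

Definition C1_closure O f := Ck 1 O f /\ C1_extension O f !=set0.

End smoothness.

Section vector_smoothness.
Context {R : realType} {n : nat}.
Implicit Types (O : set 'rV[R]_n) (y : 'rV[R]_n -> 'rV[R]_n).

Definition cpt y (i : 'I_n) : 'rV[R]_n -> R := fun x => y x ord0 i.

Definition C1_closure_vec O y := forall i, C1_closure O (cpt y i).

(* row i is the gradient of y_i: the transpose of the library's 'J y x *)
Definition Dmx y x : 'M[R]_n := \matrix_(i, j) 'D_(basis j) (cpt y i) x.

(* The gradient, at a point of the closure of O, of a C^1 extension of y past
   the closure of O; by continuity it does not depend on the extension. *)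
Definition Dmx_closure O y x : 'M[R]_n :=
  \matrix_(i, j) 'D_(basis j) (xget (cpt y i) (C1_extension O (cpt y i))) x.

End vector_smoothness.

Section domains_and_surfaces.
Context {R : realType} {m : nat}.
Implicit Types (Om Gam Omp : set 'rV[R]_m.+1) (x p xi : 'rV[R]_m.+1).

(* the ambient space is R^d with d = m.+1 *)

Definition is_domain Om := open Om /\ connected Om.

(* Coordinates of x in the Cartesian system with origin p whose axes are the
   columns of the orthogonal matrix Q. *)
Definition cartesian (Q : 'M[R]_m.+1) := Q *m Q^T = 1%:M.
Definition coords p Q x : 'rV[R]_m.+1 := (x - p) *m Q.
Definition xbar x : 'rV[R]_m := \row_j x ord0 (widen_ord (leqnSn m) j).
Definition xlast x : R := x ord0 ord_max.

Definition Ck_domain k Om :=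
  is_domain Om /\
  forall xi, boundary Om xi ->
  exists r : R, exists p, exists Q, exists g : 'rV[R]_m -> R,
    [/\ 0 < r, cartesian Q, Ck k setT g,
        Om `&` eball xi r = [set x | eball xi r x /\
          g (xbar (coords p Q x)) < xlast (coords p Q x)]
      & boundary Om `&` eball xi r = [set x | eball xi r x /\
          xlast (coords p Q x) = g (xbar (coords p Q x))]].

Definition is_surface Gam :=
  compact (closure Gam) /\
  forall x, Gam x -> exists U, [/\ open U, U x &
    homeomorphic (Gam `&` U) (eball (0 : 'rV[R]_m) 1)].

Definition Ck_surface k Gam :=
  is_surface Gam /\
  forall xi, Gam xi ->
  exists r : R, exists p, exists Q, exists g : 'rV[R]_m -> R,
    [/\ 0 < r, cartesian Q, Ck k setT g
      & Gam `&` eball xi r = [set x | eball xi r x /\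
          xlast (coords p Q x) = g (xbar (coords p Q x))]].

Definition tangent Gam x : set 'rV[R]_m.+1 :=
  [set v | exists c : R -> 'rV[R]_m.+1,
     [/\ c 0 = x, \forall t \near (0 : R), Gam (c t) & is_derive (0 : R) (1 : R) c v]].

Definition outward_unit_normal Gam Omp (nu : 'rV[R]_m.+1 -> 'rV[R]_m.+1) :=
  {within Gam, continuous nu} /\
  forall x, Gam x ->
    [/\ enorm (nu x) = 1,
        forall v, tangent Gam x v -> dotp v (nu x) = 0
      & \forall t \near 0^'+,
          Omp (x - t *: nu x) /\ ~ Omp (x + t *: nu x)].

End domains_and_surfaces.

Section sobolev.
Context {R : realType} {n : nat}.
Implicit Types (Om : set 'rV[R]_n) (f h phi : 'rV[R]_n -> R)
  (z : 'rV[R]_n -> 'rV[R]_n) (G : 'rV[R]_n -> 'M[R]_n).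
Local Notation mu := (lebesgue_rV R n).

Definition locally_integrable_rV Om f :=
  measurable_fun Om f /\
  forall K, compact K -> K `<=` Om -> mu.-integrable K (EFin \o f).

Definition Linfty Om f :=
  measurable_fun Om f /\ (Lnorm mu +oo (EFin \o (f \_ Om)) < +oo)%E.

Definition test_function Om phi :=
  (forall k, Ck k setT phi) /\
  exists K, [/\ compact K, K `<=` Om & forall x, ~ K x -> phi x = 0].

Definition weak_partial Om (j : 'I_n) f h :=
  [/\ locally_integrable_rV Om f, locally_integrable_rV Om h &
      forall phi, test_function Om phi ->
        \int[mu]_(x in Om) (f x * 'D_(basis j) phi x) =
        - \int[mu]_(x in Om) (h x * phi x)].

Definition weak_gradient Om z G :=
  forall i j, weak_partial Om j (cpt z i) (fun x => G x i j).

Definition W1oo Om z :=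
  (forall i, Linfty Om (cpt z i)) /\
  exists2 G, weak_gradient Om z G & forall i j, Linfty Om (fun x => G x i j).

End sobolev.

Section conditions.
Context {R : realType} {m : nat}.
Implicit Types (Om Omp Omm Gam : set 'rV[R]_m.+1)
  (yp ym nu : 'rV[R]_m.+1 -> 'rV[R]_m.+1).

Definition glued_gradient Om Omp Omm yp ym :=
  exists2 z, W1oo Om z & exists2 G, weak_gradient Om z G &
    {ae lebesgue_rV R m.+1, forall x,
      (Omp x -> G x = Dmx yp x) /\ (Omm x -> G x = Dmx ym x)}.

Definition rank_one_jump Omp Omm Gam yp ym nu :=
  exists2 a : 'rV[R]_m.+1 -> 'rV[R]_m.+1, {within Gam, continuous a} &
    forall x, Gam x ->
      Dmx_closure Omp yp x = Dmx_closure Omm ym x + tensor (a x) (nu x).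

End conditions.

(* Main.v *)
Require Import Defs.
From HB Require Import structures.
From mathcomp Require Import all_boot all_order all_algebra.
From mathcomp Require Import all_classical all_reals all_analysis.
From mathcomp Require Import measurable_realfun ess_sup_inf ring lra.
Import Order.TTheory GRing.Theory Num.Theory.
Import numFieldNormedType.Exports.
Set Implicit Arguments.
Unset Strict Implicit.
Unset Printing Implicit Defensive.
Local Open Scope classical_set_scope.
Local Open Scope ring_scope.

(* (A) => (B). Near x0 in Gam the surface is flat, so that two opposite cones
   around the normal line lie in Omp and Omm. Let tau be tangent at x0. After
   mollification at a scale that keeps all points involved inside the cones,
   the increments of z along a parallel to s tau on either side are close to
   s Dy+ tau and s Dy- tau, whereas crossing Gam at a height w s costs at most
   O(w s), since Dz is bounded. Letting w -> 0 gives Dy+ tau = Dy- tau: the jump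
   of the gradient kills the tangent space, so it is a (x) nu.

   (B) => (A). In a chart of Gam the function y+ - y- has a vanishing tangential
   gradient, hence it is locally constant along Gam. If Gam is connected, one
   constant matches the two functions. In general the increments of y+ and y-,
   glued across Gam, form a cocycle on Om, which has a potential z when Om is
   simply connected. This z is locally Lipschitz and, Om being a bounded C^1
   domain, bounded; it is classically differentiable off the null set Gam, and
   its pointwise derivatives are its weak ones by translating difference
   quotients. *)

(** In (A) pointwise values of z carry no information and its gradients are known only almost
    everywhere. Mollification turns an almost everywhere bound on a directional weak derivative into
    a bound on increments, by the mean value theorem. One radius is fixed together with the
    parallelogram, and the mollifier is not normalised: its mass is a common positive factor that is
    divided out at the end, so no limit of mollifications is taken. Which cone lies in [Omp] is
    decided by the side condition on [nu]: a cone misses [Gam] and is convex, so one point of it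
    settles the whole cone.

    For the converse, the increments are those of C^1 extensions past the closures: both then make
    sense at a point of [Gam], and they stay Lipschitz up to the boundary of [Om]. If [Gam] has
    several components, the constants matching y+ and y- across them may be incompatible around a
    loop; this is the obstruction that simple connectedness removes. Working with increments between
    nearby points makes it unnecessary to describe the components of [Omp], [Omm] and [Gam]. *)

(** * Connectedness, interval induction and compactness *)

Section topology.

(** The level set through [x] is relatively open and closed: interiors of the sets where [A q]
    forces equality, or inequality, cut out the level set and its complement. The codomain carries
    no topology, so [cone_one_side] can take it to be [Prop]. *)
Lemma locally_constant_connected (T : topologicalType) (U : Type) (A : set T)
    (f : T -> U) : connected A ->
  (forall x, A x -> \forall y \near x, A y -> f y = f x) ->
  forall x y, A x -> A y -> f x = f y.
Proof.
move=> cA fA x y Ax Ay.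
pose B := [set q | A q /\ f q = f x].
suff BA : B = A by move: Ay; rewrite -BA => -[_ ->].
have oB (P : U -> Prop) : open (interior [set q | A q -> P (f q)]).
  exact: open_interior.
apply: cA.
- by exists x.
- exists (interior [set q | A q -> f q = f x]); first exact: (oB (eq^~ (f x))).
  apply/seteqP; split => q.
    move=> [Aq fq]; split=> //; have := fA _ Aq.
    by apply: filterS => r + Ar => /(_ Ar) ->.
  by move=> [Aq /nbhs_singleton/(_ Aq)].
- exists (~` interior [set q | A q -> f q <> f x]).
    by apply: open_closedC; exact: (oB (fun u => u <> f x)).
  apply/seteqP; split => q.
    by move=> [Aq fq]; split=> // /nbhs_singleton/(_ Aq).
  move=> [Aq nq]; split=> //; apply: contrapT => fq; apply: nq.
  by have := fA _ Aq; apply: filterS => r + Ar => /(_ Ar) ->.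
Qed.

Lemma connected_segment (R : realType) (a b : R) : connected `[a, b]%classic.
Proof. by apply/connected_intervalP; exact: interval_is_interval. Qed.

(* Cousin's lemma *)
Lemma interval_induction (R : realType) (P : R -> R -> Prop) (a b : R) : a <= b ->
  (forall u v w, a <= u -> u <= v -> v <= w -> w <= b -> P u v -> P v w -> P u w) ->
  (forall x, a <= x <= b -> exists2 e, 0 < e & forall u v,
    a <= u -> u <= x -> x <= v -> v <= b -> x - e < u -> v < x + e -> P u v) ->
  P a b.
Proof.
move=> ab glue loc.
pose S := [set x | a <= x <= b /\ P a x].
have Sa : S a.
  split; first by rewrite lexx.
  have [|e e0 he] := loc a; first by rewrite lexx.
  by apply: he; rewrite ?lexx//; lra.
have hs : has_sup S.
  by split; [exists a|exists b => x [] /andP[]].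
set s := sup S.
have sa : a <= s by apply: ub_le_sup => //; case: hs.
have sb : s <= b by apply: ge_sup; [exists a|move=> x [] /andP[]].
have [|e e0 he] := loc s; first by rewrite sa.
have [x [/andP[ax xb] Pax] sx] := sup_adherent e0 hs.
have xs : x <= s by apply: ub_le_sup; [case: hs|split; rewrite ?ax].
have Pas : P a s by apply: (glue a x s) => //; apply: he => //; lra.
have [sb'|] := ltP s b; last first.
  by move=> bs; have -> : b = s by apply/le_anti; rewrite sb bs.
pose v := Order.min b (s + e / 2).
have sv : s < v by rewrite lt_min sb' /=; lra.
have vb : v <= b by rewrite ge_min lexx.
have ve : v < s + e by rewrite gt_min; apply/orP; right; lra.
have Sv : S v.
  split; first by rewrite vb andbT; lra.
  by apply: (glue a s v) => //; [lra|apply: he => //; lra].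
by have := ub_le_sup (let: conj _ h := hs in h) Sv; rewrite -/s leNgt sv.
Qed.

(** Monotonicity lets all large constants work near each point, and compactness, in its
    near-covering form for the filter at +oo, makes one of them work everywhere. [P] will be a bound
    on values, on norms or on slopes. *)
Lemma compact_bound (R : realType) (T : topologicalType) (K : set T)
    (P : R -> T -> Prop) : compact K ->
  (forall x a b, a <= b -> P a x -> P b x) ->
  (forall x, K x -> exists M, \forall y \near x, P M y) ->
  exists M, forall x, K x -> P M x.
Proof.
move=> /compact_near_coveringP cK Pmono KP.
have /(_ _) := cK R +oo P _.
move=> /(_ _) [x Kx|M [Mr hM]].
  have [M hM] := KP x Kx.
  near=> y N => /=.
  apply: (Pmono _ M); first by near: N; apply: nbhs_pinfty_ge; rewrite num_real.
  by near: y.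
exists (M + 1) => x Kx; apply: hM => //; lra.
Unshelve. all: by end_near. Qed.

End topology.

(** * Pointwise slope bounds and the mean value inequality *)

Section normed.
Variables (R : realType) (V : normedModType R).
Implicit Types (f : V -> R) (x y : V) (L : R).

(** Only increments based at [x] itself are bounded, which is weaker than being Lipschitz near [x];
    this is the kind of control that a potential offers. *)
Definition slope_le L f x := \forall y \near x, `|f y - f x| <= L * `|y - x|.

Lemma slope_le_mono L L' f x : L <= L' -> slope_le L f x -> slope_le L' f x.
Proof.
move=> LL; apply: filterS => y /le_trans; apply.
by rewrite ler_wpM2r.
Qed.

Lemma near_segment (P : set V) x v (t : R) :
  (\forall y \near x + t *: v, P y) -> \forall s \near t, P (x + s *: v).
Proof.
move=> h; have : continuous (fun s : R => x + s *: v).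
  move=> s; apply: cvgD; first exact: cvg_cst.
  by apply: cvgZr_tmp; exact: cvg_id.
by move=> /(_ t); exact.
Qed.

Lemma near_itv (P : set R) (t : R) : (\forall s \near t, P s) ->
  exists2 e, 0 < e & forall s, t - e < s -> s < t + e -> P s.
Proof.
move=> /nbhs_ballP[e /= e0 h]; exists e => // s s1 s2; apply: h.
by rewrite /ball /= ltr_norml; lra.
Qed.

(** A mean value inequality without derivatives: the bound is additive over adjacent intervals, and
    on a short interval around [t] it follows by passing through [t]. *)
Lemma slope_le_segment L f x y :
  (forall t, 0 <= t <= 1 -> slope_le L f (x + t *: (y - x))) ->
  `|f y - f x| <= L * `|y - x|.
Proof.
move=> h; pose c (t : R) := x + t *: (y - x).
pose P u v := `|f (c v) - f (c u)| <= L * (v - u) * `|y - x|.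
suff : P 0 1.
  by rewrite /P /c scale0r scale1r addr0 subrKC subr0 mulr1.
apply: (@interval_induction R P) => //; rewrite /P.
  move=> u v w _ uv vw _ h1 h2.
  rewrite (_ : f _ - f _ = (f (c w) - f (c v)) + (f (c v) - f (c u))); last by ring.
  apply: (le_trans (ler_normD _ _)); apply: (le_trans (lerD h2 h1)).
  by rewrite -mulrDl le_eqVlt; apply/orP; left; apply/eqP; congr (_ * _); ring.
move=> t t01; have := near_segment (h t t01).
move=> /near_itv[e e0 he]; exists e => // u v _ ut tv _ eu ve.
have hu : `|f (c u) - f (c t)| <= L * `|c u - c t| by apply: he; lra.
have hv : `|f (c v) - f (c t)| <= L * `|c v - c t| by apply: he; lra.
have cc s s' : c s - c s' = (s - s') *: (y - x).
  by rewrite /c opprD addrACA subrr add0r scalerBl.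
move: hu hv; rewrite !cc !normrZ [`|u - t|]distrC.
rewrite (@ger0_norm _ (t - u)) ?subr_ge0// (@ger0_norm _ (v - t)) ?subr_ge0// => hu hv.
rewrite (_ : f _ - f _ = (f (c v) - f (c t)) - (f (c u) - f (c t))); last by ring.
apply: (le_trans (ler_normB _ _)); apply: (le_trans (lerD hv hu)).
by rewrite le_eqVlt; apply/orP; left; apply/eqP; ring.
Qed.

End normed.

(** * Sup norm, countable base and measurability in coordinate space *)

Section rV_norm.
Variables (R : realType) (n : nat).
Implicit Types x y v : 'rV[R]_n.

Lemma coord_norm_le x i : `|x ord0 i| <= `|x|.
Proof.
rewrite [leRHS]/Num.norm /= mx_normrE; apply/bigmax_geP; right => /=.
by exists (ord0, i).
Qed.

Lemma rV_norm_le x (e : R) : 0 <= e -> (forall i, `|x ord0 i| <= e) -> `|x| <= e.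
Proof.
move=> e0 h; rewrite [leLHS]/Num.norm /= mx_normrE; apply/bigmax_leP; split=> //.
by move=> [a b] _ /=; rewrite ord1.
Qed.

Lemma rV_norm_lt x (e : R) : 0 < e -> (forall i, `|x ord0 i| < e) -> `|x| < e.
Proof.
move=> e0 h; rewrite [ltLHS]/Num.norm /= mx_normrE; apply/bigmax_ltP; split=> //.
by move=> [a b] _ /=; rewrite ord1.
Qed.

Lemma nbhs_rVP x (U : set 'rV[R]_n) : nbhs x U <->
  exists2 e : R, 0 < e & forall y : 'rV[R]_n, `|y - x| < e -> U y.
Proof.
split=> [/nbhs_ballP[e /= e0 h]|[e e0 h]].
  by exists e => // y yx; apply: h; rewrite -ball_normE /= distrC.
by apply/nbhs_ballP; exists e => //= y; rewrite -ball_normE /= distrC; exact: h.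
Qed.

(** A countable base. It makes open sets measurable for the product sigma-algebra and lets null sets
    be recognised locally. *)
Definition ratbox (p : 'rV[rat]_n * nat) : set 'rV[R]_n :=
  [set y | forall i, `|y ord0 i - ratr (p.1 ord0 i)| < p.2.+1%:R^-1].

Lemma ratbox_open p : open (ratbox p).
Proof.
suff h (y : 'rV[R]_n) : ratbox p y -> nbhs y (ratbox p) by rewrite openE.
move=> yp; apply/nbhs_rVP.
have [d d0 hd] : exists2 d : R, 0 < d &
    forall i, d <= p.2.+1%:R^-1 - `|y ord0 i - ratr (p.1 ord0 i)|.
  exists (\big[Order.min/1]_i (p.2.+1%:R^-1 - `|y ord0 i - ratr (p.1 ord0 i)|)).
    by apply: lt_bigmin => // i _; rewrite subr_gt0; exact: yp.
  by move=> i; exact: bigmin_le_cond.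
exists d => // z zd i; have di := hd i.
have := coord_norm_le (z - y) i; rewrite !mxE => zi.
rewrite (_ : z ord0 i - _ = (z ord0 i - y ord0 i) + (y ord0 i - ratr (p.1 ord0 i)));
  last by ring.
apply: (le_lt_trans (ler_normD _ _)); move: (p.2.+1%:R^-1) di => t di; lra.
Qed.

Lemma ratbox_measurable p : measurable (ratbox p).
Proof.
rewrite (_ : ratbox p = \bigcap_(i in [set: 'I_n])
  ((fun y : 'rV[R]_n => y ord0 i) @^-1` ball (ratr (p.1 ord0 i) : R) p.2.+1%:R^-1)).
  apply: fin_bigcap_measurable => // i _.
  rewrite -[X in measurable X]setTI; apply: measurable_coord => //.
  exact: measurable_ball.
apply/seteqP; split=> y h i; [move=> _|]; have := h i; rewrite /ball /= distrC//.
by apply.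
Qed.

Lemma ratbox_basis x (U : set 'rV[R]_n) : nbhs x U ->
  exists p, ratbox p x /\ ratbox p `<=` U.
Proof.
move=> /nbhs_rVP[e e0 h].
have [k [t [tE t0 te]]] : exists k, exists t : R, [/\ t = k.+1%:R^-1, 0 < t & t < e / 2].
  exists (Num.truncn (2 / e)), (Num.truncn (2 / e)).+1%:R^-1.
  rewrite invr_gt0; split=> //.
  rewrite -[ltRHS]invrK ltf_pV2 ?posrE ?invr_gt0 ?divr_gt0// invf_div.
  exact: truncnS_gt.
have /choice[q hq] : forall i : 'I_n, exists q : rat,
    `|x ord0 i - ratr q| < t.
  move=> i; have [|q] := @rat_in_itvoo R (x ord0 i - t) (x ord0 i + t).
    by lra.
  by rewrite in_itv /= => /andP[q1 q2]; exists q; rewrite ltr_norml; lra.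
exists (\row_i q i, k); split; first by move=> i /=; rewrite mxE -tE.
move=> y yp; apply: h; apply: rV_norm_lt => // i; rewrite !mxE.
have := yp i; rewrite /= mxE -tE => yi; have := hq i; rewrite distrC => xi.
rewrite (_ : y ord0 i - _ = (y ord0 i - ratr (q i)) + (ratr (q i) - x ord0 i));
  last by ring.
by apply: (le_lt_trans (ler_normD _ _)); lra.
Qed.

Lemma open_measurable_rV (U : set 'rV[R]_n) : open U -> measurable U.
Proof.
move=> oU; rewrite (_ : U = \bigcup_p (if `[< ratbox p `<=` U >] then ratbox p else set0)).
  apply: countable_bigcupT_measurable => [|p]; first exact: countableP.
  by case: ifPn => // _; exact: ratbox_measurable.
apply/seteqP; split => [x Ux|x [p _]].
  have [p [px pU]] := ratbox_basis (open_nbhs_nbhs (conj oU Ux)).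
  by exists p => //; rewrite ifT//; exact/asboolP.
by case: ifPn => // /asboolP; exact.
Qed.

Lemma closed_measurable_rV (U : set 'rV[R]_n) : closed U -> measurable U.
Proof. by move=> /closed_openC/open_measurable_rV/measurableC; rewrite setCK. Qed.

Lemma compact_measurable_rV (U : set 'rV[R]_n) : compact U -> measurable U.
Proof. by move=> /compact_closed h; apply: closed_measurable_rV; exact: h. Qed.

Lemma continuous_measurable_rV (D : set 'rV[R]_n) (f : 'rV[R]_n -> R) :
  open D -> (forall x, D x -> {for x, continuous f}) -> measurable_fun D f.
Proof.
move=> oD cf; apply: (measurability _ (RGenOInfty.measurableE R)).
move=> _ [_ [a ->] <-]; apply: open_measurable_rV.
rewrite openE => x [Dx fx]; apply: filterI; first exact: open_nbhs_nbhs.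
by apply: (cf x Dx); apply: open_nbhs_nbhs; split => //; exact: interval_open.
Qed.

(** A Lindelöf argument: the rational cubes whose trace on [A] is negligible are countably many and
    cover [A]. *)
Lemma locally_negligible (mu : {measure set 'rV[R]_n -> \bar R}) (A : set 'rV[R]_n) :
  (forall x, A x -> exists2 U, nbhs x U & mu.-negligible (A `&` U)) ->
  mu.-negligible A.
Proof.
move=> h.
pose F k := if @unpickle ('rV[rat]_n * nat)%type k is Some p then
  if `[< mu.-negligible (A `&` ratbox p) >] then A `&` ratbox p else set0 else set0.
apply: (@negligibleS _ _ _ _ (\bigcup_k F k)); last first.
  apply: negligible_bigcup => k; rewrite /F.
  case: unpickle => [p|]; last exact: negligible_set0.
  by case: ifPn => [/asboolP//|_]; exact: negligible_set0.
move=> x Ax; have [U xU U0] := h x Ax; have [p [px pU]] := ratbox_basis xU.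
exists (pickle p) => //; rewrite /F pickleK ifT//; apply/asboolP.
by apply: negligibleS U0; exact: setIS.
Qed.

End rV_norm.

(** * Translation invariance of Lebesgue measure *)

Section translation.
Variable R : realType.

Definition translate n (v : 'rV[R]_n) : 'rV[R]_n -> 'rV[R]_n := fun x => x + v.

Lemma measurable_translate n (v : 'rV[R]_n) : measurable_fun setT (translate v).
Proof.
apply: measurable_fun_rVP => i; under eq_fun do rewrite mxE.
apply: measurable_funD; [exact: measurable_coord|exact: measurable_cst].
Qed.

HB.instance Definition _ n (v : 'rV[R]_n) :=
  isMeasurableFun.Build _ _ _ _ (translate v) (measurable_translate v).

Definition shiftR (a : R) : measurableTypeR R -> measurableTypeR R := fun x => x + a.

Lemma measurable_shiftR a : measurable_fun setT (shiftR a).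
Proof. by apply: measurable_funD. Qed.

HB.instance Definition _ a :=
  isMeasurableFun.Build _ _ _ _ (shiftR a) (measurable_shiftR a).

Lemma lebesgue_measure_shift a (A : set R) : measurable A ->
  pushforward lebesgue_measure (shiftR a) A = lebesgue_measure A.
Proof.
move=> mA; apply/esym/lebesgue_measure_unique => //= _ [[b c]] _ <-.
rewrite /pushforward (_ : shiftR a @^-1` _ = `]b - a, c - a]%classic).
  rewrite /= !lebesgue_measure_itv /= !lte_fin ltrD2r.
  by case: ifPn => // _; rewrite -!EFinB; congr EFin; ring.
apply/seteqP; split=> x; rewrite /= /shiftR !in_itv /=; lra.
Qed.

Let translate2 n (a : R) (v : 'rV[R]_n) (p : measurableTypeR R * 'rV[R]_n) :
  measurableTypeR R * 'rV[R]_n := (shiftR a p.1, translate v p.2).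

Let measurable_translate2 n a v : measurable_fun setT (@translate2 n a v).
Proof.
apply: measurable_fun_pair.
  by apply: measurableT_comp; [exact: measurable_shiftR|exact: measurable_fst].
by apply: measurableT_comp; [exact: measurable_translate|exact: measurable_snd].
Qed.

HB.instance Definition _ n a v :=
  isMeasurableFun.Build _ _ _ _ (@translate2 n a v) (@measurable_translate2 n a v).

(** Read through [rV_cons], a translation acts on each factor separately; by induction its
    push-forward agrees with the product measure on rectangles, and uniqueness of the product
    measure concludes. *)
Lemma lebesgue_rV_translate n (v : 'rV[R]_n) (A : set 'rV[R]_n) : measurable A ->
  lebesgue_rV R n (translate v @^-1` A) = lebesgue_rV R n A.
Proof.
elim: n v A => [|n IH] v A mA.
  rewrite /= !diracE; congr ((nat_of_bool _)%:R%:E).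
  by apply/idP/idP; rewrite !inE /= /translate; have -> : 0 + v = 0 by apply/rowP => -[].
have mB : measurable (@rV_cons R n @^-1` A).
  by rewrite -[X in measurable X]setTI; exact: measurable_rV_cons.
pose vv := rV_uncons v.
rewrite /= /lebesgue_rV_step /pushforward.
rewrite (_ : _ @^-1` _ = @translate2 n vv.1 vv.2 @^-1` (@rV_cons R n @^-1` A)); last first.
  suff E p : translate v (rV_cons p) = rV_cons (translate2 vv.1 vv.2 p).
    by apply/seteqP; split=> p /=; rewrite E.
  apply/rowP => i; rewrite mxE; case: (unliftP ord0 i) => [j|] ->.
    by rewrite !rV_consS !mxE.
  by rewrite !rV_cons0.
apply/esym; apply: (@product_measure_unique _ _ _ _ _ _ _
  (pushforward (@lebesgue_measure R \x lebesgue_rV R n)%E (translate2 vv.1 vv.2))) => //.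
move=> C D mC mD.
transitivity ((@lebesgue_measure R \x lebesgue_rV R n)%E
  ((shiftR vv.1 @^-1` C) `*` (translate vv.2 @^-1` D))); first by [].
have mC' : measurable (shiftR vv.1 @^-1` C).
  by rewrite -[X in measurable X]setTI; exact: measurable_shiftR.
have mD' : measurable (translate vv.2 @^-1` D).
  by rewrite -[X in measurable X]setTI; exact: measurable_translate.
by rewrite product_measure1E// IH//; congr (_ * _)%E; exact: lebesgue_measure_shift.
Qed.

Local Notation mu n := (lebesgue_rV R n).

Lemma integrable_translate n (v : 'rV[R]_n) (f : 'rV[R]_n -> R) :
  (mu n).-integrable setT (EFin \o f) ->
  (mu n).-integrable setT (EFin \o (fun x => f (x + v))).
Proof.
move=> /integrableP[mf fi]; apply/integrableP; split.
  by apply: (measurableT_comp mf); exact: measurable_translate.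
move: fi; congr (_ < _)%E.
transitivity (\int[pushforward (mu n) (translate v)]_x `|(f x)%:E|)%E.
  by apply: eq_measure_integral => A mA _; exact/esym/lebesgue_rV_translate.
rewrite ge0_integral_pushforward//; exact: measurableT_comp mf.
Qed.

Lemma Rintegral_translate n (v : 'rV[R]_n) (f : 'rV[R]_n -> R) :
  (mu n).-integrable setT (EFin \o f) ->
  \int[mu n]_x f (x + v) = \int[mu n]_x f x.
Proof.
move=> fi; rewrite /Rintegral; congr fine.
have mf : measurable_fun setT (EFin \o f) by case/integrableP : fi.
transitivity (\int[pushforward (mu n) (translate v)]_x (f x)%:E)%E; last first.
  by apply: eq_measure_integral => A mA _; exact: lebesgue_rV_translate.
rewrite (@integral_pushforward _ _ _ _ _ _ (measurable_translate v))//.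
exact: integrable_translate.
Qed.

End translation.

(** * Euclidean balls and charts of a surface *)

Section euclidean_ball.
Variables (R : realType) (n : nat).
Implicit Types u x : 'rV[R]_n.

(** The constant is crude but positive in every dimension, so that [nbhs_eball] may divide by it. *)
Lemma enorm_le u : enorm u <= n.+1%:R * `|u|.
Proof.
rewrite -[leRHS]ger0_norm ?mulr_ge0// -sqrtr_sqr ler_wsqrtr// exprMn.
have le1 : dotp u u <= n%:R * `|u| ^+ 2.
  rewrite -[X in X%:R * _](card_ord n) mulr_natl -sumr_const; apply: ler_sum => i _.
  by rewrite -expr2 -real_normK ?num_real// lerXn2r ?nnegrE// coord_norm_le.
apply: (le_trans le1); rewrite ler_wpM2r ?exprn_ge0// -natrX ler_nat.
by rewrite (leq_trans (leqnSn n))// expnS expn1 leq_pmulr.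
Qed.

Lemma nbhs_eball x (r : R) : 0 < r -> nbhs x (eball x r).
Proof.
move=> r0; apply/nbhs_rVP; exists (r / n.+1%:R); first by rewrite divr_gt0.
move=> y yx; apply: (le_lt_trans (enorm_le _)).
by rewrite mulrC -ltr_pdivlMr.
Qed.

End euclidean_ball.

Section chart.
Variables (R : realType) (m : nat).
Implicit Types (Gam : set 'rV[R]_m.+1) (x p : 'rV[R]_m.+1) (Q : 'M[R]_m.+1).

Lemma cartesian_sum p Q x : cartesian Q ->
  x = p + (\sum_j xbar (coords p Q x) ord0 j *: row (widen_ord (leqnSn m) j) Q^T
      + xlast (coords p Q x) *: row ord_max Q^T).
Proof.
move=> QQ; rewrite -{1}[x](subrKC p); congr (_ + _).
transitivity (\sum_i coords p Q x ord0 i *: row i Q^T).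
  rewrite -mulmx_sum_row /coords -mulmxA.
  by rewrite QQ mulmx1.
rewrite big_ord_recr /=; congr (_ + _ *: _).
by apply: eq_bigr => j _; rewrite [xbar _ _ _]mxE.
Qed.

Lemma cartesian_coords p Q (u : 'rV[R]_m) (t : R) : cartesian Q ->
  let x := p + (\sum_j u ord0 j *: row (widen_ord (leqnSn m) j) Q^T
      + t *: row ord_max Q^T) in
  xbar (coords p Q x) = u /\ xlast (coords p Q x) = t.
Proof.
move=> /mulmx1C QQ x.
pose w : 'rV[R]_m.+1 := \row_i (if unlift ord_max i is Some j then u ord0 j else t).
have wl : w ord0 ord_max = t by rewrite mxE unlift_none.
have wb j : w ord0 (widen_ord (leqnSn m) j) = u ord0 j.
  rewrite mxE (_ : widen_ord _ j = lift ord_max j) ?liftK//.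
  by apply: val_inj; rewrite /= /bump leqNgt ltn_ord.
have -> : coords p Q x = w.
  rewrite /coords /x addrC addKr -[RHS]mulmx1 -QQ mulmxA; congr (_ *m _).
  rewrite mulmx_sum_row big_ord_recr /= wl; congr (_ + _).
  by apply: eq_bigr => j _; rewrite wb.
by split=> //; apply/rowP => j; rewrite mxE wb.
Qed.

Lemma coords_lipschitz p Q x y :
  `|xbar (coords p Q x) - xbar (coords p Q y)| <=
  (\sum_i \sum_j `|Q i j|) * `|x - y|.
Proof.
apply: rV_norm_le => [|j].
  by apply: mulr_ge0 => //; apply: sumr_ge0 => i _; apply: sumr_ge0.
rewrite !mxE -sumrB.
apply: (le_trans (ler_norm_sum _ _ _)); rewrite mulr_suml; apply: ler_sum => k _.
rewrite !mxE -mulrBl opprB addrA subrK normrM mulrC; apply: ler_pM => //.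
  by rewrite (bigD1 (widen_ord (leqnSn m) j)) //= lerDl sumr_ge0.
by have := coord_norm_le (x - y) k; rewrite !mxE.
Qed.

(** [gam] parametrises the graph and [pi] projects to the first [m] coordinates of the frame. Both
    are global maps; only their relation to [Gam] is local. *)
Lemma surface_chart Gam x0 : Ck_surface 1 Gam -> Gam x0 ->
  exists (gam : 'rV[R]_m -> 'rV[R]_m.+1) (pi : 'rV[R]_m.+1 -> 'rV[R]_m) (C : R),
  [/\ forall u, differentiable gam u,
      forall x y, `|pi x - pi y| <= C * `|x - y|,
      gam (pi x0) = x0,
      \forall u \near pi x0, Gam (gam u)
    & \forall y \near x0, Gam y -> gam (pi y) = y].
Proof.
move=> [_ h] G0; have := h _ G0; move: G0 => + [r [p [Q [g [r0 QQ [dg _] GE]]]]].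
pose gam (u : 'rV[R]_m) := p + (\sum_j u ord0 j *: row (widen_ord (leqnSn m) j) Q^T
      + g u *: row ord_max Q^T).
pose pi x := xbar (coords p Q x).
have gpi x : Gam x -> eball x0 r x -> gam (pi x) = x.
  move=> Gx xr; have : (Gam `&` eball x0 r) x by [].
  by rewrite GE => -[_ xl]; rewrite [RHS](cartesian_sum p x QQ) xl.
have dgam u : differentiable gam u.
  apply: differentiableD => //; apply: differentiableD; last first.
    by apply: differentiableZl; exact: dg.
  rewrite (_ : (fun _ => _) = \sum_j (fun u : 'rV[R]_m =>
    u ord0 j *: row (widen_ord (leqnSn m) j) Q^T)).
    apply: differentiable_sum => j; apply: differentiableZl.
    exact: differentiable_coord.
  by apply/funext => v; rewrite fct_sumE.
have r00 := nbhs_eball x0 r0.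
have gx0 : Gam x0 -> gam (pi x0) = x0.
  by move=> G0; apply: gpi => //; exact: nbhs_singleton.
move=> G0; exists gam, pi, (\sum_i \sum_j `|Q i j|); split => // [x y|||].
- exact: coords_lipschitz.
- exact: gx0.
- have cg : {for pi x0, continuous gam} := differentiable_continuous (dgam _).
  have : nbhs (gam (pi x0)) (eball x0 r) by rewrite (gx0 G0).
  move=> /cg; apply: (@filterS _ (nbhs (pi x0))) => u ur.
  suff : (Gam `&` eball x0 r) (gam u) by case.
  rewrite GE; split=> //.
  by have [-> ->] := cartesian_coords p u (g u) QQ.
- by apply: filterS r00 => y yr Gy; exact: gpi.
Qed.

End chart.

(** * Bounded sets have finite measure, surfaces are null sets *)

Section finite_measure.
Variables (R : realType) (n : nat).
Local Notation mu := (lebesgue_rV R n).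

Lemma lebesgue_rV_bounded (A : set 'rV[R]_n) (M : R) : measurable A ->
  (forall x, A x -> `|x| <= M) -> (mu A < +oo)%E.
Proof.
move=> mA AM; pose N := `|M|.
pose box := [set x : 'rV[R]_n |
  forall i, (- const_mx N : 'rV[R]_n) ord0 i <= x ord0 i <= (const_mx N : 'rV[R]_n) ord0 i].
have : (mu box < +oo)%E.
  rewrite lebesgue_rV_box ?ltry// => i.
  by rewrite !mxE (@le_trans _ _ 0) ?oppr_le0 /N.
have mbox : measurable box.
  rewrite (_ : box = \bigcap_(i in [set: 'I_n])
      ((fun x : 'rV[R]_n => x ord0 i) @^-1` `[- N, N])).
    apply: fin_bigcap_measurable => // i _.
    by rewrite -[X in measurable X]setTI; exact: measurable_coord.
  apply/seteqP; split => [x /= H i _|x /= H i]; rewrite /= ?in_itv//=.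
    by have := H i; rewrite !mxE.
  by have := H i I; rewrite /= in_itv !mxE.
apply: le_lt_trans; apply: le_measure; rewrite ?inE//.
move=> x Ax i; rewrite !mxE -ler_norml; apply: (le_trans (coord_norm_le _ _)).
by apply: (le_trans (AM _ Ax)); exact: ler_norm.
Qed.

Lemma compact_norm_bound (K : set 'rV[R]_n) : compact K ->
  exists M, forall x, K x -> `|x| <= M.
Proof.
move=> cK; apply: (compact_bound (P := fun M x => `|x| <= M) cK) => [x a b ab /le_trans|x Kx].
  exact.
exists (`|x| + 1); apply/nbhs_rVP; exists 1 => // y yx.
by rewrite -[y](subrK x) addrC; apply: (le_trans (ler_normD _ _)); rewrite lerD2l ltW.
Qed.

Lemma compact_norm_ball (c : 'rV[R]_n) (r : R) : compact [set x | `|x - c| <= r].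
Proof.
apply: bounded_closed_compact.
  exists (r + `|c|); split; first exact: num_real.
  move=> y ry x /= xc; rewrite -[x](subrK c).
  by apply: (le_trans (ler_normD _ _)); apply: (le_trans (lerD xc (lexx _))); exact: ltW.
rewrite (_ : mkset _ = (fun x : 'rV[R]_n => `|x - c|) @^-1` [set x | x <= r])//.
apply: preimage_closed; last exact: closed_le.
move=> x _; have cs : continuous (fun x : 'rV[R]_n => x - c).
  by move=> y; apply: (@cvgB _ _ _ (nbhs y)); [exact: cvg_id|exact: cvg_cst].
exact: (continuous_comp (@cs x) (@norm_continuous _ _ _)).
Qed.

Lemma bounded_integrable_rV (A : set 'rV[R]_n) (f : 'rV[R]_n -> R) (M C : R) :
  measurable A -> (forall x, A x -> `|x| <= M) -> measurable_fun A f ->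
  (forall x, A x -> `|f x| <= C) -> mu.-integrable A (EFin \o f).
Proof.
move=> mA AM mf fC; apply: measurable_bounded_integrable => //.
  exact: lebesgue_rV_bounded mA AM.
exists C; split; first exact: num_real.
by move=> D CD x Ax; apply: (le_trans (fC _ Ax)); exact: ltW.
Qed.

(* The translates of A by v/(k+1) are pairwise disjoint, of equal measure and
   contained in a bounded set. *)
Lemma disjoint_translates_null (A : set 'rV[R]_n) (v : 'rV[R]_n) (M : R) :
  measurable A -> (forall x, A x -> `|x| <= M) ->
  (forall x t, A x -> A (x + t *: v) -> t = 0) -> mu A = 0.
Proof.
move=> mA AM Av.
pose F k := translate ((k.+1%:R^-1 : R) *: v) @^-1` A.
have mF k : measurable (F k).
  by rewrite -[X in measurable X]setTI; apply: measurable_translate.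
have tF : trivIset setT F.
  apply/trivIsetP => i j _ _ ij; apply/seteqP; split=> // x [Fi Fj].
  have := Av (x + i.+1%:R^-1 *: v) (j.+1%:R^-1 - i.+1%:R^-1) Fi.
  rewrite -addrA -scalerDl [i.+1%:R^-1 + _]addrC subrK => /(_ Fj)/eqP.
  rewrite subr_eq0 (inj_eq invr_inj) eqr_nat eqSS => /eqP ji.
  by move: ij; rewrite ji eqxx.
have UF : (mu (\bigcup_k F k) < +oo)%E.
  apply: (@lebesgue_rV_bounded _ (M + `|v|)).
    exact: bigcupT_measurable.
  move=> x [k _ /AM Fk].
  rewrite -[x](addrK ((k.+1%:R^-1 : R) *: v)); apply: (le_trans (ler_normB _ _)).
  apply: lerD => //; rewrite normrZ ger0_norm// ler_piMl// invf_le1//.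
  by rewrite ler1n.
have mu_n k : (mu A *+ k <= mu (\bigcup_k F k))%E.
  have <- : mu (\big[setU/set0]_(i < k) F i) = (mu A *+ k)%E.
    rewrite measure_semi_additive//.
    - rewrite (eq_bigr (fun=> mu A)) => [|i _]; last exact: lebesgue_rV_translate.
      by rewrite sumr_const card_ord.
    - exact: bigsetU_measurable.
  apply: le_measure; rewrite ?inE//.
  - exact: bigsetU_measurable.
  - exact: bigcupT_measurable.
  - exact: bigsetU_bigcup.
have Ufin : mu (\bigcup_k F k) \is a fin_num by rewrite ge0_fin_numE.
have Afin : mu A \is a fin_num.
  by rewrite ge0_fin_numE//; exact: le_lt_trans (mu_n 1%N) UF.
have a0 : 0 <= fine (mu A) by exact: fine_ge0.
move: mu_n; rewrite -(fineK Ufin) -(fineK Afin).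
move: a0; set a := fine (mu A); set b := fine _ => a0 h.
congr EFin; apply/eqP; rewrite eq_le a0 andbT.
rewrite leNgt; apply/negP => ap.
(* More than [b / a] disjoint copies of measure [a] would exceed the measure [b] of their union. *)
have := h (Num.truncn (b / a)).+1; rewrite -EFin_natmul lee_fin leNgt => /negP; apply.
by rewrite -mulr_natl -ltr_pdivrMr//; exact: truncnS_gt.
Qed.

End finite_measure.

Section surface_null.
Variables (R : realType) (m : nat).

(** A point of a graph leaves it when moved along the last axis. So the piece of [Gam] in a small
    cube inside a chart meets its own translates along this axis only for the zero shift. *)
Lemma surface_negligible (Gam : set 'rV[R]_m.+1) k : Ck_surface k Gam ->
  measurable Gam -> (lebesgue_rV R m.+1).-negligible Gam.
Proof.
move=> [_ h] mG; apply: locally_negligible => x /h [r [p [Q [g [r0 QQ _ GE]]]]].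
have : nbhs x (eball x r `&` ball x 1).
  by apply: filterI; [exact: nbhs_eball|exact: nbhsx_ballx].
move=> /ratbox_basis[q [qx qU]].
exists (ratbox q); first by apply: open_nbhs_nbhs; split => //; exact: ratbox_open.
apply/negligibleP; first by apply: measurableI => //; exact: ratbox_measurable.
apply: (@disjoint_translates_null _ _ _ (row ord_max Q^T) (`|x| + 1)).
- by apply: measurableI => //; exact: ratbox_measurable.
- move=> y [_ /qU[_]]; rewrite -ball_normE /= distrC => yx.
  by rewrite -[y](subrKC x); apply: (le_trans (ler_normD _ _)); rewrite lerD2l ltW.
move=> y t [Gy /qU[yr _]] [Gyt /qU[ytr _]].
have : (Gam `&` eball x r) y by [].
have : (Gam `&` eball x r) (y + t *: row ord_max Q^T) by [].
rewrite GE => -[_ e1] [_ e2]; move: e1.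
pose u := xbar (coords p Q y); pose s := xlast (coords p Q y).
rewrite {1 2}[y](cartesian_sum p y QQ) -!addrA -scalerDl -/u -/s.
have [-> ->] := cartesian_coords p u (s + t) QQ.
by rewrite /s e2 -/u => /eqP; rewrite -subr_eq0 addrC addKr => /eqP.
Qed.

End surface_null.

(** * Differentials, slopes and segments *)

Section differential.
Variables (R : realType) (V : normedModType R).
Implicit Types (f : V -> R) (x v : V).

Lemma differentiable_slope f x (L e : R) : differentiable f x ->
  (forall v, `|'d f x v| <= L * `|v|) -> 0 < e -> slope_le (L + e) f x.
Proof.
move=> df dL e0.
have /eqaddoP/(_ _ e0) := diff_locally df.
rewrite /slope_le (near_shift 0 x); apply: filterS => z /=.
rewrite subr0 addrK => h.
rewrite (_ : _ - f x = (f (z + x) - (f x + 'd f x z)) + 'd f x z); last by ring.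
apply: (le_trans (ler_normD _ _)); rewrite mulrDl addrC; exact: lerD.
Qed.

End differential.

Section differential_line.
Variables (R : realType) (V : normedModType R).
Implicit Types (f : V -> R) (x v : V).

Lemma derivable_slope (F : R -> R) (t a L e : R) : is_derive t 1 F a ->
  `|a| <= L -> 0 < e -> slope_le (L + e) F t.
Proof.
move=> dF aL e0; apply: differentiable_slope => //.
  by apply/derivable1_diffP; exact: ex_derive.
move=> v; rewrite -[v]mulr1 -[v * 1]/(v *: 1) linearZ /=.
rewrite -deriveE; last by apply/derivable1_diffP; exact: ex_derive.
by rewrite derive_val normrZ mulrC normrM normr1 mulr1 ler_wpM2r.
Qed.

Lemma is_derive_line (W : normedModType R) (g : V -> W) x v t :
  differentiable g (x + t *: v) ->
  is_derive t (1 : R) (fun s => g (x + s *: v)) ('d g (x + t *: v) v).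
Proof.
move=> dg.
have dl : is_diff t (fun s : R => x + s *: v) (fun s => s *: v).
  have := @is_diffD _ _ _ (cst x) (fun s : R => s *: v) 0 (fun s => s *: v) t.
  by rewrite add0r; apply.
have := @is_diff_comp _ _ _ _ _ _ g ('d g (x + t *: v)) t dl (differentiableP dg).
move=> [h1 h2]; apply: DeriveDef; first exact: diff_derivable.
by rewrite deriveE// h2 /= scale1r.
Qed.

Lemma diff_zero_const f (A : set V) x y :
  (forall t, 0 <= t <= 1 -> A (x + t *: (y - x))) ->
  (forall z, A z -> differentiable f z /\ 'd f z (y - x) = 0) -> f y = f x.
Proof.
move=> seg dA.
apply/eqP; rewrite -subr_eq0 -normr_le0; apply/ler_addgt0Pr => e e0; rewrite add0r.
pose F (t : R) := f (x + t *: (y - x)).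
have := @slope_le_segment R R e F 0 1; rewrite /F scale1r scale0r addr0 subrKC subr0.
rewrite normr1 mulr1; apply => t t01; rewrite add0r -[t *: _]/(t * 1) mulr1.
have [df d0] := dA _ (seg t t01).
have := is_derive_line df; rewrite d0 => h.
have := derivable_slope (L := 0) h _ e0; rewrite add0r normr0; exact.
Qed.

End differential_line.

Section segment.
Variables (R : realType) (V : normedModType R).

Lemma segment_ball (x y z : V) (rho t : R) : `|y - x| < rho -> `|z - x| < rho ->
  0 <= t <= 1 -> `|y + t *: (z - y) - x| < rho.
Proof.
move=> yr zr /andP[t0 t1].
have -> : y + t *: (z - y) - x = (1 - t) *: (y - x) + t *: (z - x).
  rewrite addrAC scalerBl scale1r -[RHS]addrA -[- (t *: _)]scalerN -scalerDr opprB.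
  by rewrite [x - y + _]addrC addrA subrK.
apply: (le_lt_trans (ler_normD _ _)); rewrite !normrZ !ger0_norm ?subr_ge0//.
(* The strict inequality comes from the term with weight [t], which therefore has to be positive. *)
have [t_eq|t_neq] := eqVneq t 0; first by rewrite t_eq subr0 mul1r mul0r addr0.
have {t_neq}t0' : 0 < t by rewrite lt_def t_neq.
rewrite [ltRHS](_ : rho = (1 - t) * rho + t * rho); last by ring.
apply: ler_ltD; last by rewrite ltr_pM2l.
by rewrite ler_wpM2l ?subr_ge0// ltW.
Qed.

End segment.

Section rV_differential.
Variables (R : realType) (n : nat).
Implicit Types (f : 'rV[R]_n -> R) (x v : 'rV[R]_n).

Lemma diff_basis f x v : differentiable f x ->
  'd f x v = \sum_j v ord0 j * 'D_(Defs.basis j) f x.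
Proof.
move=> df; rewrite [in LHS](row_sum_delta v) linear_sum; apply: eq_bigr => j _.
by rewrite linearZ /= deriveE.
Qed.

Lemma diff_norm_le f x v (L : R) : differentiable f x ->
  (forall j, `|'D_(Defs.basis j) f x| <= L) -> `|'d f x v| <= (n%:R * L) * `|v|.
Proof.
move=> df fL; rewrite diff_basis//; apply: (le_trans (ler_norm_sum _ _ _)).
rewrite -mulrA -[X in X%:R * _](card_ord n) mulr_natl -sumr_const; apply: ler_sum => j _.
by rewrite normrM mulrC; apply: ler_pM => //; exact: coord_norm_le.
Qed.

Lemma C1_lipschitz (U : set 'rV[R]_n) f x : open U -> Ck 1 U f -> U x ->
  exists rho L : R, [/\ 0 < rho, forall y, `|y - x| < rho -> U y &
    forall y z, `|y - x| < rho -> `|z - x| < rho -> `|f y - f z| <= L * `|y - z|].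
Proof.
move=> oU [df cf] Ux.
pose L := \sum_j `|'D_(Defs.basis j) f x| + 1.
have nL : \forall y \near x, U y /\ forall j, `|'D_(Defs.basis j) f y| <= L.
  apply: filterI; first exact: open_nbhs_nbhs.
  suff : forall j, \forall y \near x, `|'D_(Defs.basis j) f y| <= L.
    by move=> h; exact: (filter_forall _ h).
  move=> j.
  have /cvgrPdist_lt/(_ _ ltr01) : {for x, continuous (fun y => 'D_(Defs.basis j) f y)}.
    exact: cf.
  apply: filterS => y yx.
  rewrite -['D_(Defs.basis j) f y](subrK ('D_(Defs.basis j) f x)).
  apply: (le_trans (ler_normD _ _)); rewrite /L addrC; apply: lerD.
    by rewrite (bigD1 j)//= lerDl sumr_ge0.
  by rewrite distrC ltW.
have [rho r0 rh] := (nbhs_rVP _ _).1 nL.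
(* The [+ 1] is the slack in [differentiable_slope]. *)
exists rho, (n%:R * L + 1); split=> // [y /rh[]//|y z yr zr].
apply: slope_le_segment => t t01.
have [Uy hL] := rh _ (segment_ball zr yr t01).
apply: differentiable_slope => //; first exact: df.
by move=> v; apply: diff_norm_le => //; exact: df.
Qed.

End rV_differential.

Lemma lipschitz_continuous_rV (R : realType) (p q : nat)
    (f : 'rV[R]_p -> 'rV[R]_q) (C : R) :
  (forall x y, `|f x - f y| <= C * `|x - y|) -> continuous f.
Proof.
move=> fC x U /nbhs_rVP[e e0 eU]; apply/nbhs_rVP.
exists (e / (`|C| + 1)); first by rewrite divr_gt0// ltr_wpDl.
move=> y yx; apply: eU; apply: (le_lt_trans (fC _ _)).
rewrite ltr_pdivlMr ?ltr_wpDl// in yx; apply: le_lt_trans yx.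
by rewrite mulrC ler_wpM2l// (le_trans (ler_norm _))// lerDl.
Qed.

(** * Calculus along a surface *)

Section surface_calculus.
Variables (R : realType) (m : nat).
Implicit Types (Gam : set 'rV[R]_m.+1) (x : 'rV[R]_m.+1).

Lemma chart_tangent Gam (gam : 'rV[R]_m -> 'rV[R]_m.+1) u v :
  differentiable gam u -> (\forall w \near u, Gam (gam w)) ->
  tangent Gam (gam u) ('d gam u v).
Proof.
move=> dg Gg; exists (fun t => gam (u + t *: v)); split.
- by rewrite scale0r addr0.
- by apply: (@near_segment _ _ (fun w => Gam (gam w))); rewrite scale0r addr0.
- by have := @is_derive_line R _ _ gam u v 0; rewrite scale0r addr0; apply.
Qed.

(** The differential of [gam] takes its values in tangent vectors, so [f \o gam] has zero
    differential on a ball of parameters; balls being convex, it is constant there. *)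
Lemma surface_locally_constant Gam (U : set 'rV[R]_m.+1) (f : 'rV[R]_m.+1 -> R) x0 :
  Ck_surface 1 Gam -> Gam x0 -> open U -> U x0 ->
  (forall x, U x -> differentiable f x) ->
  (forall x v, U x -> Gam x -> tangent Gam x v -> 'd f x v = 0) ->
  \forall y \near x0, Gam y -> f y = f x0.
Proof.
move=> sG G0 oU Ux0 df dT.
have [gam [pi [C [dg piC gx0 Gg gpi]]]] := surface_chart sG G0.
have cg : {for pi x0, continuous gam} := differentiable_continuous (dg _).
have gU : \forall u \near pi x0, U (gam u).
  have : nbhs (gam (pi x0)) U by rewrite gx0; exact: open_nbhs_nbhs.
  by move=> /cg.
have [rho r0 hr] : exists2 rho : R, 0 < rho & forall u : 'rV[R]_m,
    `|u - pi x0| < rho -> (\forall w \near u, Gam (gam w)) /\ U (gam u).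
  by apply/nbhs_rVP; apply: filterI => //; exact: (nbhs_interior Gg).
have pir : \forall y \near x0, `|pi y - pi x0| < rho.
  have : nbhs (pi x0) [set u : 'rV[R]_m | `|u - pi x0| < rho].
    by apply/nbhs_rVP; exists rho.
  by move=> /(lipschitz_continuous_rV piC).
near=> y; move=> Gy.
have yr : `|pi y - pi x0| < rho by near: y.
have gy : gam (pi y) = y by move: Gy; near: y.
rewrite -[in LHS]gy -[in RHS]gx0.
apply: (@diff_zero_const _ _ (f \o gam) [set u | `|u - pi x0| < rho]) => [t t01|u /hr[Gu Uu]].
  by apply: segment_ball => //; rewrite subrr normr0.
have du : differentiable (f \o gam) u by apply: differentiable_comp => //; exact: df.
split=> //; rewrite diff_comp//=; last exact: df.
apply: dT => //; first exact: nbhs_singleton Gu.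
exact: chart_tangent.
Unshelve. all: by end_near. Qed.

(** The affine function [dotp (y - x0) nu], pulled back by the chart, has zero differential at
    [pi x0], hence arbitrarily small slope there. Dividing [k] by [|C| + 1] absorbs the Lipschitz
    constant of [pi]. *)
Lemma surface_flat Gam (nu : 'rV[R]_m.+1) x0 (k : R) :
  Ck_surface 1 Gam -> Gam x0 ->
  (forall v, tangent Gam x0 v -> dotp v nu = 0) -> 0 < k ->
  \forall y \near x0, Gam y -> `|dotp (y - x0) nu| <= k * `|y - x0|.
Proof.
move=> sG G0 tnu k0.
have [gam [pi [C [dg piC gx0 Gg gpi]]]] := surface_chart sG G0.
pose psi (x : 'rV[R]_m.+1) := dotp (x - x0) nu.
have dpsi x : differentiable psi x.
  rewrite (_ : psi = \sum_i (fun x : 'rV[R]_m.+1 => (x ord0 i - x0 ord0 i) * nu ord0 i)).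
    apply: differentiable_sum => i; apply: differentiableM => //.
    by apply: differentiableB => //; exact: differentiable_coord.
  by apply/funext => y; rewrite fct_sumE; apply: eq_bigr => i _; rewrite !mxE.
have psiE x v : psi (v + x) - psi x = dotp v nu.
  rewrite /psi /dotp -sumrB; apply: eq_bigr => i _; rewrite !mxE; ring.
have dpsiv x v : 'd psi x v = dotp v nu.
  rewrite -deriveE//; apply: cvg_lim => //; apply: cvg_near_cst.
  near=> h; rewrite /= psiE /dotp; transitivity (h^-1 * (h * dotp v nu)).
    by congr (_ * _); rewrite mulr_sumr; apply: eq_bigr => i _; rewrite !mxE mulrA.
  by rewrite mulKf//; near: h; exact: nbhs_dnbhs_neq.
have e0 : 0 < k / (`|C| + 1) by rewrite divr_gt0// ltr_wpDl.
have : slope_le (0 + k / (`|C| + 1)) (psi \o gam) (pi x0).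
  apply: differentiable_slope => //; first exact: differentiable_comp.
  move=> v; rewrite diff_comp// /= mul0r dpsiv tnu ?normr0//.
  by have := @chart_tangent Gam gam (pi x0) v (dg _) Gg; rewrite gx0.
rewrite add0r => hs.
have /(lipschitz_continuous_rV piC) h := hs.
near=> y => Gy.
have gy : gam (pi y) = y by move: Gy; near: y.
have psix0 : psi x0 = 0 by rewrite /psi subrr /dotp big1// => i _; rewrite mxE mul0r.
have : `|psi (gam (pi y)) - psi (gam (pi x0))| <= k / (`|C| + 1) * `|pi y - pi x0|.
  by near: y.
rewrite gy gx0 psix0 subr0 => /le_trans; apply.
apply: (le_trans (ler_wpM2l (ltW e0) (piC _ _))).
rewrite mulrA; apply: ler_wpM2r => //.
rewrite -mulrA ler_piMr// ?(ltW k0)// mulrC ler_pdivrMr ?ltr_wpDl// mul1r.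
by rewrite (le_trans (ler_norm _))// lerDl.
Unshelve. all: by end_near. Qed.

End surface_calculus.

Lemma continuous_pairl (R : realType) (c : R) : continuous (fun x : R => (x, c)).
Proof.
move=> x; exact: (@cvg_pair _ _ _ _ _ _ _ _ _ id (cst c) (@cvg_id _ (nbhs x)) (cvg_cst c)).
Qed.

Lemma continuous_pairr (R : realType) (c : R) : continuous (fun x : R => (c, x)).
Proof.
move=> x; exact: (@cvg_pair _ _ _ _ _ _ _ _ _ (cst c) id (cvg_cst c) (@cvg_id _ (nbhs x))).
Qed.

(** * Primitives of a cocycle along maps *)

Section primitive.
Variables (R : realType) (T : topologicalType) (A : set T) (d : T -> T -> R).

(* [d x y] is the increment from x to y of a potential defined near x; a
   primitive along a map H is a potential for the pulled back increments. *)
Definition primitive (X : topologicalType) (S : set X) (H : X -> T) (F : X -> R) :=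
  forall p, S p -> \forall q \near p, S q -> F q - F p = d (H p) (H q).

(** Additivity is asked only for [y] near [x] and then [y'] near [y], with neighbourhoods depending
    on the previous point. This is what can be checked for [increment], whose formula depends on the
    side of its end point. *)
Definition cocycle := forall x, A x ->
  d x x = 0 /\ \forall y \near x, \forall y' \near y, d y y' = d x y' - d x y.

Lemma primitive_comp (X Y : topologicalType) (S : set X) (S' : set Y) H F (h : Y -> X) :
  continuous h -> (forall y, S' y -> S (h y)) -> primitive S H F ->
  primitive S' (H \o h) (F \o h).
Proof.
move=> ch hS pF p S'p; have /(ch p) := pF _ (hS _ S'p).
apply: (@filterS _ (nbhs p)) => q /= + S'q.
by apply; exact: hS.
Qed.

Lemma primitive_eq (X : topologicalType) (S : set X) H H' F F' :
  (forall x, S x -> H x = H' x /\ F x = F' x) -> primitive S H F -> primitive S H' F'.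
Proof.
move=> HH pF p Sp; have := pF p Sp; apply: filterS => q /= h Sq.
have [<- <-] := HH _ Sp; have [<- <-] := HH _ Sq; exact: h.
Qed.

Lemma primitive_sub (X : topologicalType) (S S' : set X) H F : S' `<=` S ->
  primitive S H F -> primitive S' H F.
Proof.
move=> SS pF p S'p; have := pF p (SS _ S'p); apply: filterS => q /= h S'q.
by apply: h; exact: SS.
Qed.

Lemma primitive_addr (X : topologicalType) (S : set X) H F (c : R) :
  primitive S H F -> primitive S H (fun x => F x + c).
Proof.
move=> pF p Sp; have := pF p Sp; apply: filterS => q /= h Sq.
by rewrite -h//; ring.
Qed.

(** At a point lying in only one of the sets, closedness of the other gives a neighbourhood that
    misses it. *)
Lemma primitiveU (X : topologicalType) (S S' : set X) H F : closed S -> closed S' ->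
  primitive S H F -> primitive S' H F -> primitive (S `|` S') H F.
Proof.
move=> cS cS' pF pF' p _.
have loc (B : set X) : closed B -> primitive B H F ->
    \forall q \near p, B q -> F q - F p = d (H p) (H q).
  move=> cB pB; have [Bp|nBp] := pselect (B p); first exact: pB.
  have : nbhs p (~` B) by apply: open_nbhs_nbhs; split => //; exact: closed_openC.
  by apply: filterS.
have h1 := loc _ cS pF; have h2 := loc _ cS' pF'.
near=> q => -[]; first by near: q.
by near: q.
Unshelve. all: by end_near. Qed.

Lemma primitive_unique (X : topologicalType) (S : set X) H F F' : connected S ->
  primitive S H F -> primitive S H F' ->
  forall p q, S p -> S q -> F p - F' p = F q - F' q.
Proof.
move=> cS pF pF'.
apply: (@locally_constant_connected _ _ _ (fun p => F p - F' p) cS) => p Sp.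
have h := pF p Sp; have h' := pF' p Sp.
near=> q => Sq.
have e : F q - F p = d (H p) (H q) by move: Sq; near: q.
have e' : F' q - F' p = d (H p) (H q) by move: Sq; near: q.
by apply/eqP; rewrite -subr_eq0; apply/eqP; rewrite -[RHS](subrr (d (H p) (H q))) -{1}e -e'; ring.
Unshelve. all: by end_near. Qed.

Lemma primitive_cst (X : topologicalType) (S : set X) F x : connected S -> d x x = 0 ->
  primitive S (fun=> x) F -> forall p q, S p -> S q -> F p = F q.
Proof.
move=> cS dx0 pF p q Sp Sq.
have p0 : primitive S (fun=> x) (cst 0).
  by move=> r Sr; near=> r' => _; rewrite subrr dx0.
by have := primitive_unique cS pF p0 Sp Sq; rewrite !subr0.
Unshelve. all: by end_near. Qed.

(** On the connected overlap the two primitives differ by a constant [c], which is added to the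
    second one. *)
Lemma primitive_glue (X : topologicalType) (S S' : set X) H F F' p0 :
  closed S -> closed S' -> connected (S `&` S') -> S p0 -> S' p0 ->
  primitive S H F -> primitive S' H F' -> exists G, primitive (S `|` S') H G.
Proof.
move=> cS cS' cSS Sp S'p pF pF'.
pose c := F p0 - F' p0.
pose G q := if `[< S q >] then F q else F' q + c.
have GF q : S q -> G q = F q by move=> Sq; rewrite /G ifT//; exact/asboolP.
have GF' q : S' q -> G q = F' q + c.
  move=> S'q; rewrite /G; case: ifPn => // /asboolP Sq.
  have := primitive_unique cSS (primitive_sub (@subIsetl _ _ _) pF)
    (primitive_sub (@subIsetr _ _ _) pF') (conj Sp S'p) (conj Sq S'q).
  by rewrite -/c => ->; ring.
exists G; apply: primitiveU => //.
  by apply: primitive_eq pF => x Sx; rewrite GF.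
by apply: primitive_eq (primitive_addr c pF') => x Sx; rewrite GF'.
Qed.

Hypothesis dA : cocycle.

(** The cocycle identity says precisely that the increments from the fixed point [H p] form a
    primitive near [p]. *)
Lemma primitive_local (X : topologicalType) (H : X -> T) p : continuous H -> A (H p) ->
  exists2 U, nbhs p U & primitive U H (fun q => d (H p) (H q)).
Proof.
move=> cH Ap; have [_ /(cH p) h] := dA Ap.
exists [set q | \forall q' \near q, d (H q) (H q') = d (H p) (H q') - d (H p) (H q)].
  by move: h; apply: (@filterS _ (nbhs p)) => q /= /(cH q).
by move=> q /=; apply: filterS => q' /= ->.
Qed.

Lemma primitive_segment (H : R -> T) (a b : R) : continuous H ->
  (forall t, A (H t)) -> a <= b -> exists F, primitive `[a, b]%classic H F.
Proof.
move=> cH AH ab; pose P u v := exists F, primitive `[u, v]%classic H F.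
apply: (@interval_induction R P) => //.
  move=> u v w _ uv vw _ [F pF] [F' pF'].
  have [|||||G pG] := @primitive_glue _ _ _ H F F' v _ _ _ _ _ pF pF'.
  - exact: interval_closed.
  - exact: interval_closed.
  - rewrite (_ : _ `&` _ = [set v]); first exact: connected1.
    apply/seteqP; split=> x /=; rewrite !in_itv /=; last by move->; rewrite uv vw lexx.
    by move=> [/andP[_ xv] /andP[vx _]]; apply/le_anti; rewrite xv vx.
  - by rewrite /= in_itv /= uv lexx.
  - by rewrite /= in_itv /= vw lexx.
  exists G; apply: primitive_sub pG => x /=; rewrite !in_itv /= => /andP[ux xw].
  by case: (leP x v) => xv; [left|right]; rewrite /= ?in_itv /= ?ux ?xw ?ltW.
move=> x _; have [U /near_itv[e e0 eU] pU] := primitive_local cH (AH x).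
exists e => // u v _ ux xv _ ue ve; exists (fun q => d (H x) (H q)).
apply: primitive_sub pU => q /=; rewrite in_itv /= => /andP[uq qv].
by apply: eU; lra.
Qed.

Definition rect (a b a' b' : R) : set (R * R)%type :=
  `[a, b]%classic `*` `[a', b']%classic.

Lemma rectP (a b a' b' x y : R) :
  rect a b a' b' (x, y) <-> a <= x <= b /\ a' <= y <= b'.
Proof. by rewrite /rect /= !in_itv. Qed.

(** Interval induction is applied twice: vertically, to cover a line by a thin slab, then
    horizontally, to join slabs. At each gluing the overlap is a segment, hence connected. *)
Lemma primitive_square (H : R * R -> T) : continuous H -> (forall p, A (H p)) ->
  exists F, primitive (rect 0 1 0 1) H F.
Proof.
move=> cH AH.
have closed_rect (a b a' b' : R) : closed (rect a b a' b').
  rewrite (_ : rect a b a' b' = fst @^-1` `[a, b]%classic `&` snd @^-1` `[a', b']%classic) //.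
  apply: closedI; apply: preimage_closed; try exact: interval_closed.
    by move=> x _; exact: cvg_fst.
  by move=> x _; exact: cvg_snd.
have sub_slab (s e e' a b : R) : e <= e' ->
    rect (s - e) (s + e) a b `<=`
    rect (s - e') (s + e') a (b).
  move=> ee' -[x y] /rectP[h1 h2]; apply/rectP; split=> //; lra.
have connected_hseg (a b c : R) : connected (`[a, b]%classic `*` [set c]).
  rewrite (_ : _ `*` _ = (fun x => (x, c)) @` `[a, b]%classic).
    apply: connected_continuous_connected; first exact: connected_segment.
    apply: continuous_subspaceT; exact: continuous_pairl.
  apply/seteqP; split=> [[x y] /= [xab ->]|_ [x xab <-]]; first by exists x.
  by split.
have connected_vseg (a b c : R) : connected ([set c] `*` `[a, b]%classic).
  rewrite (_ : _ `*` _ = (fun x => (c, x)) @` `[a, b]%classic).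
    apply: connected_continuous_connected; first exact: connected_segment.
    apply: continuous_subspaceT; exact: continuous_pairr.
  apply/seteqP; split=> [[x y] /= [-> xab]|_ [x xab <-]]; first by exists y.
  by split.
have itvI (u v w : R) : u <= v -> v <= w ->
    `[u, v]%classic `&` `[v, w]%classic = [set v].
  move=> uv vw; apply/seteqP; split=> x /=; rewrite !in_itv /=; last by move->; rewrite uv vw lexx.
  by move=> [/andP[_ xv] /andP[vx _]]; apply/le_anti; rewrite xv vx.
(* The slab may stick out of the unit square; this is harmless because [H] maps the whole plane into
   [A]. *)
have slab s : exists2 e : R, 0 < e & exists F,
    primitive (rect (s - e) (s + e) 0 1) H F.
  pose P u v := exists2 e : R, 0 < e & exists F,
    primitive (rect (s - e) (s + e) u v) H F.
  apply: (@interval_induction R P) => //.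
    move=> u v w _ uv vw _ [e e0 [F pF]] [e' e0' [F' pF']].
    pose e2 := Order.min e e'.
    have e20 : 0 < e2 by rewrite lt_min e0.
    have [le2 le2'] : e2 <= e /\ e2 <= e' by rewrite !ge_min !lexx orbT.
    have pF2 : primitive (rect (s - e2) (s + e2) u v) H F.
      exact: primitive_sub (sub_slab _ _ _ _ _ le2) pF.
    have pF2' : primitive (rect (s - e2) (s + e2) v w) H F'.
      exact: primitive_sub (sub_slab _ _ _ _ _ le2') pF'.
    have [|||||G pG] := @primitive_glue _ _ _ H F F' (s, v) _ _ _ _ _ pF2 pF2'.
    - exact: closed_rect.
    - exact: closed_rect.
    - by rewrite -setXI setIid itvI.
    - by apply/rectP; split; lra.
    - by apply/rectP; split; lra.
    exists e2 => //; exists G; apply: primitive_sub pG => -[x y] /rectP[h1 h2].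
    by case: (leP y v) => yv; [left|right]; apply/rectP; split=> //; lra.
  move=> t _; have [U /nbhs_ballP[e /= e0 eU] pU] := primitive_local cH (AH (s, t)).
  exists e => // u v _ ut tv _ ue ve; exists (e / 2); first by rewrite divr_gt0.
  exists (fun q => d (H (s, t)) (H q)); apply: primitive_sub pU => -[x y] /rectP[h1 h2].
  by apply: eU; split; rewrite /ball /= ltr_norml; lra.
pose P u v := exists F, primitive (rect u v 0 1) H F.
apply: (@interval_induction R P) => //.
  move=> u v w _ uv vw _ [F pF] [F' pF'].
  have [|||||G pG] := @primitive_glue _ _ _ H F F' (v, 0) _ _ _ _ _ pF pF'.
  - exact: closed_rect.
  - exact: closed_rect.
  - by rewrite -setXI setIid itvI.
  - by apply/rectP; split; lra.
  - by apply/rectP; split; lra.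
  exists G; apply: primitive_sub pG => -[x y] /rectP[h1 h2].
  by case: (leP x v) => xv; [left|right]; apply/rectP; split=> //; lra.
move=> x _; have [e e0 [F pF]] := slab x.
exists e => // u v _ ux xv _ ue ve; exists F.
apply: primitive_sub pF => -[q r] /rectP[h1 h2].
by apply/rectP; split=> //; lra.
Qed.

End primitive.

Section clamp.
Variable R : realType.

(** The retraction of the line onto the unit interval: composed with it, maps continuous within the
    interval or the square become continuous everywhere, with the same values there. *)
Definition clamp (t : R) : R := Order.max 0 (Order.min 1 t).

Lemma clamp_itv t : 0 <= clamp t <= 1.
Proof. by rewrite /clamp le_max lexx /= ge_max ler01 ge_min lexx. Qed.

Lemma clamp_id t : 0 <= t <= 1 -> clamp t = t.
Proof. by move=> /andP[t0 t1]; rewrite /clamp min_r// max_r. Qed.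

Lemma clamp_le0 t : t <= 0 -> clamp t = 0.
Proof. by move=> t0; rewrite /clamp min_r ?max_l//; lra. Qed.

Lemma clamp_ge1 t : 1 <= t -> clamp t = 1.
Proof. by move=> t0; rewrite /clamp min_l ?max_r//; lra. Qed.

Lemma clamp_continuous : continuous clamp.
Proof.
move=> t.
have h1 : {for t, continuous (cst 1 \min id : R -> R^o)}.
  by apply: continuous_min; [exact: cst_continuous|exact: cvg_id].
by have := continuous_max (@cst_continuous _ R^o 0 t) h1; exact.
Qed.

End clamp.

Lemma continuous_within_comp (X Y Z : topologicalType) (S : set Y) (f : Y -> Z) (h : X -> Y) :
  {within S, continuous f} -> continuous h -> (forall x, S (h x)) ->
  continuous (f \o h).
Proof.
move=> /subspace_continuousP cf ch hS x U /(cf _ (hS x)) hU.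
have /ch : nbhs (h x) [set y | S y -> U (f y)].
  by [].
by apply: (@filterS _ (nbhs x)) => y /=; apply.
Qed.

(** * Simply connected sets: cocycles have potentials *)

Section loops.
Variables (R : realType) (V : normedModType R) (A : set V) (d : V -> V -> R).
Hypothesis dA : cocycle A d.

(** A primitive [G] on the homotopy square is constant on the three sides sent to the base point, so
    its increment along the fourth side, which carries [c], is zero. By uniqueness [F] has the same
    increment. *)
Lemma loop_primitive (c : R -> V) (F : R -> R) : simply_connected R A -> continuous c ->
  (forall t, A (c t)) -> c 0 = c 1 -> primitive d `[0 : R, 1]%classic c F -> F 0 = F 1.
Proof.
move=> [_ sc] cc Ac c01 pF.
have [||H [cH AH Hc H0]] := sc c _ _ c01.
- exact: continuous_subspaceT.
- by move=> t _; exact: Ac.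
pose cl (p : R * R) := (clamp p.1, clamp p.2).
have ccl : continuous cl.
  move=> p; apply: (@cvg_pair _ _ _ (nbhs p) (nbhs (clamp p.1)) (nbhs (clamp p.2))).
    by apply: (@cvg_comp _ _ _ fst); [exact: cvg_fst|exact: clamp_continuous].
  by apply: (@cvg_comp _ _ _ snd); [exact: cvg_snd|exact: clamp_continuous].
have clS p : (`[0, 1]%classic `*` `[0, 1]%classic) (cl p).
  by split; rewrite /= in_itv /= clamp_itv.
have [] := @primitive_square R _ A d dA (H \o cl) (continuous_within_comp cH ccl clS).
  by move=> p; apply: AH; exact: clamp_itv.
move=> G pG.
pose I01 := `[0 : R, 1]%classic.
have i0 : I01 0 by rewrite /I01 /= in_itv /= lexx ler01.
have i1 : I01 1 by rewrite /I01 /= in_itv /= lexx ler01.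
have i01 t : I01 t -> 0 <= t <= 1 by rewrite /I01 /= in_itv.
have c01' : connected I01 by exact: connected_segment.
have d0 : d (c 0) (c 0) = 0 by have [] := dA (Ac 0).
have edge (h : R -> R * R) (c' : R -> V) : continuous h ->
    (forall t, 0 <= t <= 1 -> rect 0 1 0 1 (h t) /\ H (h t) = c' t) ->
    primitive d I01 c' (G \o h).
  move=> ch hc'; have := @primitive_comp R V d _ _ _ I01 _ _ h ch _ pG.
  move=> /(_ (fun t t01 => (hc' t (i01 _ t01)).1)); apply: primitive_eq.
  move=> t /i01 /hc'[ht <-]; split=> //=; congr H; move: ht.
  by case: (h t) => x y /rectP[x01 y01]; rewrite /cl /= !clamp_id.
have left_ : primitive d I01 c (fun t => G (0, t)).
  apply: edge; first exact: continuous_pairr.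
  by move=> t t01; split; [exact/rectP|have [] := Hc _ t01].
have right_ : primitive d I01 (fun=> c 0) (fun t => G (1, t)).
  apply: edge; first exact: continuous_pairr.
  by move=> t t01; split; [exact/rectP|have [] := Hc _ t01].
have bot_ : primitive d I01 (fun=> c 0) (fun t => G (t, 0)).
  apply: edge; first exact: continuous_pairl.
  by move=> t t01; split; [exact/rectP|have [] := H0 _ t01].
have top_ : primitive d I01 (fun=> c 0) (fun t => G (t, 1)).
  apply: edge; first exact: continuous_pairl.
  by move=> t t01; split; [exact/rectP|have [] := H0 _ t01].
have e1 := primitive_cst c01' d0 right_ i0 i1.
have e2 := primitive_cst c01' d0 bot_ i0 i1.
have e3 := primitive_cst c01' d0 top_ i0 i1.
have := primitive_unique c01' pF left_ i0 i1.
by rewrite e2 e1 -e3 => /addIr.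
Qed.

(** The value at [x] is the increment of a primitive along a chosen path from [x0] to [x]. For [y]
    near [x], the path to [x], the segment to [y] and the reversed path to [y] form a loop, on which
    [loop_primitive] yields the claim. *)
Lemma simply_connected_primitive : open A -> simply_connected R A ->
  exists z : V -> R, forall x, A x -> \forall y \near x, z y - z x = d x y.
Proof.
move=> oA sc.
have [[x0 Ax0]|A0] := pselect (A !=set0); last first.
  by exists (cst 0) => x Ax; exfalso; apply: A0; exists x.
have /choice[c hc] : forall x, exists c : R -> V, A x ->
    [/\ continuous c, c 0 = x0, c 1 = x, forall t, A (c t) & forall t, c t = c (clamp t)].
  move=> x; have [Ax|nAx] := pselect (A x); last by exists (cst x0) => /nAx.
  have [c [cc c0 c1 Ac]] := sc.1 _ _ Ax0 Ax.
  exists (c \o @clamp R) => _; split.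
  - apply: continuous_within_comp cc (@clamp_continuous R) _ => t.
    by rewrite /= in_itv /= clamp_itv.
  - by rewrite /= clamp_le0.
  - by rewrite /= clamp_ge1.
  - by move=> t; apply: Ac; exact: clamp_itv.
  - by move=> t /=; rewrite [clamp (clamp t)]clamp_id// clamp_itv.
have /choice[F hF] : forall x, exists F : R -> R, A x -> primitive d `[0 : R, 1]%classic (c x) F.
  move=> x; have [Ax|nAx] := pselect (A x); last by exists (cst 0) => /nAx.
  have [cc _ _ Ac _] := hc x Ax.
  by have [G pG] := primitive_segment dA cc Ac ler01; exists G.
exists (fun x => F x 1 - F x 0) => x Ax.
have [dxx hx] := dA Ax.
have /nbhs_ballP[rho /= r0 hr] : \forall y \near x, A y /\
    \forall y' \near y, d y y' = d x y' - d x y.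
  by apply: filterI => //; exact: open_nbhs_nbhs.
near=> y.
have yr : ball x rho y by near: y; exact: nbhsx_ballx.
have [Ay _] := hr _ yr.
have [ccx cx0 cx1 Acx cxc] := hc x Ax.
have [ccy cy0 cy1 Acy cyc] := hc y Ay.
pose s t := x + clamp t *: (y - x).
have sr t : ball x rho (s t).
  move: yr; rewrite -!ball_normE /= => yr; rewrite /s opprD addNKr normrN normrZ.
  have /andP[cl0 cl1] := clamp_itv t.
  rewrite ger0_norm// (le_lt_trans _ yr)// [X in _ <= X]distrC.
  by rewrite ler_piMl.
have cs : continuous s.
  move=> t; apply: cvgD; first exact: cvg_cst.
  by apply: cvgZr_tmp; exact: clamp_continuous.
have ps S : primitive d S s (fun t => d x (s t)).
  move=> t _; have [_ /(cs t)] := hr _ (sr t).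
  by apply: (@filterS _ (nbhs t)) => t' /= ->.
have s_le0 t : t <= 0 -> s t = x by move=> t0; rewrite /s clamp_le0// scale0r addr0.
have s_ge1 t : 1 <= t -> s t = y by move=> t0; rewrite /s clamp_ge1// scale1r subrKC.
(* the three paths are concatenated on [0, 3]; each of them being constant
   outside its own third, concatenation is addition *)
pose C t := c x t + (s (t - 1) - x) + (c y (3 - t) - y).
pose G t := F x (clamp t) + d x (s (t - 1)) + F y (clamp (3 - t)).
have cx_ge1 t : 1 <= t -> c x t = x by move=> t1; rewrite cxc clamp_ge1.
have cy_ge1 t : 1 <= t -> c y t = y by move=> t1; rewrite cyc clamp_ge1.
have C01 t : 0 <= t <= 1 -> C t = c x t.
  by move=> t01; rewrite /C s_le0 ?cy_ge1 ?subrr ?addr0//; lra.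
have C12 t : 1 <= t <= 2 -> C t = s (t - 1).
  by move=> t01; rewrite /C cx_ge1 ?cy_ge1 ?subrr ?addr0 ?subrKC//; lra.
have C23 t : 2 <= t <= 3 -> C t = c y (3 - t).
  by move=> t01; rewrite /C cx_ge1 ?s_ge1 ?subrKC//; lra.
have cC : continuous C.
  move=> t; apply: cvgD; first apply: cvgD; first exact: ccx.
    apply: cvgB; last exact: cvg_cst.
    apply: (@cvg_comp _ _ _ (fun t => t - 1) s); last exact: cs.
    by apply: cvgB; [exact: cvg_id|exact: cvg_cst].
  apply: cvgB; last exact: cvg_cst.
  apply: (@cvg_comp _ _ _ (fun t => 3 - t) (c y)); last exact: ccy.
  by apply: cvgB; [exact: cvg_cst|exact: cvg_id].
have AC t : 0 <= t <= 3 -> A (C t).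
  move=> t03; have [t1|t1] := leP t 1; first by rewrite C01//; lra.
  have [t2|t2] := leP t 2; last by rewrite C23//; lra.
  by rewrite C12; [have [] := hr _ (sr (t - 1))|lra].
have pG : primitive d (`[0 : R, 1] `|` `[1 : R, 2] `|` `[2 : R, 3])%classic C G.
  have cl (u v : R) : closed `[u, v]%classic by exact: interval_closed.
  apply: primitiveU => //; first exact: closedU; first apply: primitiveU => //.
  - apply: primitive_eq (primitive_addr (F y 1) (hF x Ax)) => t.
    rewrite /= in_itv /= => t01; rewrite C01// /G s_le0 ?dxx ?(clamp_id t01); last lra.
    by rewrite clamp_ge1 ?addr0//; lra.
  - have h : continuous (fun t : R => t - 1).
      by move=> t; apply: cvgB; [exact: cvg_id|exact: cvg_cst].
    have := primitive_comp (S' := `[1 : R, 2]%classic) h (fun _ _ => I) (ps setT).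
    move=> /(primitive_addr (F x 1 + F y 1)); apply: primitive_eq => t.
    rewrite /= in_itv /= => t01; rewrite C12// /G !clamp_ge1; try lra.
    by split=> //; ring.
  - have h : continuous (fun t : R => 3 - t).
      by move=> t; apply: cvgB; [exact: cvg_cst|exact: cvg_id].
    have hS (t : R) : `[2, 3]%classic t -> `[0, 1]%classic (3 - t).
      by rewrite /= !in_itv /=; lra.
    have := primitive_comp h hS (hF y Ay).
    move=> /(primitive_addr (F x 1 + d x y)); apply: primitive_eq => t.
    rewrite /= in_itv /= => t01; rewrite C23// /G s_ge1 ?[clamp t]clamp_ge1 ?clamp_id; try lra.
    by split=> //; ring.
(* The loop is reparametrised by the unit interval; the clamp keeps it in [A] at all times. *)
pose h3 (t : R) := 3 * clamp t.
have ch3 : continuous h3.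
  by move=> t; apply: cvgM; [exact: cvg_cst|exact: clamp_continuous].
have h3I t : 0 <= h3 t <= 3 by have := clamp_itv t; rewrite /h3; lra.
have pG' := primitive_comp (S' := `[0 : R, 1]%classic) ch3 _ pG.
have := @loop_primitive (C \o h3) (G \o h3) sc.
have h30 : h3 0 = 0 by rewrite /h3 clamp_le0// mulr0.
have h31 : h3 1 = 3 by rewrite /h3 clamp_ge1// mulr1.
rewrite /= h30 h31 C01 ?C23; try lra.
rewrite subrr cx0 cy0 => h.
have {h} : G 0 = G 3.
  apply: h => //.
  - by move=> t; apply: (@cvg_comp _ _ _ h3 C); [exact: ch3|exact: cC].
  - by move=> t; exact: AC.
  - apply: pG' => t _; have := h3I t; rewrite /= !in_itv /= => t03.
    have [t1|t1] := leP (h3 t) 1; first by left; left; lra.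
    by have [t2|t2] := leP (h3 t) 2; [left; right|right]; lra.
rewrite /G s_le0 ?s_ge1 ?subrr ?subr0 ?dxx ?[clamp 0]clamp_le0 ?[clamp 3]clamp_ge1; try lra.
Unshelve. all: by end_near. Qed.

End loops.

Lemma slope_le_continuous (R : realType) (V : normedModType R) (L : R) (f : V -> R) x :
  slope_le L f x -> {for x, continuous f}.
Proof.
move=> hs; apply/cvgrPdist_lt => e e0.
near=> y; rewrite distrC.
have : `|f y - f x| <= L * `|y - x| by near: y.
move=> /le_lt_trans; apply.
have : `|y - x| < e / (`|L| + 1).
  near: y; apply/nbhs_ballP; exists (e / (`|L| + 1)) => /=; first by rewrite divr_gt0.
  by move=> y; rewrite -ball_normE /= distrC.
rewrite ltr_pdivlMr//; apply: le_lt_trans.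
by rewrite mulrC ler_wpM2l// (le_trans (ler_norm _))// lerDl.
Unshelve. all: by end_near. Qed.

(** * Extensions of C^1 functions past the closure *)

Section C1_ext.
Variables (R : realType) (n : nat).
Implicit Types (O : set 'rV[R]_n) (f : 'rV[R]_n -> R).

(** The same choice as in [Dmx_closure], whose entries are therefore partial derivatives of
    [ext]. *)
Definition ext O f := xget f (C1_extension O f).

Lemma extP O f : C1_closure O f -> exists U,
  [/\ open U, closure O `<=` U, Ck 1 U (ext O f) & forall x, O x -> ext O f x = f x].
Proof. by move=> [_ [F hF]]; rewrite /ext; case: xgetP => [g _ //|/(_ F)]. Qed.

Lemma derive_ext O f x j : open O -> C1_closure O f -> O x ->
  'D_(Defs.basis j) f x = 'D_(Defs.basis j) (ext O f) x.
Proof.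
move=> oO /extP[U [_ _ _ e]] Ox; apply: near_eq_derive.
by have : nbhs x O by [apply: open_nbhs_nbhs]; apply: filterS => y /e.
Qed.

Lemma ext_bounded_derive O f j : compact (closure O) -> C1_closure O f ->
  exists C, forall x, O x -> `|'D_(Defs.basis j) (ext O f) x| <= C.
Proof.
move=> cO /extP[U [oU OU [_ /(_ j) cf] _]].
have [x a b ab /le_trans|x Ox|C hC] := @compact_bound R _ (closure O)
  (fun M x => `|'D_(Defs.basis j) (ext O f) x| <= M) cO; first exact.
- exists (`|'D_(Defs.basis j) (ext O f) x| + 1).
  have /cvgrPdist_lt/(_ _ ltr01) : {for x, continuous ('D_(Defs.basis j) (ext O f))}.
    exact: cf (OU _ Ox).
  apply: filterS => y; set a := 'D__ _ x; set b := 'D__ _ y => ab.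
  by have := ler_normB a (a - b); rewrite opprB addrC subrK; lra.
- by exists C => x /subset_closure; exact: hC.
Qed.

(** Asking [x] to lie in the closure makes the claim meaningful at every [xi]: near a point outside
    the closure it is vacuous, and elsewhere the extension is C^1 around [xi]. *)
Lemma ext_lipschitz O f xi : C1_closure O f -> exists rho L : R, [/\ 0 < rho, 0 <= L &
  forall x y, `|x - xi| < rho -> `|y - xi| < rho -> closure O x ->
    `|ext O f y - ext O f x| <= L * `|y - x| ].
Proof.
move=> /extP[U [oU OU cf _]]; have [Oxi|nO] := pselect (closure O xi).
  have [rho [L [r0 _ h]]] := C1_lipschitz oU cf (OU _ Oxi).
  exists rho, `|L|; split=> // x y xr yr _; apply: (le_trans (h _ _ yr xr)).
  by rewrite ler_wpM2r// ler_norm.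
have : nbhs xi (~` closure O).
  by apply: open_nbhs_nbhs; split => //; apply: closed_openC; exact: closed_closure.
by move=> /nbhs_rVP[rho r0 h]; exists rho, 0; split=> // x y /h.
Qed.

End C1_ext.

(** * Increments across the interface and their potentials *)

Section potential.
Variables (R : realType) (m : nat) (Om Omp Omm Gam : set 'rV[R]_m.+1)
  (fp fm : 'rV[R]_m.+1 -> R).
Hypotheses (oOm : open Om) (OmE : Om = Omp `|` Gam `|` Omm) (oOmp : open Omp)
  (oOmm : open Omm) (dis : Omp `&` Omm = set0) (Gp : Gam = Om `&` boundary Omp)
  (Gm : Gam = Om `&` boundary Omm) (Cp : C1_closure Omp fp) (Cm : C1_closure Omm fm).

Local Notation Yp := (ext Omp fp).
Local Notation Ym := (ext Omm fm).

(** The end point selects the side. A base point on [Gam] lies in both closures, so either extension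
    is meaningful there; a base point off [Gam] has all nearby end points on its own side. *)
Definition increment (x y : 'rV[R]_m.+1) : R :=
  if `[< Omm y >] then Ym y - Ym x else Yp y - Yp x.

Lemma incrementm x y : Omm y -> increment x y = Ym y - Ym x.
Proof. by move=> Oy; rewrite /increment ifT//; exact/asboolP. Qed.

Lemma incrementp x y : ~ Omm y -> increment x y = Yp y - Yp x.
Proof. by move=> Oy; rewrite /increment ifF//; exact/asboolPn. Qed.

Lemma Omp_not_Omm x : Omp x -> ~ Omm x.
Proof. by move=> px mx; have : (Omp `&` Omm) x by []; rewrite dis. Qed.

Lemma Gam_notin x : Gam x -> ~ Omp x /\ ~ Omm x.
Proof.
move=> Gx; split.
  by move: Gx; rewrite Gp => -[_ [_ np]] px; apply: np; exact: open_nbhs_nbhs.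
by move: Gx; rewrite Gm => -[_ [_ np]] px; apply: np; exact: open_nbhs_nbhs.
Qed.

Lemma Gam_closure x : Gam x -> closure Omp x /\ closure Omm x.
Proof.
move=> Gx; split; first by move: Gx; rewrite Gp => -[_ []].
by move: Gx; rewrite Gm => -[_ []].
Qed.

Lemma OmP x : Om x -> [\/ Omp x, Gam x | Omm x].
Proof.
by rewrite OmE => -[[]|]; [apply: Or31|apply: Or32|apply: Or33].
Qed.

Lemma near_increment x : Om x -> \forall y \near x, Om y /\
  ((Omm y /\ increment x y = Ym y - Ym x /\ closure Omm x) \/
   (~ Omm y /\ increment x y = Yp y - Yp x /\ closure Omp x)).
Proof.
move=> Ox; have nO : nbhs x Om by exact: open_nbhs_nbhs.
have [px|Gx|mx] := OmP Ox.
- have : nbhs x Omp by exact: open_nbhs_nbhs.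
  apply: filterS2 nO => y Oy py; split=> //; right.
  have nm := Omp_not_Omm py; rewrite incrementp//; split=> //; split=> //.
  exact: subset_closure.
- have [cp cm] := Gam_closure Gx.
  apply: filterS nO => y Oy; split=> //; have [my|my] := pselect (Omm y).
    by left; rewrite incrementm.
  by right; rewrite incrementp.
- have : nbhs x Omm by exact: open_nbhs_nbhs.
  apply: filterS2 nO => y Oy py; split=> //; left.
  by rewrite incrementm//; split=> //; split=> //; exact: subset_closure.
Qed.

Definition jump_locally_constant := forall x, Gam x ->
  \forall y \near x, Gam y -> Yp y - Ym y = Yp x - Ym x.

Definition potential (z : 'rV[R]_m.+1 -> R) := forall x, Om x ->
  \forall y \near x, z y - z x = increment x y.

(** The jump hypothesis enters in a single configuration: [x] and [y] on [Gam] and [y'] in [Omm],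
    where [increment x y] uses the plus side and the other two increments the minus side. *)
Lemma increment_cocycle : jump_locally_constant -> cocycle Om increment.
Proof.
move=> jc x Ox; split.
  by rewrite /increment; case: ifPn => _; rewrite subrr.
have same y : Omp y -> ~ Omm x -> \forall y' \near y,
    increment y y' = increment x y' - increment x y.
  move=> py _; have : nbhs y Omp by exact: open_nbhs_nbhs.
  apply: filterS => y' py'.
  by rewrite !incrementp; [ring|exact: Omp_not_Omm..].
have samem y : Omm y -> \forall y' \near y,
    increment y y' = increment x y' - increment x y.
  move=> my; have : nbhs y Omm by exact: open_nbhs_nbhs.
  by apply: filterS => y' my'; rewrite !incrementm//; ring.
have [px|Gx|mx] := OmP Ox.
- have : nbhs x Omp by exact: open_nbhs_nbhs.
  by apply: filterS => y py; apply: same => //; exact: Omp_not_Omm.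
- have [_ nmx] := Gam_notin Gx.
  have nO : nbhs x Om by exact: open_nbhs_nbhs.
  apply: filterS2 nO (jc _ Gx) => y Oy jy.
  have [py|Gy|my] := OmP Oy; [exact: same| |exact: samem].
  have [_ nmy] := Gam_notin Gy.
  near=> y'; rewrite [increment x y]incrementp//.
  have [my'|my'] := pselect (Omm y').
    by rewrite !incrementm//; have := jy Gy; lra.
  by rewrite !incrementp//; ring.
- have : nbhs x Omm by exact: open_nbhs_nbhs.
  by apply: filterS => y py; apply: samem.
Unshelve. all: by end_near. Qed.

Lemma potential_connected : jump_locally_constant -> connected Gam ->
  exists z, potential z.
Proof.
move=> jc cG.
have [c hc] : exists c, forall x, Gam x -> Yp x - Ym x = c.
  have [[x0 G0]|G0] := pselect (Gam !=set0); last first.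
    by exists 0 => x Gx; exfalso; apply: G0; exists x.
  exists (Yp x0 - Ym x0) => x Gx.
  by apply: (@locally_constant_connected _ _ Gam (fun x => Yp x - Ym x)).
pose z y := if `[< Omm y >] then Ym y + c else Yp y.
have zm y : Omm y -> z y = Ym y + c by move=> my; rewrite /z ifT//; exact/asboolP.
have zp y : ~ Omm y -> z y = Yp y by move=> my; rewrite /z ifF//; exact/asboolPn.
exists z => x Ox; have [px|Gx|mx] := OmP Ox.
- have : nbhs x Omp by exact: open_nbhs_nbhs.
  by apply: filterS => y py; rewrite !zp ?incrementp//; exact: Omp_not_Omm.
- have [_ nmx] := Gam_notin Gx.
  near=> y; rewrite (zp x)//; have [my|my] := pselect (Omm y).
    by rewrite zm// incrementm//; have := hc _ Gx; lra.
  by rewrite zp// incrementp.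
- have : nbhs x Omm by exact: open_nbhs_nbhs.
  by apply: filterS => y my; rewrite !zm// incrementm//; ring.
Unshelve. all: by end_near. Qed.

Variable z : 'rV[R]_m.+1 -> R.
Hypothesis zP : potential z.

Lemma potential_slope xi : exists rho L : R, [/\ 0 < rho, 0 <= L &
  forall x, Om x -> `|x - xi| < rho -> slope_le L z x].
Proof.
have [r1 [L1 [r10 L10 h1]]] := ext_lipschitz xi Cp.
have [r2 [L2 [r20 L20 h2]]] := ext_lipschitz xi Cm.
exists (Order.min r1 r2), (Order.max L1 L2).
split; [by rewrite lt_min r10|by rewrite le_max L10|].
move=> x Ox; rewrite lt_min => /andP[x1 x2].
have nr r : `|x - xi| < r -> \forall y \near x, `|y - xi| < r.
  move=> xr; apply/nbhs_rVP; exists (r - `|x - xi|); first by rewrite subr_gt0.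
  move=> y yx; rewrite -[y](subrK x) -addrA.
  by apply: (le_lt_trans (ler_normD _ _)); rewrite -ltrBrDr.
have n1 := nr _ x1; have n2 := nr _ x2; have ni := near_increment Ox.
have nz := zP Ox.
suff h : \forall y \near x, `|z y - z x| <= Order.max L1 L2 * `|y - x| by exact: h.
near=> y.
have y1 : `|y - xi| < r1 by near: y.
have y2 : `|y - xi| < r2 by near: y.
have -> : z y - z x = increment x y by near: y.
have : Om y /\
  ((Omm y /\ increment x y = Ym y - Ym x /\ closure Omm x) \/
   (~ Omm y /\ increment x y = Yp y - Yp x /\ closure Omp x)) by near: y.
move=> [_ [[_ [-> cx]]|[_ [-> cx]]]].
  by apply: (le_trans (h2 _ _ x2 y2 cx)); rewrite ler_wpM2r// le_max lexx orbT.
by apply: (le_trans (h1 _ _ x1 y1 cx)); rewrite ler_wpM2r// le_max lexx.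
Unshelve. all: by end_near. Qed.

End potential.

(** The centre [xi] ranges over the whole space, so the slopes may not blow up at the boundary of
    [Om]. *)
Definition locally_slope_bounded (R : realType) (n : nat) (Om : set 'rV[R]_n)
    (z : 'rV[R]_n -> R) := forall xi, exists rho L : R, [/\ 0 < rho, 0 <= L &
  forall x, Om x -> `|x - xi| < rho -> slope_le L z x].

Lemma slope_bounded_continuous (R : realType) (n : nat) (Om : set 'rV[R]_n)
    (z : 'rV[R]_n -> R) x :
  locally_slope_bounded Om z -> Om x -> {for x, continuous z}.
Proof.
move=> /(_ x)[rho [L [r0 L0 h]]] Ox.
by have := h x Ox; rewrite subrr normr0 => /(_ r0); exact: slope_le_continuous.
Qed.

Lemma closure_bounded_compact (R : realType) (n : nat) (Om : set 'rV[R]_n) :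
  bounded_set Om -> compact (closure Om).
Proof.
move=> [M [Mr hM]]; apply: bounded_closed_compact; last exact: closed_closure.
exists (M + 2); split; first exact: num_real.
move=> y yM x cx; have [w [Ow]] := cx _ (nbhsx_ballx x 1 ltr01).
rewrite -ball_normE /= => xw; rewrite -[x](subrK w).
have : `|w| <= M + 1 by apply: hM => //; rewrite ltrDl.
by move=> h; apply: (le_trans (ler_normD _ _)); lra.
Qed.

Lemma continuous_near_bound (R : realType) (n : nat) (z : 'rV[R]_n -> R) x :
  {for x, continuous z} -> \forall y \near x, `|z y| <= `|z x| + 1.
Proof.
move=> /cvgrPdist_lt/(_ _ ltr01); apply: filterS => y.
set a := z x; set b := z y => ab.
by have := ler_normB a (a - b); rewrite opprB addrC subrK; lra.
Qed.

(** * Potentials on a bounded C^k domain are bounded *)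

Section domain_bound.
Variables (R : realType) (m : nat) (Om : set 'rV[R]_m.+1) (z : 'rV[R]_m.+1 -> R).

(* Near a boundary point the domain is an epigraph, so one can move a fixed
   distance along the last axis into a compact part of the domain. *)
Lemma slope_bounded_bounded k : Ck_domain k Om -> bounded_set Om ->
  locally_slope_bounded Om z -> exists M, forall x, Om x -> `|z x| <= M.
Proof.
move=> [[oOm _] bOm] bdOm sz.
have cO := closure_bounded_compact bdOm.
have [x a b ab h /h/le_trans|xi cxi|M hM] := @compact_bound R _ (closure Om)
  (fun M x => Om x -> `|z x| <= M) cO; first exact.
- have [Oxi|nOxi] := pselect (Om xi).
    exists (`|z xi| + 1).
    have := continuous_near_bound (slope_bounded_continuous sz Oxi).
    by apply: filterS => y h _.
  have bxi : boundary Om xi.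
    by split => //; rewrite -/(interior Om xi); move=> /nbhs_singleton.
  have [r [p [Q [g [r0 QQ _ OE bE]]]]] := bOm _ bxi.
  have [rho [L [rho0 L0 hL]]] := sz xi.
  have := nbhs_eball xi r0 => /nbhs_rVP[r1 r10 hr1].
  pose v := row ord_max Q^T.
  (* Within [e] of [xi] both the slope bound and the chart are available. The length [s] is such
     that shifts by at most [s] along [v] move points by at most [e / 2]. *)
  pose e := Order.min rho r1.
  have e0 : 0 < e by rewrite lt_min rho0.
  pose s := e / (2 * (`|v| + 1)).
  have s0 : 0 < s by rewrite divr_gt0// mulr_gt0.
  have sv t : 0 <= t <= s -> `|t *: v| <= e / 2.
    move=> /andP[t0 ts]; rewrite normrZ ger0_norm//.
    apply: (le_trans (ler_wpM2r (normr_ge0 v) ts)).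
    rewrite (_ : s * `|v| = e / 2 * (`|v| / (`|v| + 1))); last first.
      by rewrite /s; field; rewrite lt0r_neq0.
    by rewrite ler_piMr ?divr_ge0 ?(ltW e0)// ler_pdivrMr// mul1r lerDl.
  have shift_coords x t : xbar (coords p Q (x + t *: v)) = xbar (coords p Q x) /\
      xlast (coords p Q (x + t *: v)) = xlast (coords p Q x) + t.
    rewrite {1 3}[x](cartesian_sum p x QQ) -!addrA -scalerDl.
    exact: cartesian_coords.
  have ebd x : `|x - xi| < e / 2 -> forall t, 0 <= t <= s -> `|x + t *: v - xi| < e.
    move=> xe t /sv tv; rewrite addrAC.
    by apply: (le_lt_trans (ler_normD _ _)); lra.
  have inOm x t : `|x - xi| < e / 2 -> 0 <= t <= s ->
      g (xbar (coords p Q x)) < xlast (coords p Q x) + t -> Om (x + t *: v).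
    move=> xe ts gx; suff : (Om `&` eball xi r) (x + t *: v) by case.
    rewrite OE /=; have [-> ->] := shift_coords x t; split=> //.
    by apply: hr1; have := ebd _ xe _ ts; rewrite lt_min => /andP[].
  have s01 : 0 <= s <= s by rewrite lexx ltW.
  have Oq : Om (xi + s *: v).
    apply: inOm => //; first by rewrite subrr normr0 divr_gt0.
    have : (boundary Om `&` eball xi r) xi.
      by split => //; apply: hr1; rewrite subrr normr0.
    by rewrite bE => -[_ ->]; rewrite ltrDl.
  have nq := continuous_near_bound (slope_bounded_continuous sz Oq).
  exists (`|z (xi + s *: v)| + 1 + L * (e / 2)).
  have /nbhs_rVP[r2 r20 hr2] := nq.
  apply/nbhs_rVP; exists (Order.min (e / 2) r2); first by rewrite lt_min r20 divr_gt0.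
  move=> x; rewrite lt_min => /andP[xe xr2] Ox.
  have gx : g (xbar (coords p Q x)) < xlast (coords p Q x).
    have : (Om `&` eball xi r) x.
      split=> //; apply: hr1; apply: (lt_trans xe).
      by have : e <= r1 := ltac:(by rewrite ge_min lexx orbT); lra.
    by rewrite OE => -[].
  have : `|z (x + s *: v) - z x| <= L * `|x + s *: v - x|.
    (* Moving up from a point above the graph stays above it, so the whole segment lies in [Om]. *)
    apply: slope_le_segment => t t01.
    rewrite [x + s *: v]addrC addrK scalerA.
    have ts : 0 <= t * s <= s.
      by have := t01 => /andP[t0 t1]; rewrite mulr_ge0 ?(ltW s0)// ler_piMl// ltW.
    apply: hL; first by apply: inOm => //; lra.
    by have := ebd _ xe _ ts; rewrite lt_min => /andP[].
  rewrite [x + s *: v]addrC addrK [s *: v + x]addrC => h1.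
  have h2 : `|z (x + s *: v)| <= `|z (xi + s *: v)| + 1.
    by apply: hr2; rewrite opprD addrACA subrr addr0.
  have h3 : L * `|s *: v| <= L * (e / 2) by rewrite ler_wpM2l// sv.
  rewrite -[z x](subKr (z (x + s *: v))).
  by apply: (le_trans (ler_normB _ _)); lra.
- by exists M => x Ox; apply: hM => //; exact: subset_closure.
Qed.

End domain_bound.

Lemma slope_le_lipschitz (R : realType) (V : normedModType R) (L : R) (f : V -> R) x :
  (forall y, `|f y - f x| <= L * `|y - x|) -> slope_le L f x.
Proof. by move=> h; apply: nearW. Qed.

(** * Pointwise derivatives off a null set are weak derivatives *)

Section supported_integral.
Variables (R : realType) (n : nat).
Local Notation mu := (lebesgue_rV R n).

Lemma continuous_measurable_rVT (f : 'rV[R]_n -> R) : continuous f -> measurable_fun setT f.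
Proof. by move=> cf; apply: continuous_measurable_rV; [exact: openT|move=> x _; exact: cf]. Qed.

Lemma supported_bounded (f : 'rV[R]_n -> R) (K : set 'rV[R]_n) : compact K ->
  continuous f -> (forall x, ~ K x -> f x = 0) -> exists C, forall x, `|f x| <= C.
Proof.
move=> cK cf fK; have [x a b ab /le_trans|x _|D hD] :=
  compact_bound (P := fun D x => `|f x| <= D) cK; first exact.
  by exists (`|f x| + 1); exact: continuous_near_bound (cf x).
exists (Order.max D 0) => x; have [Kx|nKx] := pselect (K x).
  by rewrite le_max hD.
by rewrite fK// normr0 le_max lexx orbT.
Qed.

Lemma supported_integrable (f : 'rV[R]_n -> R) (K : set 'rV[R]_n) (C : R) :
  compact K -> measurable_fun setT f -> (forall x, `|f x| <= C) ->
  (forall x, ~ K x -> f x = 0) -> mu.-integrable setT (EFin \o f).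
Proof.
move=> cK mf fC fK; have [B KB] := compact_norm_bound cK.
have mK := compact_measurable_rV cK.
have : mu.-integrable K (EFin \o f).
  apply: (bounded_integrable_rV (M := B) (C := C)) => //.
  exact: measurable_funTS.
move=> /(integrable_mkcond _ mK); congr (integrable _ _ _).
apply/funext => x; rewrite patchE; case: ifPn => // xK /=.
by rewrite fK//; move: xK; rewrite notin_setE.
Qed.

Lemma supported_Rintegral (f : 'rV[R]_n -> R) (D : set 'rV[R]_n) :
  (forall x, ~ D x -> f x = 0) -> \int[mu]_(x in D) f x = \int[mu]_x f x.
Proof.
move=> fD; rewrite Rintegral_mkcond; apply: eq_Rintegral => x _.
by rewrite patchE; case: ifPn => // xK; rewrite fD//; move: xK; rewrite notin_setE.
Qed.

End supported_integral.

Section test_functions.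
Variables (R : realType) (n : nat).
Implicit Types (phi : 'rV[R]_n -> R).

Lemma test_function_C1 Om phi : test_function Om phi ->
  (forall x, differentiable phi x) /\
  forall j, continuous (fun x => 'D_(Defs.basis j) phi x).
Proof.
by move=> [/(_ 1%N) [d c] _]; split=> [x|j x]; [exact: d|exact: c].
Qed.

Lemma derive_zero_near (phi : 'rV[R]_n -> R) x v : (\forall y \near x, phi y = 0) ->
  'D_v phi x = 0.
Proof.
by move=> h; rewrite (@near_eq_derive _ _ _ phi (cst 0) x v) ?derive_cst.
Qed.

End test_functions.

Lemma compactC_near (R : realType) (n : nat) (K : set 'rV[R]_n) x : compact K -> ~ K x ->
  \forall y \near x, ~ K y.
Proof.
move=> cK nK; apply: open_nbhs_nbhs; split => //; apply: closed_openC.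
exact: compact_closed.
Qed.

Section product_with_test.
Variables (R : realType) (n : nat) (Om : set 'rV[R]_n) (z phi : 'rV[R]_n -> R) (M : R).
Hypotheses (oOm : open Om) (sz : locally_slope_bounded Om z)
  (zM : forall x, Om x -> `|z x| <= M) (tphi : test_function Om phi).
Local Notation w := (fun x : 'rV[R]_n => z x * phi x).

Let outside x : ~ Om x -> \forall y \near x, phi y = 0.
Proof.
move=> nOx; case: tphi => _ [K [cK KO K0]].
have : \forall y \near x, ~ K y by apply: compactC_near => // /KO.
by apply: filterS => y; exact: K0.
Qed.

Let slope_near (x : 'rV[R]_n) : exists L : R, \forall y \near x, slope_le L w y.
Proof.
have [Ox|nOx] := pselect (Om x); last first.
  exists 0; have := nbhs_interior (outside nOx); apply: filterS => y h.
  have h0 := nbhs_singleton h.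
  by apply: filterS h => y' h'; rewrite h' h0 !mulr0 subrr normr0 mul0r.
have [r1 [L1 [r10 L10 h1]]] := sz x.
have Cphi : Ck 1 setT phi by case: tphi => /(_ 1%N).
have [r2 [L2 [r20 _ h2]]] := C1_lipschitz openT Cphi (I : setT x).
have nF := continuous_near_bound (differentiable_continuous ((test_function_C1 tphi).1 x)).
exists (M * L2 + (`|phi x| + 1) * L1).
have nO : nbhs x Om by exact: open_nbhs_nbhs.
have n2 : \forall y \near x, `|y - x| < r2 by apply/nbhs_rVP; exists r2.
have n2' := nbhs_interior n2; have nO' := nbhs_interior nO.
near=> y.
have s1 : slope_le L1 z y by apply: h1 => //; near: y.
have yO : \forall y' \near y, Om y' by near: y.
have y2' : \forall y' \near y, `|y' - x| < r2 by near: y.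
have phiy : `|phi y| <= `|phi x| + 1 by near: y.
apply: filterS3 s1 yO y2' => y' s1 Oy' y'2.
rewrite (_ : _ - _ = z y' * (phi y' - phi y) + phi y * (z y' - z y)); last by ring.
apply: (le_trans (ler_normD _ _)); rewrite mulrDl !normrM -!mulrA.
by apply: lerD; apply: ler_pM => //; [exact: zM|exact: h2].
Unshelve. all: by end_near. Qed.

(** [z] is controlled only on [Om], but [phi] vanishes near every point outside. Slopes of the
    product are thus locally bounded everywhere, uniformly on the compact [K], and zero off [K]. *)
Lemma test_product_lipschitz : exists2 L, 0 <= L &
  forall x y, `|z y * phi y - z x * phi x| <= L * `|y - x|.
Proof.
case: (tphi) => _ [K [cK KO K0]].
have [x a b ab|x _|L hL] := compact_bound (P := fun L x => slope_le L w x) cK.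
- exact: slope_le_mono.
- exact: slope_near.
have Lmax : 0 <= Order.max L 0 by rewrite le_max lexx orbT.
exists (Order.max L 0) => // x y.
apply: (@slope_le_segment _ _ _ w) => t _; set u := x + _.
have [Ku|nKu] := pselect (K u).
  by apply: slope_le_mono (hL _ Ku); rewrite le_max lexx.
apply: (@slope_le_mono _ _ 0) => //.
have nu := compactC_near cK nKu.
by apply: filterS nu => v Kv; rewrite !K0// !mulr0 subrr normr0 mul0r.
Qed.

End product_with_test.

Section weak_derivative.
Variables (R : realType) (n : nat) (Om N : set 'rV[R]_n) (z G : 'rV[R]_n -> R)
  (j : 'I_n) (B M C : R).
Local Notation mu := (lebesgue_rV R n).
Local Notation e := (Defs.basis j : 'rV[R]_n).
Hypotheses (oOm : open Om) (OmB : forall x, Om x -> `|x| <= B)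
  (sz : locally_slope_bounded Om z) (zM : forall x, Om x -> `|z x| <= M)
  (mG : measurable_fun Om G) (GC : forall x, Om x -> `|G x| <= C)
  (N0 : mu.-negligible N)
  (dz : forall x, Om x -> ~ N x -> is_derive x e z (G x)).

Lemma bounded_locally_integrable (f : 'rV[R]_n -> R) (D : R) : measurable_fun Om f ->
  (forall x, Om x -> `|f x| <= D) -> locally_integrable_rV Om f.
Proof.
move=> mf fD; split=> // K cK KO.
apply: (@bounded_integrable_rV _ _ K f B D); first exact: compact_measurable_rV.
- by move=> x /KO; exact: OmB.
- by apply: measurable_funS mf => //; exact: open_measurable_rV.
- by move=> x /KO; exact: fD.
Qed.

(* the difference quotients of z * phi have zero integral by translation
   invariance and are dominated, z * phi being Lipschitz *)
Lemma weak_partial_ae_derive : weak_partial Om j z G.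
Proof.
have mOm := open_measurable_rV oOm.
have cz x : Om x -> {for x, continuous z} by exact: slope_bounded_continuous.
have mz : measurable_fun Om z by exact: continuous_measurable_rV.
split; [exact: bounded_locally_integrable zM|exact: bounded_locally_integrable GC|].
move=> phi tphi.
have [L L0 hL] := test_product_lipschitz oOm sz zM tphi.
have [dphi cphi] := test_function_C1 tphi.
case: (tphi) => _ [K [cK KO K0]].
pose w x := z x * phi x.
pose f x := z x * 'D_e phi x + (G \_ Om) x * phi x.
have nK x : ~ K x -> \forall y \near x, phi y = 0.
  by move=> /(compactC_near cK); apply: filterS => y; exact: K0.
have D0 x : ~ K x -> 'D_e phi x = 0 by move=> /nK; exact: derive_zero_near.
have cw : continuous w.
  move=> x; apply: (@slope_le_continuous _ _ L).
  by apply: slope_le_lipschitz => y; exact: hL.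
have mw := continuous_measurable_rVT cw.
have wK x : ~ K x -> w x = 0 by move=> /K0 h; rewrite /w h mulr0.
have [Bw hBw] := supported_bounded cK cw wK.
have iw : mu.-integrable setT (EFin \o w) := supported_integrable cK mw hBw wK.
have [BK hBK] := compact_norm_bound cK.
(* The steps [h k] being at most 1, the ball [D] of radius [r] contains the supports of all the
   difference quotients [Q k]. *)
pose r := BK + `|e|.
pose D := [set x : 'rV[R]_n | `|x| <= r].
have cD : compact D.
  have := @compact_norm_ball R n 0 r.
  by congr compact; apply/seteqP; split=> x; rewrite /D /= subr0.
have mD := compact_measurable_rV cD.
pose h k : R := k.+1%:R^-1.
have h0 k : 0 < h k by rewrite /h invr_gt0.
have h1 k : h k <= 1 by rewrite /h invf_le1// ler1n.
pose Q k x := (h k)^-1 * (w (x + h k *: e) - w x).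
have QD k x : ~ D x -> Q k x = 0.
  move=> nDx; have nKx : ~ K x.
    by move=> /hBK xB; apply: nDx; rewrite /D /= /r (le_trans xB)// lerDl.
  have nKx' : ~ K (x + h k *: e).
    move=> /hBK xB; apply: nDx; rewrite /D /= /r -[x](addrK (h k *: e)).
    apply: (le_trans (ler_normB _ _)); apply: lerD => //.
    by rewrite normrZ ger0_norm ?(ltW (h0 k))// ler_piMl.
  by rewrite /Q !wK// subrr mulr0.
have QL k x : `|Q k x| <= L * `|e|.
  rewrite /Q normrM gtr0_norm ?invr_gt0//.
  have := hL x (x + h k *: e); rewrite -/(w _) -/(w x) [x + _]addrC addrK normrZ.
  rewrite gtr0_norm// => hw; rewrite mulrC ler_pdivrMr//.
  by rewrite (le_trans hw)// mulrA mulrAC.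
have cQ k : continuous (Q k).
  move=> x; have ct : continuous (translate (h k *: e)).
    by move=> y; apply: (@cvgD _ _ _ (nbhs y)); [exact: cvg_id|exact: cvg_cst].
  have cg : {for x, continuous (w \o translate (h k *: e))}.
    by apply: continuous_comp; [exact: ct|exact: cw].
  have cst_ : {for x, continuous (cst (h k)^-1 : 'rV[R]_n -> R)} by exact: cst_continuous.
  by have := continuousM cst_ (continuousB cg (cw x)); exact.
have intQ k : \int[mu]_(x in D) Q k x = 0.
  rewrite supported_Rintegral; last exact: QD.
  rewrite /Q RintegralZl//.
    rewrite RintegralB//; last exact: integrable_translate.
    by rewrite Rintegral_translate// subrr mulr0.
  exact: (integrableB measurableT (integrable_translate (h k *: e) iw) iw).
have fN x : ~ N x -> is_derive x e w (f x).
  move=> nNx; have [Ox|nOx] := pselect (Om x).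
    have dzx := dz Ox nNx.
    have dpx : is_derive x e phi ('D_e phi x).
      by apply: derivableP; exact: diff_derivable.
    have := is_deriveM dzx dpx; congr (is_derive _ _ _ _).
    by rewrite /f patchE mem_set//; congr (_ + _); exact: mulrC.
  have nKx : ~ K x by move=> /KO.
  rewrite /f D0// K0// !mulr0 addr0.
  have h0' : is_derive x e (cst 0 : 'rV[R]_n -> R) 0 by exact: is_derive_cst.
  apply: near_eq_is_derive h0'.
  by have := nK _ nKx; apply: filterS => y hy; rewrite /w hy mulr0.
have Qf x : ~ N x -> Q k x @[k --> \oo] --> f x.
  move=> /fN [dw <-].
  have := dw; rewrite /derivable => dw'.
  have : h^-1 *: (w (h *: e + x) - w x) @[h --> 0^'] --> 'D_e w x by exact: dw.
  move=> /cvgr_dnbhsP /(_ h) H.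
  rewrite (_ : (fun k => Q k x) = (fun k => (h k)^-1 *: (w (h k *: e + x) - w x))).
    by apply: H; split=> [k|]; [exact: lt0r_neq0|exact: cvg_harmonic].
  by apply/funext => k; rewrite /Q [x + _]addrC.
(* Nothing is known of [z] outside [Om], yet the first summand is continuous on the whole space,
   since the derivative of [phi] vanishes near each point outside [Om]. *)
have mf : measurable_fun setT f.
  apply: measurable_funD.
    apply: continuous_measurable_rVT => x; have [Ox|nOx] := pselect (Om x).
      by have := continuousM (cz x Ox) (cphi j x); exact.
    apply: (@slope_le_continuous _ _ 0).
    have nKx : ~ K x by move=> /KO.
    have := compactC_near cK nKx; apply: filterS => y nKy.
    by rewrite !D0// !mulr0 subrr normr0 mul0r.
  apply: measurable_funM; first exact: (measurable_restrictT G mOm).1.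
  by apply: continuous_measurable_rVT => x; exact: differentiable_continuous.
have [] := @dominated_convergence _ _ _ mu D mD (fun k x => (Q k x)%:E) (EFin \o f)
  (cst (L * `|e|)%:E).
- by move=> k; apply/measurable_EFinP/measurable_funTS; exact: continuous_measurable_rVT.
- by apply/measurable_EFinP/measurable_funTS.
- case: N0 => N' [mN' N'0 NN']; exists N'; split=> // x /= nx; apply: NN'.
  apply: contrapT => nNx; apply: nx => _; apply/cvg_EFin; last exact: Qf.
  exact: nearW.
- by apply: (bounded_integrable_rV (f := cst (L * `|e|)) (M := r) (C := `|L * `|e| |) mD).
- by apply: aeW => x k _ /=; rewrite lee_fin.
move=> iF _ /= cvgQ.
have iQ k : mu.-integrable D (EFin \o Q k).
  apply: (bounded_integrable_rV (M := r) (C := L * `|e|) mD) => //.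
  by apply/measurable_funTS; exact: (continuous_measurable_rVT (cQ k)).
have e0 k : (\int[mu]_(x in D) (Q k x)%:E)%E = 0%E.
  have := congr1 EFin (intQ k); rewrite /Rintegral fineK; first by [].
  by rewrite integrable_fin_num//; exact: iQ.
have intf : (\int[mu]_(x in D) (f x)%:E)%E = 0%E.
  move: cvgQ; rewrite (_ : (fun k => _) = cst 0%E); last exact/funext.
  by move=> c0; apply: (cvg_unique _ c0 (cvg_cst _)).
have fD x : ~ D x -> f x = 0.
  move=> nDx; have nKx : ~ K x.
    by move=> /hBK xB; apply: nDx; rewrite /D /= /r (le_trans xB)// lerDl.
  by rewrite /f D0// K0// !mulr0 addr0.
have fOm x : ~ Om x -> f x = 0.
  by move=> nOx; have nKx : ~ K x by [move=> /KO]; rewrite /f D0// K0// !mulr0 addr0.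
have : \int[mu]_(x in Om) f x = 0.
  by rewrite supported_Rintegral// -(supported_Rintegral fD) /Rintegral intf.
have [C1 hC1] := supported_bounded cK (cphi j) D0.
have cphi0 : continuous phi by move=> x; exact: differentiable_continuous.
have [C2 hC2] := supported_bounded cK cphi0 K0.
have i1 : mu.-integrable Om (EFin \o (fun x => z x * 'D_e phi x)).
  apply: (bounded_integrable_rV (M := B) (C := M * C1) mOm) => //.
    apply: measurable_funM => //; apply/measurable_funTS.
    exact: (continuous_measurable_rVT (cphi j)).
  by move=> x Ox; rewrite normrM; apply: ler_pM => //; exact: zM.
have i2 : mu.-integrable Om (EFin \o (fun x => G x * phi x)).
  apply: (bounded_integrable_rV (M := B) (C := C * C2) mOm) => //.
    apply: measurable_funM => //; apply/measurable_funTS.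
    exact: (continuous_measurable_rVT cphi0).
  by move=> x Ox; rewrite normrM; apply: ler_pM => //; exact: GC.
rewrite (_ : \int[mu]_(x in Om) f x =
    \int[mu]_(x in Om) (z x * 'D_e phi x + G x * phi x)); last first.
  by apply: eq_Rintegral => x xO; rewrite /f patchE xO.
by rewrite RintegralD// => /eqP; rewrite addr_eq0 => /eqP.
Qed.

End weak_derivative.

Lemma Linfty_bounded (R : realType) (n : nat) (Om : set 'rV[R]_n) (f : 'rV[R]_n -> R) (C : R) :
  measurable_fun Om f -> (forall x, Om x -> `|f x| <= C) -> Linfty Om f.
Proof.
move=> mf fC; split=> //; rewrite unlock /=; case: ifPn => _; last exact: ltry.
apply: (@le_lt_trans _ _ (Order.max C 0)%:E); last exact: ltry.
apply/ess_supP; apply: aeW => x /=; rewrite lee_fin patchE; case: ifPn => xO.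
  by rewrite le_max fC//; move: xO; rewrite inE.
by rewrite normr0 le_max lexx orbT.
Qed.

(** * From the rank-one jump to the glued gradient *)

Section gluing.
Variables (R : realType) (m : nat) (Om Omp Omm Gam : set 'rV[R]_m.+1)
  (yp ym nu : 'rV[R]_m.+1 -> 'rV[R]_m.+1).
Hypotheses (Ck_Om : Ck_domain 1 Om) (bdOm : bounded_set Om)
  (OmE : Om = Omp `|` Gam `|` Omm) (oOmp : open Omp)
  (oOmm : open Omm) (dis : Omp `&` Omm = set0) (Gp : Gam = Om `&` boundary Omp)
  (Gm : Gam = Om `&` boundary Omm) (sG : Ck_surface 1 Gam)
  (Cp : C1_closure_vec Omp yp) (Cm : C1_closure_vec Omm ym)
  (nuP : outward_unit_normal Gam Omp nu).

Let oOm : open Om. Proof. by case: Ck_Om => -[]. Qed.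

Lemma Gam_measurable : measurable Gam.
Proof.
rewrite Gp /boundary; apply: measurableI; first exact: open_measurable_rV.
apply: measurableD; first by apply: closed_measurable_rV; exact: closed_closure.
by apply: open_measurable_rV; exact: open_interior.
Qed.

(** On a tangent vector [v] the differential of the difference of the extensions is
    [a x ord0 i * dotp v (nu x)], which is zero. *)
Lemma rank_one_jump_constant i : rank_one_jump Omp Omm Gam yp ym nu ->
  jump_locally_constant Omp Omm Gam (cpt yp i) (cpt ym i).
Proof.
move=> [a _ ha] x0 G0.
have [Up [oUp sUp [dp _] _]] := extP (Cp i).
have [Um [oUm sUm [dm _] _]] := extP (Cm i).
have [cp cm] := Gam_closure Gp Gm G0.
apply: (@surface_locally_constant _ _ Gam (Up `&` Um)
  (fun y => ext Omp (cpt yp i) y - ext Omm (cpt ym i) y)) => //.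
- exact: openI.
- by split; [exact: sUp|exact: sUm].
- by move=> x [Ux Vx]; apply: differentiableB; [exact: dp|exact: dm].
move=> x v [Ux Vx] Gx tv.
have dpx := dp _ Ux; have dmx := dm _ Vx.
have -> : 'd (fun y => ext Omp (cpt yp i) y - ext Omm (cpt ym i) y) x v =
    'd (ext Omp (cpt yp i)) x v - 'd (ext Omm (cpt ym i)) x v.
  by have := diffB dpx dmx => /(congr1 (fun f => f v)).
rewrite !diff_basis// -sumrB.
have [_ /(_ _ Gx)[_ tnu _]] := nuP.
rewrite (_ : \sum_j _ = a x ord0 i * dotp v (nu x)); first by rewrite tnu// mulr0.
rewrite /dotp mulr_sumr; apply: eq_bigr => j _.
have /matrixP/(_ i j) := ha _ Gx; rewrite !mxE -/(ext _ _) -/(ext _ _) => ->.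
by ring.
Qed.

Lemma glue_potentials : rank_one_jump Omp Omm Gam yp ym nu ->
  (forall i, exists z, potential Om Omp Omm (cpt yp i) (cpt ym i) z) ->
  glued_gradient Om Omp Omm yp ym.
Proof.
move=> jump /choice[z hz].
(* The value 0 on [Gam] is arbitrary, as [Gam] is a null set; it keeps [G] measurable and
   bounded. *)
pose G x : 'M[R]_m.+1 := if `[< Omp x >] then Dmx yp x else
  if `[< Omm x >] then Dmx ym x else 0.
have Gpx x : Omp x -> G x = Dmx yp x by move=> px; rewrite /G ifT//; exact/asboolP.
have Gmx x : Omm x -> G x = Dmx ym x.
  move=> mx; rewrite /G ifF; last by apply/asboolPn => /(Omp_not_Omm dis).
  by rewrite ifT//; exact/asboolP.
have G0x x : Gam x -> G x = 0.
  move=> Gx; have [npx nmx] := Gam_notin oOmp oOmm Gp Gm Gx.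
  rewrite /G ifF; last exact/asboolPn.
  by rewrite ifF//; exact/asboolPn.
pose Z x : 'rV[R]_m.+1 := \row_i z i x.
have cZ i : cpt Z i = z i by apply/funext => x; rewrite /cpt /Z mxE.
have sz i : locally_slope_bounded Om (z i).
  by move=> xi; apply: (@potential_slope _ _ Om Omp Omm Gam (cpt yp i) (cpt ym i)) => //; exact: hz.
have bz i := slope_bounded_bounded Ck_Om bdOm (@sz i).
have cOm := closure_bounded_compact bdOm.
have [B hB] := compact_norm_bound cOm.
have OmB x : Om x -> `|x| <= B by move=> /subset_closure; exact: hB.
have mz i : measurable_fun Om (z i).
  by apply: continuous_measurable_rV => // x Ox; exact: slope_bounded_continuous (sz i) Ox.
have subp : Omp `<=` Om by move=> x px; rewrite OmE; left; left.
have subm : Omm `<=` Om by move=> x px; rewrite OmE; right.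
have ccl (A : set 'rV[R]_m.+1) : A `<=` Om -> compact (closure A).
  by move=> AO; apply: subclosed_compact cOm (closureS AO); exact: closed_closure.
have bG i j : exists C, forall x, Om x -> `|G x i j| <= C.
  have [C1 hC1] := ext_bounded_derive j (ccl _ subp) (Cp i).
  have [C2 hC2] := ext_bounded_derive j (ccl _ subm) (Cm i).
  exists (Order.max (Order.max C1 C2) 0) => x /(OmP OmE)[px|Gx|mx].
  - by rewrite Gpx// mxE (derive_ext _ oOmp (Cp i))// !le_max hC1.
  - by rewrite G0x// mxE normr0 !le_max lexx !orbT.
  - by rewrite Gmx// mxE (derive_ext _ oOmm (Cm i))// !le_max hC2// orbT.
have mG i j : measurable_fun Om (fun x => G x i j).
  have mp := open_measurable_rV oOmp; have mm := open_measurable_rV oOmm.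
  have mGam := Gam_measurable.
  rewrite OmE; apply/measurable_funU => //; first exact: measurableU.
  split; first apply/measurable_funU => //; first split.
  - apply: (@eq_measurable_fun _ _ _ _ _ (fun x => 'D_(Defs.basis j) (cpt yp i) x)).
      by move=> x; rewrite inE => px; rewrite Gpx// mxE.
    by apply: continuous_measurable_rV => // x px; case: (Cp i) => -[_ /(_ j)] + _; exact.
  - apply: (@eq_measurable_fun _ _ _ _ _ (cst (0 : R))); last exact: measurable_cst.
    by move=> x; rewrite inE => px; rewrite G0x// mxE.
  - apply: (@eq_measurable_fun _ _ _ _ _ (fun x => 'D_(Defs.basis j) (cpt ym i) x)).
      by move=> x; rewrite inE => px; rewrite Gmx// mxE.
    by apply: continuous_measurable_rV => // x px; case: (Cm i) => -[_ /(_ j)] + _; exact.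
have zd i j x : Om x -> ~ Gam x -> is_derive x (Defs.basis j : 'rV[R]_m.+1) (z i) (G x i j).
  move=> Ox nGx.
  (* Near such an [x] the potential is the extension plus the constant [z i x - ext O f x]. *)
  have key (O : set 'rV[R]_m.+1) (f : 'rV[R]_m.+1 -> R) : C1_closure O f -> O x ->
      (\forall y \near x, increment Omp Omm (cpt yp i) (cpt ym i) x y = ext O f y - ext O f x) ->
      is_derive x (Defs.basis j : 'rV[R]_m.+1) (z i) ('D_(Defs.basis j) (ext O f) x).
    move=> cf Ox' inc; have [U [_ OU [df _] _]] := extP cf.
    have dfx : derivable (ext O f) x (Defs.basis j).
      by apply: diff_derivable; apply: df; apply: OU; exact: subset_closure.
    have := is_deriveD (derivableP dfx) (is_derive_cst (z i x - ext O f x) x (Defs.basis j)).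
    rewrite addr0; apply: near_eq_is_derive.
    have := hz i x Ox; apply: filterS2 inc => y e1 e2.
    rewrite -[RHS](subrK (z i x)) e2 e1 -[LHS]/(ext O f y + (z i x - ext O f x)).
    by ring.
  have [px|//|mx] := OmP OmE Ox.
  - rewrite Gpx// mxE (derive_ext _ oOmp (Cp i))//; apply: key => //.
    have : nbhs x Omp by exact: open_nbhs_nbhs.
    by apply: filterS => y py; rewrite incrementp//; exact: (Omp_not_Omm dis).
  - rewrite Gmx// mxE (derive_ext _ oOmm (Cm i))//; apply: key => //.
    have : nbhs x Omm by exact: open_nbhs_nbhs.
    by apply: filterS => y my; rewrite incrementm.
have wG : weak_gradient Om Z G.
  move=> i j; rewrite cZ; have [M hM] := bz i; have [C hC] := bG i j.
  apply: (weak_partial_ae_derive (N := Gam) oOm OmB (@sz i) hM (mG i j) hC).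
  exact: surface_negligible sG Gam_measurable.
exists Z.
  split=> [i|].
    by rewrite cZ; have [M hM] := bz i; exact: Linfty_bounded hM.
  exists G => // i j; have [C hC] := bG i j; exact: Linfty_bounded hC.
exists G => //; apply: aeW => x; split; [exact: Gpx|exact: Gmx].
Qed.

Theorem rank_one_jump_glued : connected Gam \/ simply_connected R Om ->
  rank_one_jump Omp Omm Gam yp ym nu -> glued_gradient Om Omp Omm yp ym.
Proof.
move=> top jump; apply: glue_potentials => // i.
have jc := rank_one_jump_constant i jump.
case: top => [cG|sc].
  by apply: (@potential_connected _ _ _ _ _ Gam).
apply: simply_connected_primitive sc => //.
by apply: (@increment_cocycle _ _ _ _ _ Gam).
Qed.

End gluing.

(** * A smooth function vanishing on a half line *)

Section flat.
Variable R : realType.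

(** The polynomial factor makes this family closed under differentiation, so smoothness is a plain
    induction on the order. *)
Definition flat (p : {poly R}) (t : R) : R :=
  if 0 < t then p.[t^-1] * expR (- t^-1) else 0.

Lemma flat_le0 p t : t <= 0 -> flat p t = 0.
Proof. by move=> t0; rewrite /flat ltNge t0. Qed.

Lemma flat_gt0 p t : 0 < t -> flat p t = p.[t^-1] * expR (- t^-1).
Proof. by move=> t0; rewrite /flat t0. Qed.

Lemma exp_dominates n (s : R) : 0 < s -> s ^+ n.+1 <= n.+1`!%:R * expR s.
Proof.
move=> /ltW /(expR_ge1Dxn n) h; rewrite mulrC -ler_pdivrMr ?ltr0n ?fact_gt0//.
by apply: le_trans h; rewrite lerDr.
Qed.

Lemma poly_bound (p : {poly R}) : exists C, forall s, 1 <= s ->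
  `|p.[s]| <= C * s ^+ (size p).
Proof.
exists (\sum_(i < size p) `|p`_i|) => s s1.
rewrite horner_coef (le_trans (ler_norm_sum _ _ _))// mulr_suml; apply: ler_sum => i _.
rewrite normrM ler_wpM2l// normrX ger0_norm; last lra.
by apply: ler_weXn2l => //; exact: ltnW.
Qed.

(** With [s = 1 / t], the exponential dominates one power of [s] more than the polynomial needs; the
    spare power is the factor [|t|]. The range [t <= 1] means [s >= 1], as [poly_bound] requires. *)
Lemma flat_bound p : exists2 C, 0 <= C & forall t, t <= 1 -> `|flat p t| <= C * `|t|.
Proof.
have [C hC] := poly_bound p.
exists (`|C| * (size p).+1`!%:R); first by rewrite mulr_ge0.
move=> t t1; have [t0|t0] := leP t 0; first by rewrite flat_le0// normr0 mulr_ge0// mulr_ge0.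
have s0 : 0 < t^-1 by rewrite invr_gt0.
rewrite flat_gt0// normrM (ger0_norm (expR_ge0 _)) (gtr0_norm t0).
have h1 : `|p.[t^-1]| <= `|C| * t^-1 ^+ size p.
  apply: (le_trans (hC _ _)); first by rewrite invf_ge1.
  by rewrite ler_wpM2r ?exprn_ge0 ?ler_norm// ltW.
apply: (le_trans (ler_wpM2r (expR_ge0 _) h1)).
rewrite -!mulrA ler_wpM2l// expRN ler_pdivrMr ?expR_gt0//.
have := exp_dominates (size p) s0.
rewrite exprS -(ler_pM2l t0) mulrA divff ?lt0r_neq0// mul1r => /le_trans; apply.
by rewrite le_eqVlt; apply/orP; left; apply/eqP; ring.
Qed.

(** With [s = 1 / t] one has [ds/dt = - s ^ 2], and the derivative of [p(s) exp(-s)] in [s] is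
    [(p' - p)(s) exp(-s)]. *)
Definition flat_deriv (p : {poly R}) : {poly R} := 'X^2 * (p - p^`()).

Lemma is_derive_flat p t : is_derive t (1 : R) (flat p) (flat (flat_deriv p) t).
Proof.
have [t0|t0|->] := ltgtP t 0.
- rewrite flat_le0 ?ltW//.
  have d0 : is_derive t 1 (cst 0 : R -> R) 0 by exact: is_derive_cst.
  apply: near_eq_is_derive d0.
  near=> s; rewrite flat_le0// ltW//; near: s; exact: lt_nbhsl.
- have nf : \forall s \near t, (fun s => p.[s^-1] * expR (- s^-1)) s = flat p s.
    by near=> s; rewrite flat_gt0//; near: s; exact: lt_nbhsr.
  apply: near_eq_is_derive nf _.
  have dinv : is_derive t 1 (fun s : R => s^-1) (- t ^- 2).
    have t_neq0 : (id t : R) != 0 by rewrite lt0r_neq0.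
    apply: DeriveDef; first exact: derivableV.
    by rewrite (@deriveV _ _ id t 1 t_neq0)// derive_id -[_ *: 1]/(_ * 1) mulr1.
  have d1 : is_derive t 1 (fun s : R => p.[s^-1]) (p^`().[t^-1] * - t ^- 2).
    exact: (@is_derive1_comp _ (horner p) (fun s : R => s^-1)).
  have dN : is_derive t 1 (fun s : R => - s^-1) (t ^- 2).
    by have := is_deriveN dinv; rewrite opprK; exact.
  have d2 : is_derive t 1 (fun s : R => expR (- s^-1)) (expR (- t^-1) * t ^- 2).
    exact: (@is_derive1_comp _ expR (fun s : R => - s^-1)).
  have := is_deriveM d1 d2; congr (is_derive _ _ _ _).
  rewrite flat_gt0// /flat_deriv hornerM hornerXn hornerD hornerN.
  by rewrite -![_ *: _]/(_ * _) -exprVn; ring.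
(* At 0 the difference quotient of [flat p] is [flat ('X * p)], which tends to 0 by [flat_bound]. *)
- rewrite flat_le0//.
  have [C C0 hC] := flat_bound ('X * p).
  have lim0 : h^-1 *: (flat p (h *: 1 + 0) - flat p 0) @[h --> 0^'] --> 0.
    apply/cvgrPdist_le => e e0; near=> h.
    have h1 : `|h| < Order.min 1 (e / (C + 1)).
      by near: h; apply: dnbhs0_lt; rewrite lt_min ltr01 divr_gt0// ltr_wpDl.
    move: h1; rewrite lt_min => /andP[h1 he].
    rewrite (@flat_le0 p 0)// subr0 addr0 sub0r normrN -[h *: 1]/(h * 1) mulr1.
    have -> : h^-1 *: flat p h = flat ('X * p) h.
      have [hle|hgt] := leP h 0; first by rewrite !flat_le0// scaler0.
      by rewrite !flat_gt0// hornerM hornerX -[_ *: _]/(_ * _) mulrA.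
    apply: (le_trans (hC _ _)); first by have := ler_norm h; lra.
    move: he; rewrite ltr_pdivlMr ?ltr_wpDl// => he.
    have : 0 <= `|h| by [].
    by nra.
  apply: DeriveDef; first by apply/cvg_ex; exists 0.
  exact: (cvg_lim _ lim0).
Unshelve. all: by end_near. Qed.

End flat.

(** * Smooth functions and the mollifier *)

Section smooth.
Variables (R : realType) (n : nat).
Implicit Types (f g : 'rV[R]_n -> R).

Lemma Ck_eq k (U : set 'rV[R]_n) f g : f =1 g -> Ck k U g -> Ck k U f.
Proof. by move=> /funext ->. Qed.

Lemma CkW k f : Ck k.+1 setT f -> Ck k setT f.
Proof.
elim: k f => [|k IH] f [df cf].
  by move=> x _; apply: differentiable_continuous; exact: df.
by split=> // j; apply: IH; exact: cf.
Qed.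

Lemma Ck_cst k (c : R) : Ck k (@setT 'rV[R]_n) (fun=> c).
Proof.
elim: k c => [|k IH] c; first by move=> x _; exact: cst_continuous.
split=> [x _|j]; first exact: differentiable_cst.
by apply: (Ck_eq _ (IH 0)) => x; rewrite derive_cst.
Qed.

Lemma Ck_coord k (i : 'I_n) : Ck k setT (fun x : 'rV[R]_n => x ord0 i).
Proof.
case: k => [|k]; first by move=> x _; exact: coord_continuous.
split=> [x _|j]; first exact: differentiable_coord.
have [c hc] : exists c : R, forall x : 'rV[R]_n,
    'D_(Defs.basis j) (fun x : 'rV[R]_n => x ord0 i) x = c.
  exists ((Defs.basis j : 'rV[R]_n) ord0 i) => x.
  apply: cvg_lim => //; apply: cvg_near_cst; near=> h.
  rewrite /= !mxE addrK -[_ *: _]/(_ * _) mulKf//.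
  by near: h; exact: nbhs_dnbhs_neq.
by apply: (Ck_eq _ (Ck_cst k c)) => x; exact: hc.
Unshelve. all: by end_near. Qed.

Lemma CkD k f g : Ck k setT f -> Ck k setT g -> Ck k setT (fun x => f x + g x).
Proof.
elim: k f g => [|k IH] f g; first by move=> cf cg x _; apply: continuousD; [exact: cf|exact: cg].
move=> [df cf] [dg cg]; split=> [x _|j].
  by apply: differentiableD; [exact: df|exact: dg].
apply: (Ck_eq _ (IH _ _ (cf j) (cg j))) => x.
by apply: (@deriveD _ _ _ f g); apply: diff_derivable; [exact: df|exact: dg].
Qed.

Lemma CkM k f g : Ck k setT f -> Ck k setT g -> Ck k setT (fun x => f x * g x).
Proof.
elim: k f g => [|k IH] f g; first by move=> cf cg x _; apply: continuousM; [exact: cf|exact: cg].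
move=> f1 g1; have f0 := CkW f1; have g0 := CkW g1; move: f1 g1.
move=> [df cf] [dg cg]; split=> [x _|j].
  by apply: differentiableM; [exact: df|exact: dg].
apply: (Ck_eq _ (CkD (IH _ _ f0 (cg j)) (IH _ _ g0 (cf j)))) => x.
by apply: (@deriveM _ _ f g); apply: diff_derivable; [exact: df|exact: dg].
Qed.

Lemma CkB k f g : Ck k setT f -> Ck k setT g -> Ck k setT (fun x => f x - g x).
Proof.
move=> cf cg; apply: (Ck_eq _ (CkD cf (CkM (Ck_cst k (-1)) cg))) => x.
by rewrite mulN1r.
Qed.

Lemma Ck_sum k (I : finType) (F : I -> 'rV[R]_n -> R) :
  (forall i, Ck k setT (F i)) -> Ck k setT (fun x => \sum_i F i x).
Proof.
move=> cF; elim: (index_enum I) => [|i s IH].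
  by apply: (Ck_eq _ (Ck_cst k 0)) => x; rewrite big_nil.
by apply: (Ck_eq _ (CkD (cF i) IH)) => x; rewrite big_cons.
Qed.

Lemma Ck_flat k p f : Ck k setT f -> Ck k setT (fun x => flat p (f x)).
Proof.
have dflat q t : differentiable (flat q) t.
  by apply/derivable1_diffP; have [] := is_derive_flat q t.
elim: k p f => [|k IH] p f.
  move=> cf x _; apply: (@continuous_comp _ _ _ f (flat p)); first exact: cf.
  exact: differentiable_continuous.
move=> f1; have f0 := CkW f1; move: f1 => [df cf]; split=> [x _|j].
  by apply: differentiable_comp => //; exact: df.
apply: (Ck_eq _ (CkM (IH (flat_deriv p) _ f0) (cf j))) => x; have dfx := df x I.
have dcomp : differentiable (flat p \o f) x by exact: differentiable_comp.
rewrite (deriveE _ dcomp) diff_comp//= deriveE//.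
set v := 'd f x _; rewrite -[v in LHS]mulr1 -[v * 1]/(v *: 1) linearZ /=.
rewrite -deriveE// -[_ *: _]/(_ * _) mulrC; congr (_ * _).
by have [_ ->] := is_derive_flat p (f x).
Qed.

(** For [r > 0] it is positive exactly on the open Euclidean ball; the squared distance keeps it
    smooth at the centre. The later estimates use only that it vanishes off the larger sup-norm
    ball. *)
Definition mollifier (r : R) (c y : 'rV[R]_n) : R :=
  flat 1 (r ^+ 2 - \sum_i (y ord0 i - c ord0 i) * (y ord0 i - c ord0 i)).

Lemma mollifier_Ck k r c : Ck k setT (mollifier r c).
Proof.
apply: Ck_flat; apply: CkB; first exact: Ck_cst.
apply: Ck_sum => i; have h : Ck k setT (fun y : 'rV[R]_n => y ord0 i - c ord0 i).
  by apply: CkB; [exact: Ck_coord|exact: Ck_cst].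
exact: CkM.
Qed.

Lemma mollifier_translate r c y : mollifier r c y = mollifier r 0 (y - c).
Proof.
rewrite /mollifier; congr flat; congr (_ - _); apply: eq_bigr => i _.
by rewrite !mxE subr0.
Qed.

Lemma mollifier_ge0 r c y : 0 <= mollifier r c y.
Proof.
rewrite /mollifier /flat; case: ifPn => // _.
by rewrite hornerC mul1r expR_ge0.
Qed.

Lemma mollifier_eq0 r c y : 0 < r -> r < `|y - c| -> mollifier r c y = 0.
Proof.
move=> r0 ryc; have [i hi] : exists i, r < `|(y - c) ord0 i|.
  apply: contrapT => h; move: ryc; rewrite ltNge => /negP; apply.
  apply: rV_norm_le; first exact: ltW.
  by move=> i; rewrite leNgt; apply/negP => hi; apply: h; exists i.
apply: flat_le0; rewrite subr_le0 (bigD1 i)//= -expr2.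
rewrite !mxE in hi; apply: (@le_trans _ _ (`|y ord0 i - c ord0 i| ^+ 2)).
  by rewrite ler_pXn2r ?nnegrE ?normr_ge0 ?(ltW r0) // ltW.
by rewrite real_normK ?num_real// lerDl sumr_ge0// => j _; rewrite -expr2 sqr_ge0.
Qed.

Lemma mollifier_test (Om : set 'rV[R]_n) r c : 0 < r -> 
  (forall y, `|y - c| <= r -> Om y) -> test_function Om (mollifier r c).
Proof.
move=> r0 rO; split; first by move=> k; exact: mollifier_Ck.
exists [set y | `|y - c| <= r]; split.
- exact: compact_norm_ball.
- by move=> y; exact: rO.
- by move=> y /= /negP; rewrite -ltNge => /(mollifier_eq0 r0).
Qed.

End smooth.

Section Rintegral_lemmas.
Variables (R : realType) (d : measure_display) (T : measurableType d)
  (mu : {measure set T -> \bar R}) (D : set T).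
Hypothesis mD : measurable D.

Lemma integrableM_bounded (f h : T -> R) (C : R) : mu.-integrable D (EFin \o f) ->
  measurable_fun D h -> (forall x, D x -> `|h x| <= C) ->
  mu.-integrable D (EFin \o (fun x => f x * h x)).
Proof.
move=> fi mh hC; apply: (integrableMl mD fi mh).
exists C; split; first exact: num_real.
by move=> M CM x Dx; apply: (le_trans (hC _ Dx)); exact: ltW.
Qed.

Lemma Rintegral_sum (I : Type) (s : seq I) (F : I -> T -> R) :
  (forall i, mu.-integrable D (EFin \o F i)) ->
  mu.-integrable D (EFin \o (fun x => \sum_(i <- s) F i x)) /\
  \int[mu]_(x in D) (\sum_(i <- s) F i x) = \sum_(i <- s) \int[mu]_(x in D) F i x.
Proof.
move=> iF; elim: s => [|i s [IH1 IH2]].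
  rewrite big_nil; split.
    rewrite (_ : _ \o _ = cst 0%E); first exact: integrable0.
    by apply/funext => x /=; rewrite big_nil.
  rewrite (@eq_Rintegral _ _ _ mu D (cst 0)).
    by rewrite Rintegral_cst// mul0r.
  by move=> x _; rewrite big_nil.
have e : (fun x => \sum_(j <- i :: s) F j x) = (fun x => F i x + \sum_(j <- s) F j x).
  by apply/funext => x; rewrite big_cons.
rewrite e big_cons; split; last by rewrite RintegralD// IH2.
exact: (integrableD mD (iF i) IH1).
Qed.

Lemma ae_le_normr_Rintegral (f h : T -> R) :
  mu.-integrable D (EFin \o f) -> mu.-integrable D (EFin \o h) ->
  {ae mu, forall x, D x -> `|f x| <= h x} ->
  (forall x, D x -> 0 <= h x) ->
  `|\int[mu]_(x in D) f x| <= \int[mu]_(x in D) h x.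
Proof.
move=> fi hi fh h0; apply: (le_trans (le_normr_Rintegral mD fi)).
have nfi : mu.-integrable D (EFin \o (fun x => `|f x|)) := integrable_norm fi.
rewrite /Rintegral fine_le//; try exact: integrable_fin_num.
apply: ae_ge0_le_integral => //.
- by have /integrableP[] := nfi.
- by have /integrableP[] := hi.
Qed.

End Rintegral_lemmas.

(** * Integrability and mass of the mollifier *)

Section mollifier_mass.
Variables (R : realType) (n : nat).
Local Notation mu := (lebesgue_rV R n).
Variable r : R.
Hypothesis r0 : 0 < r.

Lemma mollifier_C1 (c : 'rV[R]_n) : (forall x, differentiable (mollifier r c) x) /\
  forall j, continuous (fun x => 'D_(Defs.basis j) (mollifier r c) x).
Proof. by have [df cf] := mollifier_Ck 1 r c; split=> [x|j x]; [exact: df|exact: cf]. Qed.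

Lemma mollifier_continuous (c : 'rV[R]_n) : continuous (mollifier r c).
Proof. by move=> x; apply: differentiable_continuous; have [] := mollifier_C1 c. Qed.

Lemma mollifier_bounded (c : 'rV[R]_n) : exists C, forall y, `|mollifier r c y| <= C.
Proof.
apply: (@supported_bounded _ _ _ [set x | `|x - c| <= r]).
- exact: compact_norm_ball.
- exact: mollifier_continuous.
- by move=> x /= /negP; rewrite -ltNge => /(mollifier_eq0 r0).
Qed.

Lemma mollifier_integrable (c : 'rV[R]_n) : mu.-integrable setT (EFin \o mollifier r c).
Proof.
have [C hC] := mollifier_bounded c.
apply: (@supported_integrable _ _ _ [set x | `|x - c| <= r] C) => //.
- exact: compact_norm_ball.
- exact: continuous_measurable_rVT (@mollifier_continuous c).
- by move=> x /= /negP; rewrite -ltNge => /(mollifier_eq0 r0).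
Qed.

Definition mollifier_mass : R := \int[mu]_y mollifier r 0 y.

Lemma mollifier_massE (c : 'rV[R]_n) : \int[mu]_y mollifier r c y = mollifier_mass.
Proof.
rewrite /mollifier_mass -(Rintegral_translate (- c) (mollifier_integrable 0)).
by apply: eq_Rintegral => y _; rewrite mollifier_translate.
Qed.

(** Near the origin the mollifier exceeds half of its value there, and a cube of side [e], whose
    measure is known, fits into that neighbourhood. *)
Lemma mollifier_mass_gt0 : 0 < mollifier_mass.
Proof.
have b0 : 0 < mollifier r (0 : 'rV[R]_n) 0.
  rewrite /mollifier big1 => [|i _]; last by rewrite subrr mulr0.
  by rewrite subr0 flat_gt0 ?exprn_gt0// hornerC mul1r expR_gt0.
set b := mollifier r _ _ in b0.
have b2 : 0 < b / 2 by rewrite divr_gt0.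
have : nbhs (0 : 'rV[R]_n) [set y | b / 2 <= mollifier r 0 y].
  have /cvgrPdist_lt/(_ _ b2) : {for (0 : 'rV[R]_n), continuous (mollifier r 0)}.
    exact: mollifier_continuous.
  apply: filterS => y; rewrite /= -/b ltr_norml => /andP[_ h].
  by move: (mollifier r 0 y) h => t; lra.
move=> /nbhs_rVP[e e0 he].
pose N : 'rV[R]_n := const_mx (e / 2).
pose box := [set x : 'rV[R]_n | forall i, (- N) ord0 i <= x ord0 i <= N ord0 i].
have mubox : mu box = (\prod_(i < n) e)%:E.
  rewrite lebesgue_rV_box => [|i]; last by rewrite !mxE; lra.
  by congr EFin; apply: eq_bigr => i _; rewrite !mxE; lra.
have mbox : measurable box.
  rewrite (_ : box = \bigcap_(i in [set: 'I_n])
      ((fun x : 'rV[R]_n => x ord0 i) @^-1` `[- (e / 2), e / 2])).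
    apply: fin_bigcap_measurable => // i _.
    by rewrite -[X in measurable X]setTI; exact: measurable_coord.
  apply/seteqP; split => [x /= H i _|x /= H i]; rewrite /= ?in_itv//=.
    by have := H i; rewrite !mxE.
  by have := H i I; rewrite /= in_itv !mxE.
have boxe y : box y -> b / 2 <= mollifier r 0 y.
  move=> yb; apply: he; rewrite subr0; apply: (@le_lt_trans _ _ (e / 2)); last lra.
  apply: rV_norm_le => [|i]; first lra.
  by have := yb i; rewrite !mxE ler_norml.
have ib : mu.-integrable setT (EFin \o ((cst (b / 2) : 'rV[R]_n -> R) \_ box)).
  have ib : mu.-integrable box (EFin \o (cst (b / 2) : 'rV[R]_n -> R)).
    apply: (bounded_integrable_rV (M := e) (C := b / 2) mbox) => //.
    - move=> y yb; apply: rV_norm_le => [|i]; first lra.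
      by have := yb i; rewrite !mxE ler_norml; lra.
    - by move=> y _ /=; rewrite gtr0_norm.
  by move: ib => /(integrable_mkcond _ mbox); rewrite restrict_EFin.
have : \int[mu]_(x in box) (b / 2) <= mollifier_mass.
  rewrite Rintegral_mkcond; apply: le_Rintegral => //; first exact: mollifier_integrable.
  move=> y _; rewrite patchE; case: ifPn => [|_]; last exact: mollifier_ge0.
  by rewrite inE => /boxe.
rewrite (_ : \int[mu]_(x in box) (b / 2) = b / 2 * fine (mu box)); last exact: Rintegral_cst.
by rewrite mubox /=; apply: lt_le_trans; rewrite mulr_gt0 ?divr_gt0// prodr_gt0.
Qed.

End mollifier_mass.

Lemma derive_translate (R : realType) (V : normedModType R) (f : V -> R) (c v x : V) :
  'D_v (fun y => f (y - c)) x = 'D_v f (x - c).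
Proof.
rewrite /derive.
have -> : (fun y => f (y - c)) \o shift x = f \o shift (x - c).
  by apply/funext => y /=; rewrite addrA.
by [].
Qed.

(** * Increments of mollified weakly differentiable functions *)

Section mollified.
Variables (R : realType) (n : nat) (Om : set 'rV[R]_n) (z : 'rV[R]_n -> R)
  (g : 'I_n -> 'rV[R]_n -> R) (B0 : set 'rV[R]_n) (r : R) (p v : 'rV[R]_n).
Local Notation mu := (lebesgue_rV R n).
Hypotheses (lz : locally_integrable_rV Om z) (wp : forall j, weak_partial Om j z (g j)) (r0 : 0 < r)
  (cB0 : compact B0) (B0O : B0 `<=` Om)
  (pv : forall (t : R) (y : 'rV[R]_n), -1 < t < 2 -> `|y - (p + t *: v)| <= r -> B0 y).

(** An unnormalised convolution. The compact [B0] is the same for all centres, makes [z] integrable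
    and contains the supports of the mollifiers centred on the line for times in (-1, 2), an open
    range around [0, 1] that leaves room to differentiate at its ends. *)
Definition mollified (c : 'rV[R]_n) : R := \int[mu]_(y in B0) (z y * mollifier r c y).

Let mB0 := compact_measurable_rV cB0.

Let out (t : R) (y : 'rV[R]_n) : -1 < t < 2 -> ~ B0 y ->
  \forall y' \near y, mollifier r (p + t *: v) y' = 0.
Proof.
move=> t12 nB; have nK : ~ `|y - (p + t *: v)| <= r by move=> /(pv t12).
have := compactC_near (@compact_norm_ball R n (p + t *: v) r) nK.
by apply: filterS => y' /= /negP; rewrite -ltNge => /(mollifier_eq0 r0).
Qed.

Let test (t : R) : -1 < t < 2 -> test_function Om (mollifier r (p + t *: v)).
Proof. by move=> t12; apply: mollifier_test => // y /(pv t12)/B0O. Qed.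

Let D_bounded : exists2 C : R, 0 <= C & forall c y,
  `|\sum_j v ord0 j * 'D_(Defs.basis j) (mollifier r c) y| <= C.
Proof.
have /choice[C hC] : forall j, exists C, forall y : 'rV[R]_n,
    `|'D_(Defs.basis j) (mollifier r 0) y| <= C.
  move=> j; apply: (@supported_bounded _ _ _ [set x | `|x - 0| <= r]).
  - exact: compact_norm_ball.
  - exact: (mollifier_C1 r 0).2.
  - move=> y nK; apply: derive_zero_near.
    have := compactC_near (@compact_norm_ball R n 0 r) nK.
    by apply: filterS => y' /= /negP; rewrite -ltNge => /(mollifier_eq0 r0).
exists (\sum_j `|v ord0 j| * `|C j|) => [|c y]; first exact: sumr_ge0.
apply: (le_trans (ler_norm_sum _ _ _)); apply: ler_sum => j _.
rewrite normrM ler_wpM2l//.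
rewrite (_ : mollifier r c = fun y => mollifier r 0 (y - c)); last first.
  by apply/funext => y'; exact: mollifier_translate.
by rewrite derive_translate (le_trans (hC _ _))// ler_norm.
Qed.

Let zi : mu.-integrable B0 (EFin \o z).
Proof.
by case: lz => _; apply.
Qed.

Let F (t : R) (y : 'rV[R]_n) := z y * mollifier r (p + t *: v) y.

Let dF (t : R) y : is_derive t (1 : R) (F^~ y)
  (z y * - \sum_j v ord0 j * 'D_(Defs.basis j) (mollifier r (p + t *: v)) y).
Proof.
have dm := (mollifier_C1 r (0 : 'rV[R]_n)).1.
have := is_derive_line (dm (y - p + t *: (- v))).
rewrite diff_basis// => h.
have := is_deriveM (is_derive_cst (z y) t 1) h.
rewrite scaler0 addr0.
have -> : (cst (z y) * (fun s : R => mollifier r 0 (y - p + s *: - v))) = F^~ y.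
  apply/funext => s; rewrite -[LHS]/(z y * mollifier r 0 (y - p + s *: - v)).
  by rewrite /F [in RHS]mollifier_translate scalerN -addrA -opprD.
congr (is_derive _ _ _ _); congr (_ * _); rewrite -sumrN; apply: eq_bigr => j _.
have -> : 'D_(Defs.basis j) (mollifier r (p + t *: v)) y =
    'D_(Defs.basis j) (mollifier r 0) (y - p + t *: - v).
  rewrite (_ : mollifier r (p + t *: v) = fun y => mollifier r 0 (y - (p + t *: v))).
    by rewrite derive_translate scalerN -addrA -opprD.
  by apply/funext => y'; exact: mollifier_translate.
by rewrite mxE mulNr.
Qed.

Let meas_moll c D : measurable_fun D (mollifier r (c : 'rV[R]_n)).
Proof.
by apply: measurable_funTS; exact: continuous_measurable_rVT (@mollifier_continuous _ _ _ _).
Qed.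

Let iF t : mu.-integrable B0 (EFin \o F t).
Proof.
have [C hC] := mollifier_bounded r0 (p + t *: v).
exact: (integrableM_bounded mB0 zi (@meas_moll _ _) (fun x _ => hC x)).
Qed.

Let ig t j : mu.-integrable B0 (EFin \o (fun y => g j y * mollifier r (p + t *: v) y)).
Proof.
have [C hC] := mollifier_bounded r0 (p + t *: v).
have gi : mu.-integrable B0 (EFin \o g j) by have [_ [_ lg] _] := wp j; exact: lg.
exact: (integrableM_bounded mB0 gi (@meas_moll _ _) (fun x _ => hC x)).
Qed.

(** Differentiation under the integral, dominated by a multiple of [|z|]. Differentiating the
    mollifier in its centre rather than its variable costs a sign, which the weak derivative gives
    back. *)
Lemma mollified_derive (t : R) : -1 < t < 2 ->
  is_derive t 1 (fun t => mollified (p + t *: v))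
    (\sum_j v ord0 j * \int[mu]_(y in B0) (g j y * mollifier r (p + t *: v) y)).
Proof.
move=> t12.
have tI : `](-1), 2[%classic t by rewrite /= in_itv.
have [C C0 hC] := D_bounded.
have dF1 x y : `](-1), 2[%classic x -> B0 y -> derivable (F^~ y) x 1.
  by move=> _ _; have [] := dF x y.
have iG : mu.-integrable B0 (EFin \o (fun y => `|z y| * C)).
  have nzi : mu.-integrable B0 (EFin \o (fun y => `|z y|)) := integrable_norm zi.
  exact: (integrableM_bounded (C := `|C|) mB0 nzi (measurable_cst _)).
have Gub x y : `](-1), 2[%classic x -> B0 y -> `|partial1of2 F x y| <= `|z y| * C.
  move=> _ _; rewrite partial1of2E; have [_ ->] := dF x y.
  by rewrite normrM normrN ler_wpM2l.
have G0 y : 0 <= `|z y| * C by rewrite mulr_ge0.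
have h1 := derivable_under_integral mB0 tI (fun x _ => iF x) dF1 G0 iG Gub.
have h2 := differentiation_under_integral mB0 tI (fun x _ => iF x) dF1 G0 iG Gub.
apply: DeriveDef; first exact: h1.
rewrite -derive1E h2.
pose H j y := - v ord0 j * (z y * 'D_(Defs.basis j) (mollifier r (p + t *: v)) y).
have iD j : mu.-integrable B0
    (EFin \o (fun y => z y * 'D_(Defs.basis j) (mollifier r (p + t *: v)) y)).
  have cD := (mollifier_C1 r (p + t *: v)).2 j.
  have [D hD] := supported_bounded cB0 cD (fun y nB => derive_zero_near _ (out t12 nB)).
  apply: (integrableM_bounded mB0 zi _ (fun x _ => hD x)).
  by apply: measurable_funTS; exact: continuous_measurable_rVT cD.
have iH j : mu.-integrable B0 (EFin \o H j).
  exact: (integrableZl mB0 (- v ord0 j) (iD j)).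
rewrite (@eq_Rintegral _ _ _ _ _ (fun y => \sum_j H j y)); last first.
  move=> y _; rewrite partial1of2E; have [_ ->] := dF t y.
  by rewrite -sumrN mulr_sumr; apply: eq_bigr => j _; rewrite /H; ring.
have [_ ->] := Rintegral_sum mB0 (index_enum _) iH.
apply: eq_bigr => j _; rewrite /H RintegralZl//.
have [_ _ /(_ _ (test t12)) wpj] := wp j.
(* Weak derivatives are tested over [Om], whereas [mollified] integrates over [B0]. *)
have suppO (f : 'rV[R]_n -> R) (h : 'rV[R]_n -> R) : (forall y, ~ B0 y -> h y = 0) ->
    \int[mu]_(y in B0) (f y * h y) = \int[mu]_(y in Om) (f y * h y).
  move=> h0; rewrite supported_Rintegral => [|y nB]; last by rewrite h0// mulr0.
  by rewrite [RHS]supported_Rintegral// => y nO; rewrite h0 ?mulr0// => /B0O.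
rewrite (suppO z ('D_(Defs.basis j) (mollifier r (p + t *: v)))) => [|y nB]; last first.
  exact: (derive_zero_near _ (out t12 nB)).
rewrite wpj mulrNN; congr (_ * _); rewrite suppO// => y nB.
exact: nbhs_singleton (out t12 nB).
Qed.

(** The mean value theorem reduces the increment to a derivative at one time [t], an average of the
    directional weak derivative over points within [r] of [p + t *: v]. The mass stands in for
    normalisation. *)
Lemma mollified_increment (A eps : R) : 0 <= eps ->
  {ae mu, forall y, (exists2 t, 0 <= t <= 1 & `|y - (p + t *: v)| <= r) ->
    `|\sum_j v ord0 j * g j y - A| <= eps} ->
  `|mollified (p + v) - mollified p - A * mollifier_mass n r| <= eps * mollifier_mass n r.
Proof.
move=> eps0 hA.
pose dM t := \sum_j v ord0 j * \int[mu]_(y in B0) (g j y * mollifier r (p + t *: v) y).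
have [||t t01] := @MVT R (fun t => mollified (p + t *: v)) dM 0 1 ltr01.
- by move=> t; rewrite in_itv /= => t01; apply: mollified_derive; lra.
- apply: derivable_within_continuous => t; rewrite in_itv /= => t01.
  by have [] := @mollified_derive t; first lra.
rewrite scale1r scale0r addr0 subr0 mulr1 => ->.
rewrite in_itv /= in t01.
have t12 : -1 < t < 2 by lra.
set c := p + t *: v.
have moll0 y : ~ B0 y -> mollifier r c y = 0 by move=> nB; exact: nbhs_singleton (out t12 nB).
have massE : \int[mu]_(y in B0) mollifier r c y = mollifier_mass n r.
  by rewrite (supported_Rintegral moll0); exact: mollifier_massE.
have imoll : mu.-integrable B0 (EFin \o mollifier r c).
  exact: (integrableS measurableT mB0 (@subsetT _ _) (mollifier_integrable r0 c)).
have iA (a : R) : mu.-integrable B0 (EFin \o (fun y => a * mollifier r c y)).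
  exact: (integrableZl mB0 a imoll).
have ivg j : mu.-integrable B0 (EFin \o (fun y => v ord0 j * (g j y * mollifier r c y))).
  exact: (integrableZl mB0 _ (ig t j)).
have [is1 s1] := Rintegral_sum mB0 (index_enum _) ivg.
have eA : \int[mu]_(y in B0) (A * mollifier r c y) = A * mollifier_mass n r.
  by rewrite (RintegralZl A mB0 imoll) massE.
have eeps : \int[mu]_(y in B0) (eps * mollifier r c y) = eps * mollifier_mass n r.
  by rewrite (RintegralZl eps mB0 imoll) massE.
have eM : \int[mu]_(y in B0) (\sum_j v ord0 j * (g j y * mollifier r c y)) = dM t.
  by rewrite s1; apply: eq_bigr => j _; rewrite (RintegralZl (v ord0 j) mB0 (ig t j)).
rewrite -eM -eA -eeps -(RintegralB mB0 is1 (iA A)).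
apply: (ae_le_normr_Rintegral mB0 _ (iA eps)).
- exact: (integrableB mB0 is1 (iA A)).
- apply: filterS hA => y hA By.
  move: (mollifier_ge0 r c y) (@mollifier_eq0 R n r c y r0).
  move: (mollifier r c y) => M M0 Mr.
  rewrite (_ : _ - _ = (\sum_j v ord0 j * g j y - A) * M); last first.
    rewrite mulrBl mulr_suml; congr (_ - _); apply: eq_bigr => j _; ring.
  rewrite normrM (ger0_norm M0).
  have [yr|ry] := leP `|y - c| r.
    by apply: (ler_wpM2r M0); apply: hA; exists t; [lra|exact: yr].
  by rewrite (Mr ry) !mulr0 lexx.
- by move=> y _; exact: (mulr_ge0 eps0 (mollifier_ge0 r c y)).
Qed.

End mollified.

Section dot_product.
Variables (R : realType) (n : nat).
Implicit Types u v x y : 'rV[R]_n.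

Lemma dotpDl x y v : dotp (x + y) v = dotp x v + dotp y v.
Proof. by rewrite /dotp -big_split; apply: eq_bigr => i _; rewrite mxE mulrDl. Qed.

Lemma dotpZl (t : R) x v : dotp (t *: x) v = t * dotp x v.
Proof. by rewrite /dotp mulr_sumr; apply: eq_bigr => i _; rewrite mxE mulrA. Qed.

Lemma dotpNl x v : dotp (- x) v = - dotp x v.
Proof. by rewrite -scaleN1r dotpZl mulN1r. Qed.

Lemma dotpNr x v : dotp x (- v) = - dotp x v.
Proof. by rewrite /dotp -sumrN; apply: eq_bigr => i _; rewrite mxE mulrN. Qed.

Lemma dotp_unit v : enorm v = 1 -> dotp v v = 1.
Proof.
move=> v1; rewrite -[LHS]sqr_sqrtr -/(enorm v) ?v1 ?expr1n//.
by apply: sumr_ge0 => i _; rewrite -expr2 sqr_ge0.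
Qed.

Lemma coord_unit_le1 v i : enorm v = 1 -> `|v ord0 i| <= 1.
Proof.
move=> /dotp_unit v1; rewrite -(@ler_pXn2r _ 2)// ?nnegrE// expr1n.
rewrite real_normK ?num_real// -v1 /dotp (bigD1 i)//= -expr2 lerDl sumr_ge0//.
by move=> j _; rewrite -expr2 sqr_ge0.
Qed.

Lemma norm_unit_le1 v : enorm v = 1 -> `|v| <= 1.
Proof. by move=> v1; apply: rV_norm_le => // i; exact: coord_unit_le1. Qed.

Lemma dotp_unit_le e v : enorm v = 1 -> `|dotp e v| <= n%:R * `|e|.
Proof.
move=> v1; apply: (le_trans (ler_norm_sum _ _ _)).
rewrite -[X in X%:R * _](card_ord n) mulr_natl -sumr_const; apply: ler_sum => i _.
rewrite normrM -[leRHS]mulr1; apply: ler_pM => //; [exact: coord_norm_le|exact: coord_unit_le1].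
Qed.

End dot_product.

(** * From the glued gradient to the rank-one jump *)

Section jump.
Variables (R : realType) (m : nat) (Om Omp Omm Gam : set 'rV[R]_m.+1)
  (yp ym nu : 'rV[R]_m.+1 -> 'rV[R]_m.+1).
Hypotheses (oOm : open Om)
  (OmE : Om = Omp `|` Gam `|` Omm) (oOmp : open Omp)
  (oOmm : open Omm) (dis : Omp `&` Omm = set0) (Gp : Gam = Om `&` boundary Omp)
  (Gm : Gam = Om `&` boundary Omm) (sG : Ck_surface 1 Gam)
  (Cp : C1_closure_vec Omp yp) (Cm : C1_closure_vec Omm ym)
  (nuP : outward_unit_normal Gam Omp nu).

Let cone (x0 v : 'rV[R]_m.+1) (rho k : R) :=
  [set x | `|x - x0| < rho /\ dotp (x - x0) v < - (k * `|x - x0|)].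

(** The truncated cone is convex and misses [Gam]; along a segment in it, membership in [Omp] is
    locally constant. *)
Lemma cone_one_side x0 v rho k : 0 <= k -> (forall x, `|x - x0| < rho -> Om x) ->
  (forall x, `|x - x0| < rho -> Gam x -> `|dotp (x - x0) v| <= k * `|x - x0|) ->
  forall p q, cone x0 v rho k p -> cone x0 v rho k q -> Omp p -> Omp q.
Proof.
move=> k0 rO rG p q [pr pk] [qr qk].
pose s (t : R) := p + t *: (q - p).
have convex t : 0 <= t <= 1 -> cone x0 v rho k (s t).
  move=> t01; split; first exact: segment_ball.
  have -> : s t - x0 = (1 - t) *: (p - x0) + t *: (q - x0).
    rewrite /s addrAC scalerBl scale1r -[RHS]addrA -[- (t *: _)]scalerN -scalerDr opprB.
    by rewrite [x0 - p + _]addrC addrA subrK.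
  have h : `|(1 - t) *: (p - x0) + t *: (q - x0)| <= (1 - t) * `|p - x0| + t * `|q - x0|.
    apply: (le_trans (ler_normD _ _)); rewrite !normrZ !ger0_norm//; lra.
  rewrite dotpDl !dotpZl; apply: (@lt_le_trans _ _ (- (k * ((1 - t) * `|p - x0| + t * `|q - x0|)))).
    move: pk qk; set P := `|p - x0|; set Q := `|q - x0|; set dp := dotp _ _; set dq := dotp _ _.
    (* One of the two weights is at least 1/2, which preserves strictness. *)
    move=> pk qk; have [t0|t0] := leP t (1 / 2); nra.
  by rewrite lerN2 ler_wpM2l.
have side x : cone x0 v rho k x -> Omp x \/ Omm x.
  move=> [xr xk]; have [px|Gx|mx] := OmP OmE (rO _ xr); [by left| |by right].
  have := rG _ xr Gx; rewrite ler_norml => /andP[h _]; exfalso; lra.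
have := @locally_constant_connected R Prop `[0, 1]%classic (fun t => Omp (s t))
  (@connected_segment R 0 1).
have s0 : s 0 = p by rewrite /s scale0r addr0.
have s1 : s 1 = q by rewrite /s scale1r subrKC.
move=> /(_ _ 0 1); rewrite s0 s1 => -> //; last 2 first.
- by rewrite /= in_itv /= lexx ler01.
- by rewrite /= in_itv /= lexx ler01.
move=> t; rewrite /= in_itv /= => /convex /side [px|mx].
  have : \forall y \near s t, Omp y by exact: open_nbhs_nbhs.
  move=> /near_segment; apply: filterS => t' pt' _; exact/propext.
have : \forall y \near s t, Omm y by exact: open_nbhs_nbhs.
move=> /near_segment; apply: filterS => t' pt' _; apply/propext; split => h; exfalso.
  exact: (Omp_not_Omm dis h).
exact: (Omp_not_Omm dis h).
Qed.

(** By [surface_flat] both cones miss [Gam] near [x0], and [k < 1] puts the points [x0 - t *: nu x0]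
    and [x0 + t *: nu x0] inside them. The first lies in [Omp], hence so does its cone; the second
    does not, so no point of its cone does, and that cone lies in [Omm]. *)
Lemma half_cones x0 (k : R) : Gam x0 -> 0 < k < 1 -> exists2 rho : R, 0 < rho &
  forall x, `|x - x0| < rho -> [/\ Om x,
    dotp (x - x0) (nu x0) < - (k * `|x - x0|) -> Omp x &
    k * `|x - x0| < dotp (x - x0) (nu x0) -> Omm x].
Proof.
move=> G0 /andP[k0 k1].
have [_ /(_ _ G0) [nu1 tnu side]] := nuP.
have O0 : Om x0 by move: G0; rewrite Gp => -[].
have := surface_flat sG G0 tnu k0.
have nO : nbhs x0 Om by exact: open_nbhs_nbhs.
move=> /(filterI nO) /nbhs_rVP[rho rho0 hr].
exists rho => //.
have rO x : `|x - x0| < rho -> Om x by move=> /hr[].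
have rG x : `|x - x0| < rho -> Gam x -> `|dotp (x - x0) (nu x0)| <= k * `|x - x0|.
  by move=> /hr[_]; apply.
have rG' x : `|x - x0| < rho -> Gam x -> `|dotp (x - x0) (- nu x0)| <= k * `|x - x0|.
  by move=> xr Gx; rewrite dotpNr normrN; exact: rG.
have [t [t0 tr [pt npt]]] : exists t : R, [/\ 0 < t, t < rho &
    Omp (x0 - t *: nu x0) /\ ~ Omp (x0 + t *: nu x0)].
  have /filter_ex : \forall t \near (0 : R)^'+, 0 < t /\ t < rho /\
      (Omp (x0 - t *: nu x0) /\ ~ Omp (x0 + t *: nu x0)).
    near=> t; split; first by near: t; exact: nbhs_right_gt.
    split; first by near: t; exact: nbhs_right_lt.
    by near: t.
  by move=> [t [t0 [tr h]]]; exists t.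
have nv := norm_unit_le1 nu1.
have tn : `|t *: nu x0| <= t.
  by rewrite normrZ gtr0_norm// ler_piMr// ltW.
have ktn : k * `|t *: nu x0| < t.
  apply: (@le_lt_trans _ _ (k * t)); first by rewrite ler_wpM2l// ltW.
  by rewrite gtr_pMl.
have d1 : dotp (nu x0) (nu x0) = 1 by exact: dotp_unit.
have cm : cone x0 (nu x0) rho k (x0 - t *: nu x0).
  rewrite /cone /= addrAC subrr add0r normrN; split; first exact: le_lt_trans tn tr.
  by rewrite dotpNl dotpZl d1 mulr1 ltrN2.
have cp : cone x0 (- nu x0) rho k (x0 + t *: nu x0).
  rewrite /cone /= addrAC subrr add0r; split; first exact: le_lt_trans tn tr.
  by rewrite dotpNr dotpZl d1 mulr1 ltrN2.
move=> x xr; split; first exact: rO.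
  by move=> xk; apply: (cone_one_side (ltW k0) rO rG cm).
move=> xk; have cx : cone x0 (- nu x0) rho k x by split=> //; rewrite dotpNr ltrN2.
have [px|Gx|//] := OmP OmE (rO _ xr).
  by exfalso; apply: npt; exact: (cone_one_side (ltW k0) rO rG' cx cp px).
by have := rG _ xr Gx; rewrite ler_norml => /andP[_ h]; exfalso; lra.
Unshelve. all: by end_near. Qed.

Lemma derive_osc (O : set 'rV[R]_m.+1) f (tau xi : 'rV[R]_m.+1) (w : R) : open O ->
  C1_closure O f -> closure O xi -> 0 < w ->
  exists2 rho : R, 0 < rho & forall y, `|y - xi| < rho -> O y ->
    `|\sum_j tau ord0 j * 'D_(Defs.basis j) f y -
      \sum_j tau ord0 j * 'D_(Defs.basis j) (ext O f) xi| <= w.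
Proof.
move=> oO cf Oxi w0; have [U [oU OU [_ cD] _]] := extP cf.
pose S y := \sum_j tau ord0 j * 'D_(Defs.basis j) (ext O f) y.
have cS : {for xi, continuous S}.
  rewrite (_ : S = \sum_j (fun y => tau ord0 j * 'D_(Defs.basis j) (ext O f) y)); last first.
    by apply/funext => y; rewrite fct_sumE.
  elim/big_ind: _ => [|a b ca cb|j _]; first exact: cst_continuous.
    exact: continuousD ca cb.
  by have := continuousM (@cst_continuous _ R^o (tau ord0 j) xi) (cD j xi (OU _ Oxi)); exact.
have /cvgrPdist_lt/(_ _ w0) := cS.
move=> /nbhs_rVP[rho rho0 hr]; exists rho => // y yr Oy.
have -> : \sum_j tau ord0 j * 'D_(Defs.basis j) f y = S y.
  by apply: eq_bigr => j _; rewrite (derive_ext _ oO cf Oy).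
by rewrite distrC; exact: ltW (hr _ yr).
Qed.

Lemma Linfty_ae_bound (f : 'rV[R]_m.+1 -> R) : Linfty Om f ->
  exists2 C : R, 0 <= C & {ae lebesgue_rV R m.+1, forall x, Om x -> `|f x| <= C}.
Proof.
(* [Lnorm] at +oo is an essential supremum only if the space has positive measure; otherwise
   everything holds almost everywhere. *)
move=> [mf]; rewrite unlock /=; case: ifPn => [mu0|mu0 _]; last first.
  exists 0 => //; exists setT; split=> //.
  by apply/eqP; rewrite eq_le measure_ge0 andbT leNgt.
set M := ess_sup _ _ => Moo.
have aeM : {ae lebesgue_rV R m.+1, forall x,
    ((abse \o (EFin \o (f \_ Om))) x <= M)%E} by exact: ess_sup_ge.
exists `|fine M| => //; apply: filterS aeM => x /= + Ox.
rewrite patchE mem_set//; case: (M) Moo => [r _||//].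
  by rewrite lee_fin => /le_trans; apply; exact: ler_norm.
by rewrite ltxx.
Qed.

Let unit_range (t : R) : 0 <= t <= 1 -> -1 < t < 2.
Proof. by lra. Qed.

(** Along the sides of the parallelogram the coefficients of [v] and [u] are [t] and [-1 + 2 * t],
    or are fixed; the range is the one over which [mollified_increment] needs room. *)
Let four_point_range (t : R) : -1 < t < 2 ->
  [/\ `|t| <= 2, `|-1 + 2 * t| <= 3, `|- 1 : R| <= 3 & `|1 : R| <= 3].
Proof. by move=> t12; split; rewrite ler_norml; lra. Qed.

(** [a], [b] are the values on the side in [Omp] and [c], [d] those on the side in [Omm]. The two
    parallel sides cost [s w] each and the two crossings [2 w s K] each; the sum is divided by
    [s M]. *)
Let four_points (a b c d p q s w K M : R) : 0 < s -> 0 < M ->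
  `|b - a - (s * p) * M| <= (s * w) * M -> `|d - c - (s * q) * M| <= (s * w) * M ->
  `|c - a - 0 * M| <= (2 * (w * s) * K) * M ->
  `|d - b - 0 * M| <= (2 * (w * s) * K) * M -> `|p - q| <= w * (2 + 4 * K).
Proof.
move=> s0 M0; rewrite !ler_norml => /andP[e1 e1'] /andP[e2 e2'] /andP[e3 e3'] /andP[e4 e4'].
have sM : 0 < s * M by rewrite mulr_gt0.
by apply/andP; split; rewrite -(ler_pM2l sM); lra.
Qed.

(* The increments of the mollified function are compared along the sides of the
   parallelogram x0 +- w s nu, x0 +- w s nu + s tau. *)
Lemma jump_tangential i x0 tau : glued_gradient Om Omp Omm yp ym -> Gam x0 ->
  dotp tau (nu x0) = 0 ->
  \sum_j tau ord0 j * 'D_(Defs.basis j) (ext Omp (cpt yp i)) x0 =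
  \sum_j tau ord0 j * 'D_(Defs.basis j) (ext Omm (cpt ym i)) x0.
Proof.
(* [G'] is the bounded gradient and controls the sides crossing [Gam]; [G] equals Dy+ and Dy- almost
   everywhere and controls the sides parallel to [tau]. *)
move=> [z [_ [G' wG' LG']] [G wG aeG]] G0 tnu.
set Dp := LHS; set Dm := RHS.
have [cp cm] := Gam_closure Gp Gm G0.
have [_ /(_ _ G0) [nu1 _ _]] := nuP.
pose mu := lebesgue_rV R m.+1.
have [C C0 hC] : exists2 C : R, 0 <= C & {ae mu, forall x, Om x -> forall j, `|G' x i j| <= C}.
  have /choice[C hC] : forall j, exists C, 0 <= C /\
      {ae mu, forall x, Om x -> `|G' x i j| <= C}.
    by move=> j; have [C C0 hC] := Linfty_ae_bound (LG' i j); exists C.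
  exists (\sum_j C j); first by apply: sumr_ge0 => j _; case: (hC j).
  have : {ae mu, forall x, forall j, Om x -> `|G' x i j| <= C j}.
    by apply: filter_forall => j; case: (hC j).
  apply: filterS => x h Ox j; apply: (le_trans (h j Ox)).
  by rewrite (bigD1 j)//= lerDl sumr_ge0// => k _; case: (hC k).
have [N NE] : exists N : R, N = m.+1%:R by exists m.+1%:R.
suff key w : 0 < w < 1 -> `|Dp - Dm| <= w * (2 + 4 * (N * C)).
  apply/eqP; rewrite -subr_eq0 -normr_le0 leNgt; apply/negP => d0.
  have NC : 0 <= N * C by rewrite NE mulr_ge0.
  set a := `|_| in key d0.
  have b0 : 0 < 2 + 4 * (N * C) by lra.
  pose w := Order.min (1 / 2) (a / (2 * (2 + 4 * (N * C)))).
  have w0 : 0 < w by rewrite lt_min divr_gt0//= divr_gt0// mulr_gt0.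
  have w1 : w <= 1 / 2 by rewrite ge_min lexx.
  have wa : w <= a / (2 * (2 + 4 * (N * C))) by rewrite ge_min lexx orbT.
  have w01 : 0 < w < 1 by rewrite w0 (le_lt_trans w1)//; lra.
  have h : w * (2 + 4 * (N * C)) <= a / 2.
    apply: (le_trans (ler_wpM2r (ltW b0) wa)).
    by rewrite le_eqVlt; apply/orP; left; apply/eqP; field; exact: lt0r_neq0.
  by have := le_trans (key w w01) h; lra.
move=> /andP[w0 w1].
have [T T0 TE] : exists2 T : R, 0 <= T & T = `|tau| by exists `|tau|.
(* Points near the parallel sides are within [2 s (1 + T)] of [x0], so [k] times their distance is
   at most [w s / 2], while their height over the tangent plane is at least [3 w s / 4]: they lie in
   the cones. *)
have [k k0 kT] : exists2 k : R, 0 < k & k * (4 * (1 + T)) = w.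
  exists (w / (4 * (1 + T))); first by rewrite divr_gt0// mulr_gt0// ltr_wpDr.
  by rewrite divfK// lt0r_neq0// mulr_gt0// ltr_wpDr.
have k01 : 0 < k < 1 by rewrite k0 /=; nra.
have [r1 r10 h1] := half_cones G0 k01.
have [r2 r20 h2] := derive_osc tau oOmp (Cp i) cp w0.
have [r3 r30 h3] := derive_osc tau oOmm (Cm i) cm w0.
have [rho [rho0 rho1 rho2 rho3]] : exists rho : R,
    [/\ 0 < rho, rho <= r1, rho <= r2 & rho <= r3].
  exists (Order.min r1 (Order.min r2 r3)).
  by rewrite !lt_min !ge_min !lexx ?orbT r10 r20 r30.
(* With coefficients up to 3 for [u] and 2 for [v], and mollification included, all points stay
   within [rho / 2] of [x0]. *)
have [s s0 sT] : exists2 s : R, 0 < s & s * (4 + 2 * T) = rho / 2.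
  exists (rho / 2 / (4 + 2 * T)); first by rewrite !divr_gt0//; lra.
  by rewrite divfK// lt0r_neq0//; lra.
have N1 : 1 <= N by rewrite NE ler1n.
have N0 : 0 <= N by exact: le_trans ler01 N1.
(* By [dotp_unit_le] a displacement of sup norm [r] changes the height by at most [N * r], a quarter
   of [w * s]. *)
have [r r0 rN] : exists2 r : R, 0 < r & N * r = w * s / 4.
  exists (w * s / 4 / N); first by rewrite !divr_gt0// ?mulr_gt0//; lra.
  by rewrite mulrC divfK// lt0r_neq0//; lra.
have ws0 : 0 < w * s by rewrite mulr_gt0.
have wss : w * s <= s by rewrite ger_pMl// ltW.
have rw : r <= w * s / 4 by nra.
pose u : 'rV[R]_m.+1 := (w * s) *: nu x0; pose v : 'rV[R]_m.+1 := s *: tau.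
have un : `|u| <= w * s.
  by rewrite normrZ gtr0_norm// ler_piMr ?norm_unit_le1// ltW.
have vn : `|v| = s * T by rewrite normrZ gtr0_norm// TE.
pose pt (al be : R) : 'rV[R]_m.+1 := x0 + (al *: u + be *: v).
have ptn al be y : `|y - pt al be| <= r ->
    `|y - x0| <= `|al| * (w * s) + `|be| * (s * T) + w * s / 4.
  move=> yr; rewrite (_ : y - x0 = (al *: u + be *: v) + (y - pt al be)); last first.
    by apply/rowP => j; rewrite !mxE; ring.
  apply: (le_trans (ler_normD _ _)); apply: lerD; last exact: le_trans yr rw.
  apply: (le_trans (ler_normD _ _)); rewrite (normrZ al) (normrZ be) vn lerD2r.
  by rewrite ler_wpM2l.
have ptd al be y : `|y - pt al be| <= r ->
    `|dotp (y - x0) (nu x0) - al * (w * s)| <= w * s / 4.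
  move=> yr; rewrite (_ : y - x0 = (al *: u + be *: v) + (y - pt al be)); last first.
    by apply/rowP => j; rewrite !mxE; ring.
  rewrite !dotpDl !dotpZl tnu (dotp_unit nu1) -rN.
  rewrite (_ : _ - _ = dotp (y - pt al be) (nu x0)); last by rewrite -dotpDl; ring.
  by apply: (le_trans (dotp_unit_le _ nu1)); rewrite NE ler_wpM2l.
pose B0 := [set y : 'rV[R]_m.+1 | `|y - x0| <= rho / 2].
have cB0 : compact B0 by exact: compact_norm_ball.
have rhoB y : B0 y -> `|y - x0| < rho by rewrite /B0 /= => h; lra.
have B0O : B0 `<=` Om.
  by move=> y /rhoB yr; case: (h1 y (lt_le_trans yr rho1)).
have ptB al be y : `|al| <= 3 -> `|be| <= 2 -> `|y - pt al be| <= r -> B0 y.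
  move=> a3 b2 /ptn; rewrite /B0 /= -sT => h; apply: (le_trans h).
  have : `|al| * (w * s) <= 3 * s by apply: ler_pM => //; exact: ltW.
  have : `|be| * (s * T) <= 2 * (s * T) by rewrite ler_wpM2r// mulr_ge0// ltW.
  by lra.
have coneb be y : 0 <= be <= 1 -> forall al, `|al| = 1 -> `|y - pt al be| <= r ->
    k * `|y - x0| <= w * s / 2.
  move=> b01 al a1 /ptn; rewrite a1 ger0_norm; last by case/andP: b01.
  move=> h.
  have : be * (s * T) <= s * T by rewrite ler_piMl ?mulr_ge0 ?(ltW s0)//; lra.
  move=> hb; have {}h : `|y - x0| <= s * (2 * (1 + T)).
    by apply: (le_trans h); have := mulr_ge0 (ltW s0) T0; lra.
  apply: (le_trans (ler_wpM2l (ltW k0) h)).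
  by rewrite -kT le_eqVlt; apply/orP; left; apply/eqP; field.
have inOmp be y : 0 <= be <= 1 -> `|y - pt (-1) be| <= r -> Omp y /\ `|y - x0| < r2.
  move=> b01 yr; have yB : B0 y.
    by have [t2 _ m3 _] := four_point_range (unit_range b01); exact: ptB yr.
  have yrho := rhoB _ yB; split; last exact: lt_le_trans yrho rho2.
  have [_ + _] := h1 y (lt_le_trans yrho rho1); apply.
  have := coneb be y b01 (-1) _ yr; rewrite normrN normr1 => /(_ erefl).
  by have := ptd _ _ _ yr; rewrite ler_norml => /andP[_]; lra.
have inOmm be y : 0 <= be <= 1 -> `|y - pt 1 be| <= r -> Omm y /\ `|y - x0| < r3.
  move=> b01 yr; have yB : B0 y.
    by have [t2 _ _ p3] := four_point_range (unit_range b01); exact: ptB yr.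
  have yrho := rhoB _ yB; split; last exact: lt_le_trans yrho rho3.
  have [_ _ +] := h1 y (lt_le_trans yrho rho1); apply.
  have := coneb be y b01 1 _ yr; rewrite normr1 => /(_ erefl).
  by have := ptd _ _ _ yr; rewrite ler_norml => /andP[+ _]; lra.
have [lz _ _] := wG i ord0.
pose Z c := mollified (cpt z i) B0 r c.
pose M := mollifier_mass m.+1 r.
have M0 : 0 < M by exact: mollifier_mass_gt0.
have ptv (al be t : R) : pt al be + t *: v = pt al (be + t).
  by apply/rowP => j; rewrite !mxE; ring.
have ptu (al be t : R) : pt al be + t *: (2 *: u) = pt (al + 2 * t) be.
  by apply/rowP => j; rewrite !mxE; ring.
have ptv1 (al be : R) : pt al be + v = pt al (be + 1) by rewrite -ptv scale1r.
have ptu1 (al be : R) : pt al be + 2 *: u = pt (al + 2) be.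
  by rewrite -[2 *: u]scale1r ptu mulr1.
have sw0 : 0 <= s * w by rewrite mulr_ge0// ltW.
have e1 : `|Z (pt (-1) 1) - Z (pt (-1) 0) - (s * Dp) * M| <= (s * w) * M.
  have := @mollified_increment R m.+1 Om (cpt z i) (fun j y => G y i j) B0 r (pt (-1) 0) v
    lz (wG i) r0 cB0 B0O.
  rewrite ptv1 add0r; apply=> //.
    move=> t y /four_point_range[t2 _ m3 p3]; rewrite ptv add0r; exact: ptB.
  apply: filterS aeG => y [hy _] [t t01]; rewrite ptv add0r => yr.
  have [py yr2] := inOmp _ _ t01 yr; rewrite (hy py).
  rewrite (_ : _ - _ = s * (\sum_j tau ord0 j * 'D_(Defs.basis j) (cpt yp i) y - Dp)).
    by rewrite normrM gtr0_norm// ler_wpM2l ?(ltW s0)//; exact: h2.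
  rewrite mulrBr; congr (_ - _); rewrite mulr_sumr; apply: eq_bigr => j _.
  by rewrite !mxE mulrA.
have e2 : `|Z (pt 1 1) - Z (pt 1 0) - (s * Dm) * M| <= (s * w) * M.
  have := @mollified_increment R m.+1 Om (cpt z i) (fun j y => G y i j) B0 r (pt 1 0) v
    lz (wG i) r0 cB0 B0O.
  rewrite ptv1 add0r; apply=> //.
    move=> t y /four_point_range[t2 _ m3 p3]; rewrite ptv add0r; exact: ptB.
  apply: filterS aeG => y [_ hy] [t t01]; rewrite ptv add0r => yr.
  have [my yr3] := inOmm _ _ t01 yr; rewrite (hy my).
  rewrite (_ : _ - _ = s * (\sum_j tau ord0 j * 'D_(Defs.basis j) (cpt ym i) y - Dm)).
    by rewrite normrM gtr0_norm// ler_wpM2l ?(ltW s0)//; exact: h3.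
  rewrite mulrBr; congr (_ - _); rewrite mulr_sumr; apply: eq_bigr => j _.
  by rewrite !mxE mulrA.
(* The comparison slope is 0: each coordinate of [2 *: u] is at most [2 w s], and each of the [N]
   entries of the gradient at most [C]. *)
have cross be : 0 <= be <= 1 ->
    `|Z (pt 1 be) - Z (pt (-1) be) - 0 * M| <= (2 * (w * s) * (N * C)) * M.
  move=> b01.
  have := @mollified_increment R m.+1 Om (cpt z i) (fun j y => G' y i j) B0 r (pt (-1) be)
    (2 *: u) lz (wG' i) r0 cB0 B0O.
  have -> : pt (-1) be + 2 *: u = pt 1 be by rewrite ptu1; congr pt; ring.
  apply=> //.
  - move=> t y /four_point_range[_ t3 _ _]; rewrite ptu; apply: ptB => //.
    by have [] := four_point_range (unit_range b01).
  - by rewrite !mulr_ge0 ?(ltW w0) ?(ltW s0).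
  apply: filterS hC => y hy [t t01]; rewrite ptu => yr.
  have [_ t3 _ _] := four_point_range (unit_range t01).
  have [b2 _ _ _] := four_point_range (unit_range b01).
  have yO : Om y by apply: B0O; exact: ptB yr.
  rewrite subr0; apply: (le_trans (ler_norm_sum _ _ _)).
  have -> : 2 * (w * s) * (N * C) = \sum_(j < m.+1) (2 * (w * s) * C).
    by rewrite sumr_const card_ord -[RHS]mulr_natl NE; ring.
  apply: ler_sum => j _; rewrite normrM; apply: ler_pM => //; last exact: hy.
  rewrite mxE normrM ger0_norm// ler_wpM2l//.
  exact: le_trans (coord_norm_le _ _) un.
have r00 : 0 <= (0 : R) <= 1 by rewrite lexx ler01.
have r11 : 0 <= (1 : R) <= 1 by rewrite lexx ler01.
have c0 := cross 0 r00; have c1 := cross 1 r11.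
exact: four_points s0 M0 e1 e2 c0 c1.
Qed.

Theorem glued_gradient_jump : glued_gradient Om Omp Omm yp ym ->
  rank_one_jump Omp Omm Gam yp ym nu.
Proof.
move=> glued.
pose J x : 'M[R]_m.+1 := Dmx_closure Omp yp x - Dmx_closure Omm ym x.
(* The row vector of [J nu], forced by applying the wanted identity to the unit vector [nu]. *)
pose a x : 'rV[R]_m.+1 := nu x *m (J x)^T.
have aE x i : a x ord0 i = \sum_j nu x ord0 j * J x i j.
  by rewrite !mxE; apply: eq_bigr => j _; rewrite !mxE.
exists a; last first.
  move=> x Gx; have [_ /(_ _ Gx) [nu1 _ _]] := nuP.
  have d1 := dotp_unit nu1.
  suff -> : tensor (a x) (nu x) = J x by rewrite /J subrKC.
  apply/matrixP => i j; rewrite mxE aE.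
  (* The tangential part of the j-th basis vector. As [J] kills it, column [j] of [J] is
     [nu x ord0 j] times [J nu]. *)
  pose tau : 'rV[R]_m.+1 := Defs.basis j - nu x ord0 j *: nu x.
  have tn : dotp tau (nu x) = 0.
    rewrite dotpDl dotpNl dotpZl d1 mulr1.
    rewrite (_ : dotp _ _ = nu x ord0 j) ?subrr// /dotp (bigD1 j)//= big1 => [|k kj].
      by rewrite !mxE !eqxx mul1r addr0.
    by rewrite !mxE (negbTE kj) andbF mul0r.
  have /eqP := jump_tangential i glued Gx tn; rewrite -subr_eq0 -sumrB.
  rewrite (_ : \sum_k _ = J x i j - nu x ord0 j * \sum_k nu x ord0 k * J x i k).
    by rewrite subr_eq0 => /eqP ->; rewrite mulrC.
  transitivity (\sum_k tau ord0 k * J x i k).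
    by apply: eq_bigr => k _; rewrite !mxE mulrBr.
  rewrite mulr_sumr -[J x i j](_ : \sum_k (Defs.basis j : 'rV[R]_m.+1) ord0 k * J x i k = _).
    rewrite -sumrB; apply: eq_bigr => k _; rewrite mulrA -mulrBl; congr (_ * _).
    by rewrite !mxE.
  rewrite (bigD1 j)//= big1 => [|k kj]; first by rewrite mxE !eqxx mul1r addr0.
  by rewrite mxE (negbTE kj) andbF mul0r.
apply/subspace_continuousP => x Gx.
have [xp xm] := Gam_closure Gp Gm Gx.
have nucvg j : (fun y => nu y ord0 j) @ within Gam (nbhs x) --> (nu x ord0 j : R).
  have [/subspace_continuousP/(_ x Gx)/cvgrPdist_lt cnu _] := nuP.
  apply/cvgrPdist_lt => e /cnu; apply: filterS => y; apply: le_lt_trans.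
  by have := coord_norm_le (nu x - nu y) j; rewrite !mxE.
have Dcvg O y i j : C1_closure_vec O y -> closure O x ->
    (fun t => Dmx_closure O y t i j) @ within Gam (nbhs x) --> (Dmx_closure O y x i j : R).
  move=> Cy Ox; have [U [_ OU [_ cD] _]] := extP (Cy i).
  rewrite (_ : (fun _ => _) = fun t => 'D_(Defs.basis j) (ext O (cpt y i)) t).
    rewrite mxE; apply: cvg_trans (cD j x (OU _ Ox)).
    exact/cvg_app/cvg_within.
  by apply/funext => t; rewrite mxE.
have acvg i : (fun y => a y ord0 i) @ within Gam (nbhs x) --> (a x ord0 i : R).
  rewrite aE (_ : (fun _ => _) = \sum_j (fun y => nu y ord0 j * J y i j)); last first.
    by apply/funext => y; rewrite aE fct_sumE.
  elim/big_ind2: _ => [|f u g v fu gv|j _]; [exact: cvg_cst|exact: cvgD|].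
  apply: cvgM => //; rewrite (_ : (fun _ => _) =
    (fun y => Dmx_closure Omp yp y i j - Dmx_closure Omm ym y i j)).
    by rewrite [J x i j]mxE [X in _ + X]mxE; apply: cvgB; exact: Dcvg.
  by apply/funext => y; rewrite [LHS]mxE [X in _ + X]mxE.
apply/cvgrPdist_lt => e e0.
have : \forall y \near within Gam (nbhs x), forall i, `|a x ord0 i - a y ord0 i| < e.
  by apply: filter_forall => i; have /cvgrPdist_lt := acvg i; apply.
by apply: filterS => y h; apply: rV_norm_lt => // i; have := h i; rewrite !mxE.
Qed.

End jump.

Theorem theorem3p2 (R : realType) (m : nat)
    (Om Omp Omm Gam : set 'rV[R]_m.+1)
    (yp ym nu : 'rV[R]_m.+1 -> 'rV[R]_m.+1) :
  (2 <= m.+1)%N ->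
  Ck_domain 1 Om -> bounded_set Om ->
  Om = Omp `|` Gam `|` Omm ->
  open Omp -> open Omm -> Omp `&` Omm = set0 ->
  Gam = Om `&` boundary Omp -> Gam = Om `&` boundary Omm ->
  Ck_surface 1 Gam ->
  C1_closure_vec Omp yp -> C1_closure_vec Omm ym ->
  outward_unit_normal Gam Omp nu ->
  (glued_gradient Om Omp Omm yp ym ->
     rank_one_jump Omp Omm Gam yp ym nu) /\
  (connected Gam \/ simply_connected R Om ->
     rank_one_jump Omp Omm Gam yp ym nu ->
     glued_gradient Om Omp Omm yp ym).
Proof.
move=> _ dOm bdOm OmE oOmp oOmm dis Gp Gm sG Cp Cm nuP.
have [[oOm _] _] := dOm.
split; first exact: (glued_gradient_jump oOm OmE oOmp oOmm dis Gp Gm sG Cp Cm nuP).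
exact: (rank_one_jump_glued dOm bdOm OmE oOmp oOmm dis Gp Gm sG Cp Cm nuP).
Qed.
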